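(* There exists an explicit algorithm that takes as input an integer $r\geq1$ and outputs the set $\mathcal{T}(r)$, using $O(r^{14}\log^{21} r)$ bit operations.
   Context: For hyperbolic $a\leq b\leq c$ in $\mathbb{Z}_{\geq2}\cup\{\infty\}$ (i.e.\ $\frac1a+\frac1b+\frac1c<1$, $1/\infty=0$): $\lambda_s=2\cos(2\pi/s)$ for $s\in\mathbb{Z}_{\geq2}$, $\lambda_\infty=2$, $2\cdot\infty=\infty$; $E=\mathbb{Q}(\lambda_a,\lambda_b,\lambda_c,\lambda_{2a}\lambda_{2b}\lambda_{2c})$; $\beta=\lambda_a+\lambda_b+\lambda_c+\lambda_{2a}\lambda_{2b}\lambda_{2c}+2$; $A$ is the quaternion algebra over $E$ with Hilbert symbol $(\lambda_b^2-4,(\lambda_b+2)(\lambda_c+2)\beta)$ (the $E$-algebra generated by the triangle group $\Delta(a,b,c)$); $\operatorname{adim}(a,b,c)$ is the number of real places of $E$ at which $A$ splits. $\mathcal{T}(r)$ is the (finite) set of such triples with $\operatorname{adim}(a,b,c)=r$. *)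

(* Defs.v *)
From HB Require Import structures.
From mathcomp Require Import all_boot all_order all_algebra.
From mathcomp Require Import all_classical all_reals all_analysis.
From mathcomp Require Import ring.
Import numFieldNormedType.Exports.
Import Order.TTheory GRing.Theory Num.Theory.

Set Implicit Arguments.
Unset Strict Implicit.
Unset Printing Implicit Defensive.

Local Open Scope classical_set_scope.
Local Open Scope ring_scope.

(* The algebra with Hilbert symbol (a, b) over K: the free K-module on
   1, i, j, ij with i^2 = a, j^2 = b, ji = -ij. *)
Definition quaternion (K : comNzRingType) (a b : K) : Type := 'rV[K]_4.

Section Quaternion.
Variables (K : comNzRingType) (a b : K).
Local Notation Q := (quaternion a b).

HB.instance Definition _ := GRing.Lmodule.copy Q 'rV[K]_4.

Definition mkquat (x0 x1 x2 x3 : K) : Q :=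
  \row_(i < 4) [:: x0; x1; x2; x3]`_i.

Definition qcoef (p : Q) (n : nat) : K := (p : 'rV[K]_4) 0 (inord n).

Definition onequat : Q := mkquat 1 0 0 0.

Definition mulquat (p q : Q) : Q :=
  let p_ := qcoef p in let q_ := qcoef q in
  mkquat
    (p_ 0%N * q_ 0%N + a * (p_ 1%N * q_ 1%N) + b * (p_ 2%N * q_ 2%N)
       - a * b * (p_ 3%N * q_ 3%N))
    (p_ 0%N * q_ 1%N + p_ 1%N * q_ 0%N - b * (p_ 2%N * q_ 3%N)
       + b * (p_ 3%N * q_ 2%N))
    (p_ 0%N * q_ 2%N + p_ 2%N * q_ 0%N + a * (p_ 1%N * q_ 3%N)
       - a * (p_ 3%N * q_ 1%N))
    (p_ 0%N * q_ 3%N + p_ 3%N * q_ 0%N + p_ 1%N * q_ 2%N - p_ 2%N * q_ 1%N).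

Lemma quatP (p q : Q) :
  qcoef p 0 = qcoef q 0 -> qcoef p 1 = qcoef q 1 ->
  qcoef p 2 = qcoef q 2 -> qcoef p 3 = qcoef q 3 -> p = q.
Proof.
move=> h0 h1 h2 h3; apply/rowP => i; rewrite -(inord_val i).
by case: i => -[|[|[|[|]]]].
Qed.

Lemma qcoefE x0 x1 x2 x3 :
  (qcoef (mkquat x0 x1 x2 x3) 0 = x0) * (qcoef (mkquat x0 x1 x2 x3) 1 = x1)
  * (qcoef (mkquat x0 x1 x2 x3) 2 = x2) * (qcoef (mkquat x0 x1 x2 x3) 3 = x3).
Proof. by rewrite /qcoef !mxE !inordK. Qed.

Lemma qcoefD (p q : Q) n : qcoef (p + q) n = qcoef p n + qcoef q n.
Proof. by rewrite /qcoef mxE. Qed.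

Lemma qcoefZ c (p : Q) n : qcoef (c *: p) n = c * qcoef p n.
Proof. by rewrite /qcoef mxE. Qed.

Lemma mulquatA : associative mulquat.
Proof. by move=> p q r; apply: quatP; rewrite /mulquat !qcoefE; ring. Qed.

Lemma mul1quat : left_id onequat mulquat.
Proof. by move=> p; apply: quatP; rewrite /mulquat !qcoefE; ring. Qed.

Lemma mulquat1 : right_id onequat mulquat.
Proof. by move=> p; apply: quatP; rewrite /mulquat !qcoefE; ring. Qed.

Lemma mulquatDl : left_distributive mulquat +%R.
Proof.
by move=> p q r; apply: quatP; rewrite /mulquat !(qcoefD, qcoefE); ring.
Qed.

Lemma mulquatDr : right_distributive mulquat +%R.
Proof.
by move=> p q r; apply: quatP; rewrite /mulquat !(qcoefD, qcoefE); ring.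
Qed.

Lemma onequat_neq0 : onequat != 0.
Proof.
apply/eqP => /rowP /(_ (inord 0)); rewrite !mxE inordK //= => /eqP.
by rewrite oner_eq0.
Qed.

HB.instance Definition _ := GRing.Zmodule_isNzRing.Build Q
  mulquatA mul1quat mulquat1 mulquatDl mulquatDr onequat_neq0.

Lemma scalequatAl c (p q : Q) : c *: (p * q) = (c *: p) * q.
Proof.
by apply: quatP; rewrite [in RHS]/GRing.mul /= /GRing.mul /= /mulquat
  !(qcoefZ, qcoefE); ring.
Qed.

HB.instance Definition _ := GRing.Lmodule_isLalgebra.Build K Q scalequatAl.

End Quaternion.

(* [quaternion (v a) (v b)] is the base change of [quaternion a b] along
   v : E -> K, since base change applies v to the structure constants. *)
Definition splits_at (E K : fieldType) (a b : E) (v : {rmorphism E -> K}) : Prop :=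
  exists f : {lrmorphism quaternion (v a) (v b) -> 'M[K]_2}, bijective f.

Section GeneratedField.
Variables (R : realType) (S : set R).

Definition in_genfield : {pred R} := fun x =>
  `[< forall F : {pred R}, divring_closed F -> (forall y, S y -> y \in F) ->
      x \in F >].

Lemma in_genfieldP x :
  reflect (forall F : {pred R}, divring_closed F ->
             (forall y, S y -> y \in F) -> x \in F)
          (x \in in_genfield).
Proof. exact: asboolP. Qed.

Lemma mem_genfield x : S x -> x \in in_genfield.
Proof. by move=> Sx; apply/in_genfieldP => F _; apply. Qed.

Fact genfield_divring_closed : divring_closed in_genfield.
Proof.
split.
- by apply/in_genfieldP => F [].
- move=> x y /in_genfieldP hx /in_genfieldP hy.
  apply/in_genfieldP => F cF SF; case: (cF) => _ cB _.
  by apply: cB; [apply: hx | apply: hy].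
- move=> x y /in_genfieldP hx /in_genfieldP hy.
  apply/in_genfieldP => F cF SF; case: (cF) => _ _ cV.
  by apply: cV; [apply: hx | apply: hy].
Qed.

HB.instance Definition _ :=
  GRing.isDivringClosed.Build R in_genfield genfield_divring_closed.

Record genfield : Type :=
  Genfield { genfield_val : R ; genfield_valP : genfield_val \in in_genfield }.

HB.instance Definition _ := [isSub for genfield_val].
HB.instance Definition _ := [Choice of genfield by <:].
HB.instance Definition _ := [SubChoice_isSubComUnitRing of genfield by <:].
HB.instance Definition _ :=
  [SubComUnitRing_isSubIntegralDomain of genfield by <:].
HB.instance Definition _ := [SubIntegralDomain_isSubField of genfield by <:].

End GeneratedField.

(* [None] stands for infinity. *)
Definition natinf : Type := option nat.

Definition triple : Type := (natinf * natinf * natinf)%type.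

Definition leqi (s t : natinf) : bool :=
  match s, t with
  | _, None => true
  | None, Some _ => false
  | Some m, Some n => (m <= n)%N
  end.

Definition doublei (s : natinf) : natinf := omap double s.

Definition invi (s : natinf) : rat := if s is Some n then n%:R^-1 else 0.

Definition hyperbolic (t : triple) : Prop :=
  let: (a, b, c) := t in
  [/\ [&& leqi (Some 2%N) a, leqi (Some 2%N) b & leqi (Some 2%N) c],
      leqi a b && leqi b c
    & invi a + invi b + invi c < 1].

Section ArithmeticDimension.
Variable R : realType.

Definition lambda (s : natinf) : R :=
  if s is Some n then 2 * cos (2 * pi / n%:R) else 2.

Definition lambda2_prod (t : triple) : R :=
  let: (a, b, c) := t in
  lambda (doublei a) * lambda (doublei b) * lambda (doublei c).

Definition trace_gens (t : triple) : set R :=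
  let: (a, b, c) := t in
  [set lambda a; lambda b; lambda c; lambda2_prod t].

Definition trace_field (t : triple) : fieldType := genfield (trace_gens t).

Definition beta (t : triple) : R :=
  let: (a, b, c) := t in
  lambda a + lambda b + lambda c + lambda2_prod t + 2.

(* When b is infinite, lambda_b ^ 2 - 4 = 0 and the generic symbol does not
   define a quaternion algebra. The algebra generated by the triangle group
   then contains nontrivial unipotents, hence is the matrix algebra, whose
   symbol is (1, 1). *)
Definition symbol (t : triple) : R * R :=
  let: (a, b, c) := t in
  if b is Some _ then
    (lambda b ^+ 2 - 4, (lambda b + 2) * (lambda c + 2) * beta t)
  else (1, 1).

Lemma symbol_in (t : triple) :
  ((symbol t).1 \in in_genfield (trace_gens t)) &&
  ((symbol t).2 \in in_genfield (trace_gens t)).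
Proof.
case: t => [[a [b|]] c]; last by rewrite /= rpred1.
set S := trace_gens _.
have ha : lambda a \in in_genfield S by apply: mem_genfield; left; left; left.
have hb : lambda (Some b) \in in_genfield S
  by apply: mem_genfield; left; left; right.
have hc : lambda c \in in_genfield S by apply: mem_genfield; left; right.
have hp : lambda2_prod (a, Some b, c) \in in_genfield S
  by apply: mem_genfield; right.
apply/andP; split; first by rewrite rpredB ?rpredX ?rpred_nat.
by apply: rpredM; [apply: rpredM|];
  do ?[exact: ha | exact: hb | exact: hc | exact: hp | exact: rpred_nat
      | apply: rpredD].
Qed.

Definition symbol1 (t : triple) : trace_field t :=
  Genfield (proj1 (andP (symbol_in t))).

Definition symbol2 (t : triple) : trace_field t :=
  Genfield (proj2 (andP (symbol_in t))).

(* Real places of the totally real field E are identified with the field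
   embeddings E -> R. *)
Definition split_places (t : triple) : set {rmorphism trace_field t -> R} :=
  [set v | splits_at (symbol1 t) (symbol2 t) v].

Arguments split_places t : clear implicits.

Definition has_adim (t : triple) (r : nat) : Prop :=
  (split_places t #= `I_r)%card.

Definition triples_of_adim (r : nat) : set triple :=
  [set t | hyperbolic t /\ has_adim t r].

End ArithmeticDimension.

(* Deterministic programs acting on finitely many registers, each a stack of
   bits. Every primitive touches one bit and costs one bit operation. Two
   stacks make up one tape, so this is the multitape Turing machine in
   structured form: each simulates the other with constant-factor overhead. *)
Inductive prog : Type :=
| Skip
| Push (x : nat) (bit : bool)
| Pop (x : nat)
| Seq (p q : prog)
| Case (x : nat) (pempty pfalse ptrue : prog)
| While (x : nat) (p : prog).

Definition store : Type := nat -> seq bool.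

Definition update (s : store) (x : nat) (w : seq bool) : store :=
  fun y => if y == x then w else s y.

Definition select (T : Type) (w : seq bool) (pempty pfalse ptrue : T) : T :=
  match w with
  | [::] => pempty
  | false :: _ => pfalse
  | true :: _ => ptrue
  end.

(* [exec p s s' n]: started in s, p halts in s' after n bit operations. *)
Inductive exec : prog -> store -> store -> nat -> Prop :=
| ExecSkip s : exec Skip s s 0
| ExecPush s x bit : exec (Push x bit) s (update s x (bit :: s x)) 1
| ExecPop s x : exec (Pop x) s (update s x (behead (s x))) 1
| ExecSeq p q s s1 s2 m n :
    exec p s s1 m -> exec q s1 s2 n -> exec (Seq p q) s s2 (m + n)
| ExecCase x p0 p1 p2 s s' n :
    exec (select (s x) p0 p1 p2) s s' n -> exec (Case x p0 p1 p2) s s' n.+1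
| ExecWhileStop x p s : s x = [::] -> exec (While x p) s s 1
| ExecWhileStep x p s s1 s2 m n :
    s x <> [::] -> exec p s s1 m -> exec (While x p) s1 s2 n ->
    exec (While x p) s s2 (m + n).+1.

(* Binary expansion, least significant bit first, without leading zeros. *)
Definition binary (n : nat) : seq bool :=
  mkseq (fun i => odd (n %/ 2 ^ i)) (up_log 2 n.+1).

(* Each digit is preceded by [true] and the numeral is closed by [false];
   infinity is the empty numeral, which encodes no finite index >= 2. *)
Definition encode_index (s : natinf) : seq bool :=
  flatten [seq [:: true; d] | d <- binary (odflt 0%N s)] ++ [:: false].

Definition encode_triple (t : triple) : seq bool :=
  let: (a, b, c) := t in encode_index a ++ encode_index b ++ encode_index c.

Definition encode_triples (l : seq triple) : seq bool :=
  flatten [seq encode_triple t | t <- l].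

(* Register 0 holds the input at the start, and the output at the end; the
   output lists each element of the set exactly once, in any order. *)
Definition outputs_set (p : prog) (r : nat) (T : set triple) (n : nat) : Prop :=
  exists (l : seq triple) (s : store),
    [/\ uniq l, [set` l] = T,
        exec p (update (fun=> [::]) 0 (binary r)) s n
      & s 0%N = encode_triples l].

(* Main.v *)
(* Let D be the product of the finite entries of a triple (a, b, c). The
   generators of E are values of integer polynomials at a primitive 2D-th root
   of unity z, so every real place of E is induced by some z |-> z^k with k
   prime to 2D. For finite b the first entry of the symbol is negative there, so
   A splits exactly when beta is positive; for infinite b, A splits and beta is
   positive everywhere. The conjugate of beta is 16 times the product of the
   cosines of k (pi / 2) (1/a +- 1/b +- 1/c), so its sign is a parity of integer
   quotients. Hence adim (a, b, c) is the number of k that split divided by the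
   number of k that fix the generators.

   Every prime k < a / 3 that does not divide 2D splits, and these primes give
   distinct places; the same holds for k < b / (2 a) and for k < c / (a b).
   Chebyshev's lower bound on the number of primes then gives a <= n, b <= n^2
   and c <= n^4 with n = O(r log r). The program tries the n^7 triples of this
   box, and for each of them the at most n^7 odd k < 2D, updating the residues
   of k modulo 2D additively and testing coprimality with a binary gcd. Each k
   costs O(log^2 r), which gives O(n^14 log^2 r) = O(r^14 log^16 r). *)

Require Import Defs.
From HB Require Import structures.
From mathcomp Require Import all_boot all_order all_algebra.
From mathcomp Require Import algC cyclotomic complex.
From mathcomp Require Import all_classical all_reals all_analysis.
From mathcomp Require Import zify ring lra.
Import numFieldNormedType.Exports.
Import Order.TTheory GRing.Theory Num.Theory.

Set Implicit Arguments.
Unset Strict Implicit.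
Unset Printing Implicit Defensive.

Local Open Scope classical_set_scope.
Local Open Scope ring_scope.

(** * Programs on binary numerals *)

(** The exponents [k] that induce a given real place form a coset of the group of those fixing the
    generators, which explains the quotient of two counts. The program compares one count with [r]
    times the other, so it never divides and never constructs [E].

    The primes [k] in the three ranges split for different reasons. Below [a / 3] no cosine has yet
    changed sign. Below [b / (2 a)] the four frequencies are so close to [1/a] that all four cosines
    have changed sign equally often. Below [c / (a b)] the frequencies pair off around [1/a + 1/b]
    and [1/a - 1/b]. The last two cases need an exact common frequency at which the cosine does not
    vanish, and this is where coprimality enters.

    The bound is self-referential: if [m] is the largest range, then [D] is bounded by a constant
    times [m^7], so at most [O(log m)] primes divide [2D], and Chebyshev gives
    [m / log m = O(r + log m)]. A bootstrap on the bit length of [m] turns this into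
    [m = O(r log r)]. *)

Section Binary.
Local Open Scope nat_scope.

Definition bval (w : seq bool) : nat := foldr (fun (b : bool) v => b + v.*2) 0 w.

Lemma binary0 : binary 0 = [::]. Proof. by []. Qed.

Lemma up_log2_half n : 0 < n -> up_log 2 n.+1 = (up_log 2 n./2.+1).+1.
Proof.
move=> n0; apply: up_log_eq => //.
have h1 := @up_log_bounds 2 n./2.+1 isT.
have h2 := @up_logP 2 n./2.+1 isT.
have h3 := odd_double_half n.
rewrite expnS; apply/andP; split; last by lia.
case E: (n./2) => [|m]; first by rewrite up_log1 /=; lia.
move: h1 h2; rewrite E; set u := up_log _ _ => h1 h2.
have {}h1 := h1 isT.
have up0 : 0 < u by rewrite up_log_gt0.
have -> : 2 ^ u = 2 * 2 ^ u.-1 by rewrite -expnS prednK.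
by case/andP: h1 => h1 _; lia.
Qed.

Lemma binaryE n : 0 < n -> binary n = odd n :: binary n./2.
Proof.
move=> n0; rewrite /binary up_log2_half // /mkseq /= expn0 divn1.
congr (_ :: _); rewrite (iotaDl 1 0) -map_comp; apply: eq_map => i /=.
by rewrite add1n expnS divnMA divn2.
Qed.

Lemma size_binary n : size (binary n) = up_log 2 n.+1.
Proof. exact: size_mkseq. Qed.

Lemma size_binary_le n m : n < 2 ^ m -> size (binary n) <= m.
Proof. by move=> h; rewrite size_binary up_log_min. Qed.

Lemma binaryK n : bval (binary n) = n.
Proof.
elim/ltn_ind: n => -[//|n] IH; rewrite binaryE //= IH; last by lia.
by have := odd_double_half n.+1; lia.
Qed.

(** The hypothesis makes the most significant digit a one; the default [true] admits the empty
    numeral of 0. *)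
Lemma bvalK w : last true w -> binary (bval w) = w.
Proof.
elim: w => [//|b w IH] /= h.
have pos : last b w -> 0 < b + (bval w).*2.
  case: w {IH} h => [|c w] /=; first by move->.
  elim: w c => [|d w IH] c /=; first by move->; lia.
  by move=> h _; have := IH _ h h; lia.
rewrite binaryE ?pos //; congr (_ :: _); first by rewrite oddD odd_double addbF; case: b {h pos}.
rewrite half_bit_double; apply: IH.
by case: w h {pos}.
Qed.

Lemma behead_binary n : behead (binary n) = binary n./2.
Proof. by case: n => [//|n]; rewrite binaryE. Qed.

Lemma bval_rcons w (b : bool) : bval (rcons w b) = bval w + 2 ^ size w * b.
Proof. by elim: w => [|c w IH] /=; [case: b|rewrite IH expnS; lia]. Qed.

Lemma bval_lt w : bval w < 2 ^ size w.
Proof. by elim: w => [//|b w IH] /=; rewrite expnS; case: b; lia. Qed.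

End Binary.

Section Programs.
Local Open Scope nat_scope.

(** An upper bound in place of the exact cost, so that the costs of parts can be rounded up before
    they are added. *)
Definition runs (p : prog) (s s' : store) (T : nat) : Prop :=
  exists2 n, n <= T & exec p s s' n.

Lemma runsW p s s' T T' : T <= T' -> runs p s s' T -> runs p s s' T'.
Proof. by move=> h [n hn e]; exists n => //; apply: leq_trans h. Qed.

Lemma runs_to p s s1 s' T T' :
  runs p s s1 T -> s1 = s' -> T <= T' -> runs p s s' T'.
Proof. by move=> h <- /runsW; apply. Qed.

Lemma runs_skip s T : runs Skip s s T.
Proof. by exists 0 => //; constructor. Qed.

Lemma runs_push s x b : runs (Push x b) s (update s x (b :: s x)) 1.
Proof. by exists 1 => //; constructor. Qed.

Lemma runs_pop s x : runs (Pop x) s (update s x (behead (s x))) 1.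
Proof. by exists 1 => //; constructor. Qed.

Lemma runs_seq p q s s1 s2 T1 T2 :
  runs p s s1 T1 -> runs q s1 s2 T2 -> runs (Seq p q) s s2 (T1 + T2).
Proof.
move=> [m hm e1] [n hn e2]; exists (m + n); first exact: leq_add.
exact: ExecSeq e1 e2.
Qed.

Lemma runs_case x p0 p1 p2 s s' T :
  runs (select (s x) p0 p1 p2) s s' T -> runs (Case x p0 p1 p2) s s' T.+1.
Proof. by move=> [n hn e]; exists n.+1 => //; constructor. Qed.

Lemma runs_stop x p s : s x = [::] -> runs (While x p) s s 1.
Proof. by exists 1 => //; constructor. Qed.

Lemma runs_step x p s s1 s2 T1 T2 :
  s x <> [::] -> runs p s s1 T1 -> runs (While x p) s1 s2 T2 ->
  runs (While x p) s s2 (T1 + T2).+1.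
Proof.
move=> hx [m hm e1] [n hn e2]; exists (m + n).+1; first by rewrite ltnS leq_add.
exact: ExecWhileStep e1 e2.
Qed.

Lemma updateE s x w : update s x w x = w.
Proof. by rewrite /update eqxx. Qed.

Lemma updateN s x y w : y != x -> update s x w y = s y.
Proof. by rewrite /update => /negbTE ->. Qed.

Lemma update_same s x : update s x (s x) = s.
Proof. by apply/funext => y; rewrite /update; case: eqP => // ->. Qed.

Lemma updateK s x w w' : update (update s x w) x w' = update s x w'.
Proof. by apply/funext => y; rewrite /update; case: eqP. Qed.

Lemma updateC s x y w w' : x != y ->
  update (update s x w) y w' = update (update s y w') x w.
Proof.
move=> xy; apply/funext => z; rewrite /update.
by case: (eqVneq z y) => // ->; rewrite eq_sym (negbTE xy).
Qed.

(** A bit can be read only by branching, hence one branch for each value; the branch for the empty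
    stack is never taken, since [While] has just tested it. The contents arrive reversed. *)
Definition move_stack x y :=
  While x (Case x Skip (Seq (Pop x) (Push y false)) (Seq (Pop x) (Push y true))).

Lemma runs_move x y s : x != y ->
  runs (move_stack x y) s (update (update s x [::]) y (catrev (s x) (s y)))
    (4 * size (s x)).+1.
Proof.
move=> xy; move E: (s x) => w; elim: w s E => [|b w IH] s E.
  by rewrite /= -E !update_same; apply: runs_stop.
set s1 := update (update s x w) y (b :: s y).
have e1 : s1 x = w by rewrite /s1 updateN // updateE.
have e2 : s1 y = b :: s y by rewrite /s1 updateE.
have := IH s1 e1; rewrite e2.
have -> : update (update s1 x [::]) y (catrev w (b :: s y)) =
          update (update s x [::]) y (catrev (b :: w) (s y)).
  by rewrite /s1 -(@updateC _ x y) // !updateK updateC // updateK.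
move=> h; apply: (runsW _ (runs_step _ _ h)); last first.
- apply: runs_case; rewrite E.
  have -> : select (b :: w) Skip (Seq (Pop x) (Push y false))
     (Seq (Pop x) (Push y true)) = Seq (Pop x) (Push y b) by case: (b).
  apply: runs_seq (runs_pop _ _) _; rewrite E /=.
  have -> : s1 = update (update s x w) y (b :: (update s x w) y).
    by rewrite /s1 updateN // eq_sym.
  exact: runs_push.
- by rewrite E.
- by rewrite /=; lia.
Qed.

Definition move2_stack x y z :=
  While x (Case x Skip
    (Seq (Pop x) (Seq (Push y false) (Push z false)))
    (Seq (Pop x) (Seq (Push y true) (Push z true)))).

Lemma runs_move2 x y z s : x != y -> x != z -> y != z ->
  runs (move2_stack x y z) s
    (update (update (update s x [::]) y (catrev (s x) (s y)))
       z (catrev (s x) (s z)))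
    (5 * size (s x)).+1.
Proof.
move=> xy xz yz; move E: (s x) => w; elim: w s E => [|b w IH] s E.
  rewrite /=; apply: runs_to (runs_stop _ E) _ _ => //.
  apply/funext => u; rewrite /update.
  by case: eqP => [->|_] //; case: eqP => [->|_] //; case: eqP => [->|].
set s1 := update (update (update s x w) y (b :: s y)) z (b :: s z).
have e1 : s1 x = w by rewrite /s1 2?updateN // updateE.
have e2 : s1 y = b :: s y by rewrite /s1 updateN ?updateE.
have e3 : s1 z = b :: s z by rewrite /s1 updateE.
have := IH s1 e1; rewrite e2 e3.
have -> : update (update (update s1 x [::]) y (catrev w (b :: s y))) z
             (catrev w (b :: s z)) =
   update (update (update s x [::]) y (catrev (b :: w) (s y))) z
     (catrev (b :: w) (s z)).
  apply/funext => u; rewrite /s1 /update.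
  by case: eqP => // _; case: eqP => // _; case: eqP.
move=> h; apply: (runsW _ (runs_step _ _ h)); last first.
- apply: runs_case; rewrite E.
  have -> : select (b :: w) Skip
    (Seq (Pop x) (Seq (Push y false) (Push z false)))
    (Seq (Pop x) (Seq (Push y true) (Push z true)))
     = Seq (Pop x) (Seq (Push y b) (Push z b)) by case: (b).
  apply: runs_seq (runs_pop _ _) _; rewrite E /=.
  apply: runs_seq (runs_push _ _ _) _.
  have -> : s1 = update (update (update s x w) y (b :: (update s x w) y)) z
    (b :: (update (update s x w) y (b :: (update s x w) y)) z).
    by rewrite /s1 (@updateN _ x y) 1?eq_sym // !(@updateN _ _ z) // eq_sym.
  exact: runs_push.
- by rewrite E.
- by rewrite /=; lia.
Qed.

Definition clear x := While x (Pop x).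

Lemma runs_clear x s :
  runs (clear x) s (update s x [::]) (2 * size (s x)).+1.
Proof.
move E: (s x) => w; elim: w s E => [|b w IH] s E.
  by rewrite -[X in update s x X]E update_same; apply: runs_stop.
have := IH (update s x w) (updateE _ _ _); rewrite updateK => h.
apply: (runsW _ (runs_step _ _ h)); last first.
- have := runs_pop s x; rewrite E /=; exact.
- by rewrite E.
- by rewrite /=; lia.
Qed.

(* Register 0 holds the output, registers 1 to 4 are scratch stacks, and
   register [x + 5] holds the binary expansion of the variable [x]. *)
Definition mem (out t1 t2 t3 t4 : seq bool) (e : nat -> nat) : store :=
  fun r => match r with
  | 0 => out | 1 => t1 | 2 => t2 | 3 => t3 | 4 => t4 | x.+4.+1 => binary (e x)
  end.

Definition upd (e : nat -> nat) (x v : nat) : nat -> nat :=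
  fun y => if y == x then v else e y.

Lemma mem_update0 o t1 t2 t3 t4 e w :
  update (mem o t1 t2 t3 t4 e) 0 w = mem w t1 t2 t3 t4 e.
Proof. by apply/funext => -[|[|[|[|[|x]]]]]. Qed.
Lemma mem_update1 o t1 t2 t3 t4 e w :
  update (mem o t1 t2 t3 t4 e) 1 w = mem o w t2 t3 t4 e.
Proof. by apply/funext => -[|[|[|[|[|x]]]]]. Qed.
Lemma mem_update2 o t1 t2 t3 t4 e w :
  update (mem o t1 t2 t3 t4 e) 2 w = mem o t1 w t3 t4 e.
Proof. by apply/funext => -[|[|[|[|[|x]]]]]. Qed.
Lemma mem_update3 o t1 t2 t3 t4 e w :
  update (mem o t1 t2 t3 t4 e) 3 w = mem o t1 t2 w t4 e.
Proof. by apply/funext => -[|[|[|[|[|x]]]]]. Qed.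
Lemma mem_update4 o t1 t2 t3 t4 e w :
  update (mem o t1 t2 t3 t4 e) 4 w = mem o t1 t2 t3 w e.
Proof. by apply/funext => -[|[|[|[|[|x]]]]]. Qed.
Lemma mem_update5 o t1 t2 t3 t4 e x v :
  update (mem o t1 t2 t3 t4 e) x.+4.+1 (binary v) = mem o t1 t2 t3 t4 (upd e x v).
Proof.
by apply/funext => -[|[|[|[|[|y]]]]] //; rewrite /update /= /upd !eqSS; case: eqP.
Qed.
Lemma mem_update5nil o t1 t2 t3 t4 e x :
  update (mem o t1 t2 t3 t4 e) x.+4.+1 [::] = mem o t1 t2 t3 t4 (upd e x 0).
Proof. exact: mem_update5 0. Qed.

Definition mem_updateE := (mem_update0, mem_update1, mem_update2, mem_update3,
  mem_update4, mem_update5, mem_update5nil).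

Lemma updE e x v : upd e x v x = v.
Proof. by rewrite /upd eqxx. Qed.

Lemma updK e x v v' : upd (upd e x v) x v' = upd e x v'.
Proof. by apply/funext => y; rewrite /upd; case: eqP. Qed.

Lemma upd_same e x : upd e x (e x) = e.
Proof. by apply/funext => y; rewrite /upd; case: eqP => // ->. Qed.

Inductive operand := Var of nat | Lit of nat.

Definition oval (e : nat -> nat) (o : operand) : nat :=
  match o with Var x => e x | Lit n => n end.

Definition push_all t (w : seq bool) := foldr (fun b p => Seq p (Push t b)) Skip w.

Lemma runs_push_all t w s :
  runs (push_all t w) s (update s t (w ++ s t)) (size w).
Proof.
elim: w => [|b w IH] /=; first by rewrite update_same; apply: runs_skip.
rewrite -[X in runs _ _ _ X]addn1; apply: runs_seq IH _.
set s1 := update s t _.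
have -> : update s t (b :: w ++ s t) = update s1 t (b :: s1 t).
  by rewrite /s1 updateE updateK.
exact: runs_push.
Qed.

(** Reading a register destroys it. The copy passes through the scratch stack 3: two reversals
    restore the order, and the second one rebuilds the variable along with the copy. *)
Definition load o t :=
  match o with
  | Var x => Seq (move_stack x.+4.+1 3) (move2_stack 3 x.+4.+1 t)
  | Lit n => push_all t (binary n)
  end.

Lemma catrev_catrev (w u v : seq bool) : catrev (catrev w u) v = catrev u (w ++ v).
Proof. by rewrite !catrevE rev_cat revK catA. Qed.

Lemma runs_load1 W o out t2 t4 e : oval e o < 2 ^ W ->
  runs (load o 1) (mem out [::] t2 [::] t4 e)
    (mem out (binary (oval e o)) t2 [::] t4 e) (9 * W + 2).
Proof.
move/size_binary_le; case: o => [x|n] h.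
  have h1 := @runs_move x.+4.+1 3 (mem out [::] t2 [::] t4 e) isT.
  rewrite /= !mem_updateE in h1.
  have h2 := runs_seq h1 (@runs_move2 3 x.+4.+1 1 _ isT isT isT).
  rewrite /= !mem_updateE !updE binary0 !catrev_catrev /= cats0 in h2.
  apply: runs_to h2 _ _.
    by rewrite mem_update5 mem_update1 updK upd_same.
  by rewrite catrevE cats0 size_rev; move: h; rewrite /=; lia.
apply: runs_to (runs_push_all _ _ _) _ _; first by rewrite mem_update1 /= cats0.
by move: h => /=; lia.
Qed.

Lemma runs_load2 W o out t1 t4 e : oval e o < 2 ^ W ->
  runs (load o 2) (mem out t1 [::] [::] t4 e)
    (mem out t1 (binary (oval e o)) [::] t4 e) (9 * W + 2).
Proof.
move/size_binary_le; case: o => [x|n] h.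
  have h1 := @runs_move x.+4.+1 3 (mem out t1 [::] [::] t4 e) isT.
  rewrite /= !mem_updateE in h1.
  have h2 := runs_seq h1 (@runs_move2 3 x.+4.+1 2 _ isT isT isT).
  rewrite /= !mem_updateE !updE binary0 !catrev_catrev /= cats0 in h2.
  apply: runs_to h2 _ _.
    by rewrite mem_update5 mem_update2 updK upd_same.
  by rewrite catrevE cats0 size_rev; move: h; rewrite /=; lia.
apply: runs_to (runs_push_all _ _ _) _ _; first by rewrite mem_update2 /= cats0.
by move: h => /=; lia.
Qed.

(* Bit-serial processing of the stacks 1 and 2, padded with zeros: the bits
   [f carry x y] are pushed on the stack 3, and the stack 4 holds the carry. *)
Section Ripple.
Variables f g : bool -> bool -> bool -> bool.

Definition ripple_leaf c x y :=
  Seq (Pop 1) (Seq (Pop 2) (Seq (Pop 4) (Seq (Push 4 (g c x y)) (Push 3 (f c x y))))).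

Definition ripple_step :=
  let r2 c x := Case 2 (ripple_leaf c x false) (ripple_leaf c x false)
                       (ripple_leaf c x true) in
  let r1 c := Case 1 (r2 c false) (r2 c false) (r2 c true) in
  Case 4 (r1 false) (r1 false) (r1 true).

Lemma runs_ripple_leaf c x y out xs ys o w e :
  runs (ripple_leaf c x y) (mem out xs ys o w e)
    (mem out (behead xs) (behead ys) (f c x y :: o) (g c x y :: behead w) e) 5.
Proof.
have h1 := runs_pop (mem out xs ys o w e) 1; rewrite mem_updateE /= in h1.
have h2 := runs_pop (mem out (behead xs) ys o w e) 2; rewrite mem_updateE /= in h2.
have h3 := runs_pop (mem out (behead xs) (behead ys) o w e) 4.
rewrite mem_updateE /= in h3.
have h4 := runs_push (mem out (behead xs) (behead ys) o (behead w) e) 4 (g c x y).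
rewrite mem_updateE /= in h4.
have h5 := runs_push (mem out (behead xs) (behead ys) o (g c x y :: behead w) e) 3 (f c x y).
rewrite mem_updateE /= in h5.
exact: runs_seq h1 (runs_seq h2 (runs_seq h3 (runs_seq h4 h5))).
Qed.

Lemma runs_ripple_step c out xs ys o e :
  let x := head false xs in let y := head false ys in
  runs ripple_step (mem out xs ys o [:: c] e)
    (mem out (behead xs) (behead ys) (f c x y :: o) [:: g c x y] e) 8.
Proof.
move=> x y; have h := runs_ripple_leaf c x y out xs ys o [:: c] e.
apply: runs_case; case: c h => /= h; apply: runs_case;
  case: xs @x h => [|[] xs] /= h; apply: runs_case;
  by case: ys @y h => [|[] ys] h.
Qed.

(** The second loop finishes the digits of stack 2 beyond the length of stack 1, where the empty
    stack reads as zeros. Addition and subtraction share this loop and differ only in [f], [g] and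
    the invariant [P]. *)
Definition ripple := Seq (While 1 ripple_step) (While 2 ripple_step).

Variable P : seq bool -> seq bool -> seq bool -> bool -> Prop.
Hypothesis stepP : forall xs ys o c, P xs ys o c ->
  P (behead xs) (behead ys) (f c (head false xs) (head false ys) :: o)
    (g c (head false xs) (head false ys)).

Lemma runs_ripple1 out xs ys o c e : P xs ys o c ->
  exists ys' o' c', [/\ P [::] ys' o' c', size ys' <= size ys,
    size o' = size o + size xs &
    runs (While 1 ripple_step) (mem out xs ys o [:: c] e)
      (mem out [::] ys' o' [:: c'] e) (9 * size xs).+1].
Proof.
elim: xs ys o c => [|x xs IH] ys o c h.
  by exists ys, o, c; split => //; [rewrite addn0|apply: runs_stop].
have /IH [ys' [w' [c' [h1 h2 h3 h4]]]] := stepP h.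
exists ys', w', c'; split => //.
- by apply: leq_trans h2 _; rewrite size_behead leq_pred.
- by rewrite h3 /=; lia.
- apply: (@runsW _ _ _ (8 + (9 * size xs).+1).+1); first by rewrite /=; lia.
  by apply: runs_step _ (runs_ripple_step _ _ _ _ _ _) h4.
Qed.

Lemma runs_ripple2 out ys o c e : P [::] ys o c ->
  exists o' c', [/\ P [::] [::] o' c', size o' = size o + size ys &
    runs (While 2 ripple_step) (mem out [::] ys o [:: c] e)
      (mem out [::] [::] o' [:: c'] e) (9 * size ys).+1].
Proof.
elim: ys o c => [|y ys IH] o c h.
  by exists o, c; split => //; [rewrite addn0|apply: runs_stop].
have /IH [w' [c' [h1 h3 h4]]] := stepP h.
exists w', c'; split => //.
- by rewrite h3 /=; lia.
- apply: (@runsW _ _ _ (8 + (9 * size ys).+1).+1); first by rewrite /=; lia.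
  by apply: runs_step _ (runs_ripple_step _ _ _ _ _ _) h4.
Qed.

Lemma runs_ripple W out xs ys c e : P xs ys [::] c ->
  size xs <= W -> size ys <= W ->
  exists o' c', [/\ P [::] [::] o' c', size o' <= 2 * W &
    runs ripple (mem out xs ys [::] [:: c] e)
      (mem out [::] [::] o' [:: c'] e) (18 * W + 2)].
Proof.
move=> h hx hy.
have [ys1 [w1 [c1 [h1 s1 s2 r1]]]] := runs_ripple1 out e h.
have [w2 [c2 [h2 s3 r2]]] := runs_ripple2 out e h1.
exists w2, c2; split => //; first by rewrite s3 s2 /=; lia.
by apply: runsW (runs_seq r1 r2); lia.
Qed.

End Ripple.

Definition maj (c x y : bool) := [|| c && x, c && y | x && y].
Definition xor3 (c x y : bool) := c (+) (x (+) y).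
Definition borrow (c x y : bool) := if x then c && y else c || y.

(** The top of stack 3 is the most significant digit. Zeros are dropped until the first one; moving
    the rest then restores the order of [binary], and ends the loop by emptying the stack. *)
Definition strip z := While 3 (Case 3 Skip (Pop 3) (move_stack 3 z)).

Lemma runs_strip z out o t4 e : e z = 0 ->
  runs (strip z.+4.+1) (mem out [::] [::] o t4 e)
    (mem out [::] [::] [::] t4 (upd e z (bval (rev o)))) (4 * size o + 4).
Proof.
move=> ez; elim: o => [|b o IH]; last case: b.
- apply: runs_to (runs_stop _ _) _ _ => //=; by rewrite -{1}ez upd_same.
- have h := @runs_move 3 z.+4.+1 (mem out [::] [::] (true :: o) t4 e) isT.
  rewrite /= mem_updateE ez binary0 -[catrev o _]/(rev (true :: o)) in h.
  rewrite -(bvalK (w := rev (true :: o))) in h; last first.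
    by rewrite rev_cons last_rcons.
  rewrite mem_update5 in h.
  apply: (runsW _ (runs_step _ (runs_case _) (runs_stop _ _))) => //; last exact: h.
  by rewrite /=; lia.
- apply: (runsW _ (runs_step _ (runs_case _) _)) => //=; last first.
  + rewrite rev_cons bval_rcons muln0 addn0; exact: IH.
  + have := runs_pop (mem out [::] [::] (false :: o) t4 e) 3.
    rewrite mem_update3 /=; exact.
  + by lia.
Qed.

(** Both operands are loaded before [z] is cleared, so [z] may coincide with [x] or [y]. The last
    carry becomes the top digit. *)
Definition add_to z x y :=
  Seq (load x 1) (Seq (load y 2) (Seq (Push 4 false) (Seq (ripple xor3 maj)
    (Seq (Case 4 Skip Skip (Push 3 true)) (Seq (Pop 4)
    (Seq (clear z.+4.+1) (strip z.+4.+1))))))).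

Lemma bval_head xs : bval xs = head false xs + (bval (behead xs)).*2.
Proof. by case: xs. Qed.

(** Invariant of the ripple loop: digits already written plus the shifted sum of the carry and what
    remains of the operands. At the end only digits and carry are left. *)
Lemma add_step xs ys o (c : bool) V :
  bval (rev o) + 2 ^ size o * (c + bval xs + bval ys) = V ->
  let x := head false xs in let y := head false ys in
  bval (rev (xor3 c x y :: o)) + 2 ^ size (xor3 c x y :: o) *
    (maj c x y + bval (behead xs) + bval (behead ys)) = V.
Proof.
move=> <- x y; rewrite rev_cons bval_rcons size_rev /= expnS.
rewrite (bval_head xs) (bval_head ys) -/x -/y.
by case: c; case: x; case: y; rewrite /xor3 /maj /=; lia.
Qed.

(** This is [X - Y = bval (rev o) + 2 ^ size o * (bval xs - bval ys - c)], arranged so that no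
    natural number is subtracted. *)
Lemma sub_step xs ys o (c : bool) X Y :
  X + 2 ^ size o * (c + bval ys) = Y + bval (rev o) + 2 ^ size o * bval xs ->
  let x := head false xs in let y := head false ys in
  X + 2 ^ size (xor3 c x y :: o) * (borrow c x y + bval (behead ys)) =
  Y + bval (rev (xor3 c x y :: o)) +
    2 ^ size (xor3 c x y :: o) * bval (behead xs).
Proof.
move=> H x y; rewrite rev_cons bval_rcons size_rev /= expnS; move: H.
rewrite (bval_head xs) (bval_head ys) -/x -/y.
by case: c; case: x; case: y; rewrite /xor3 /borrow /=; lia.
Qed.

Definition state : Type := ((nat -> nat) * seq bool)%type.
Definition mem_of (st : state) : store := mem st.2 [::] [::] [::] [::] st.1.

Definition does (p : prog) (st st' : state) (T : nat) : Prop :=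
  runs p (mem_of st) (mem_of st') T.

Lemma does_add W z x y e out : oval e x < 2 ^ W -> oval e y < 2 ^ W ->
  0 < W -> e z < 2 ^ W ->
  does (add_to z x y) (e, out) (upd e z (oval e x + oval e y), out) (70 * W).
Proof.
move=> hx hy W0 hz; rewrite /does /mem_of /=.
have r1 := runs_load1 out [::] [::] hx.
have r2 := runs_load2 out (binary (oval e x)) [::] hy.
have r3 := runs_push (mem out (binary (oval e x)) (binary (oval e y)) [::] [::] e) 4 false.
rewrite mem_updateE /= in r3.
pose V := oval e x + oval e y.
have hinv : bval (rev [::]) + 2 ^ size ([::] : seq bool) *
   (false + bval (binary (oval e x)) + bval (binary (oval e y))) = V.
  by rewrite !binaryK /= mul1n.
have [w [c [h1 h2 r4]]] := runs_ripple
  (P := fun xs ys w c => bval (rev w) + 2 ^ size w * (c + bval xs + bval ys) = V)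
  (fun xs ys w c => @add_step xs ys w c V) out e hinv
  (size_binary_le hx) (size_binary_le hy).
rewrite /= !addn0 in h1.
set w' := if c then true :: w else w.
have ho' : bval (rev w') = V.
  rewrite -h1 /w'; case: (c) => /=; last by lia.
  by rewrite rev_cons bval_rcons size_rev.
have r5 : runs (Case 4 Skip Skip (Push 3 true)) (mem out [::] [::] w [:: c] e)
   (mem out [::] [::] w' [:: c] e) 2.
  apply: runs_case; rewrite /w'; case: (c) => /=; last exact: runs_skip.
  by have := runs_push (mem out [::] [::] w [:: true] e) 3 true; rewrite mem_updateE.
have r6 := runs_pop (mem out [::] [::] w' [:: c] e) 4.
rewrite mem_updateE /= in r6.
have r7 := runs_clear z.+4.+1 (mem out [::] [::] w' [::] e).
rewrite mem_updateE /= in r7.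
have r8 := runs_strip out w' [::] (updE e z 0).
rewrite updK ho' in r8.
apply: runsW (runs_seq r1 (runs_seq r2 (runs_seq r3 (runs_seq r4 (runs_seq r5
  (runs_seq r6 (runs_seq r7 r8))))))).
have : size w' <= (size w).+1 by rewrite /w'; case: (c).
by have := size_binary_le hz; lia.
Qed.

Definition sub_core x y :=
  Seq (load x 1) (Seq (load y 2) (Seq (Push 4 false) (ripple xor3 borrow))).

Lemma runs_sub_core W x y e out : oval e x < 2 ^ W -> oval e y < 2 ^ W ->
  exists w, [/\ size w <= 2 * W,
    oval e y <= oval e x -> bval (rev w) = oval e x - oval e y &
    runs (sub_core x y) (mem out [::] [::] [::] [::] e)
      (mem out [::] [::] w [:: oval e x < oval e y] e) (36 * W + 7)].
Proof.
move=> hx hy.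
have r1 := runs_load1 out [::] [::] hx.
have r2 := runs_load2 out (binary (oval e x)) [::] hy.
have r3 := runs_push (mem out (binary (oval e x)) (binary (oval e y)) [::] [::] e) 4 false.
rewrite mem_updateE /= in r3.
pose X := oval e x; pose Y := oval e y.
have hinv : X + 2 ^ size ([::] : seq bool) * (false + bval (binary Y)) =
   Y + bval (rev [::]) + 2 ^ size ([::] : seq bool) * bval (binary X).
  by rewrite !binaryK /=; lia.
have [w [c [h1 h2 r4]]] := runs_ripple
  (P := fun xs ys w c => X + 2 ^ size w * (c + bval ys) =
     Y + bval (rev w) + 2 ^ size w * bval xs)
  (fun xs ys w c => @sub_step xs ys w c X Y) out e hinv
  (size_binary_le hx) (size_binary_le hy).
rewrite /= !addn0 muln0 addn0 in h1.
have hlt := bval_lt (rev w); rewrite size_rev in hlt.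
(* The digits form a number below [2 ^ size w], so a final borrow remains exactly when the true
   difference is negative. *)
have hc : c = (X < Y) by case: c h1 {r4} => /=; lia.
exists w; split => //.
- by move=> hle; move: h1; rewrite hc ltnNge hle /= muln0; lia.
- rewrite -/X -/Y -hc.
  apply: runsW (runs_seq r1 (runs_seq r2 (runs_seq r3 r4))).
  by lia.
Qed.

(** Subtraction is truncated as on [nat]: after a final borrow the digits are a wrapped negative
    number, and stack 3 is cleared to give 0. *)
Definition sub_to z x y :=
  Seq (sub_core x y) (Seq (Case 4 Skip Skip (clear 3)) (Seq (Pop 4)
    (Seq (clear z.+4.+1) (strip z.+4.+1)))).

Lemma does_sub W z x y e out : oval e x < 2 ^ W -> oval e y < 2 ^ W ->
  0 < W -> e z < 2 ^ W ->
  does (sub_to z x y) (e, out) (upd e z (oval e x - oval e y), out) (70 * W).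
Proof.
move=> hx hy W0 hz; rewrite /does /mem_of /=.
have [w [h1 h2 r1]] := runs_sub_core out hx hy.
set c := oval e x < oval e y in r1.
set w' := if c then [::] else w.
have ho' : bval (rev w') = oval e x - oval e y.
  rewrite /w' /c; case: ltnP => [hlt|/h2 //] /=.
  by apply/esym/eqP; rewrite subn_eq0 ltnW.
have r2 : runs (Case 4 Skip Skip (clear 3)) (mem out [::] [::] w [:: c] e)
   (mem out [::] [::] w' [:: c] e) (2 * size w).+2.
  apply: runs_case; rewrite /w'; case: (c) => /=; last exact: runs_skip.
  by have := runs_clear 3 (mem out [::] [::] w [:: true] e); rewrite mem_updateE.
have r3 := runs_pop (mem out [::] [::] w' [:: c] e) 4.
rewrite mem_updateE /= in r3.
have r4 := runs_clear z.+4.+1 (mem out [::] [::] w' [::] e).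
rewrite mem_updateE /= in r4.
have r5 := runs_strip out w' [::] (updE e z 0).
rewrite updK ho' in r5.
apply: runsW (runs_seq r1 (runs_seq r2 (runs_seq r3 (runs_seq r4 r5)))).
have : size w' <= size w by rewrite /w'; case: (c).
by have := size_binary_le hz; lia.
Qed.

Definition if_le x y p q :=
  Seq (sub_core y x) (Seq (clear 3)
    (Case 4 Skip (Seq (Pop 4) p) (Seq (Pop 4) q))).

Lemma does_if_le W T x y p q e out st' :
  oval e x < 2 ^ W -> oval e y < 2 ^ W -> 0 < W ->
  does (if oval e x <= oval e y then p else q) (e, out) st' T ->
  does (if_le x y p q) (e, out) st' (50 * W + T).
Proof.
move=> hx hy W0 h; rewrite /does /mem_of /=.
have [w [h1 h2 r1]] := runs_sub_core out hy hx.
rewrite ltnNge in r1; set b := oval e x <= oval e y in r1 h.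
have r2 := runs_clear 3 (mem out [::] [::] w [:: ~~ b] e).
rewrite mem_updateE /= in r2.
have r3 := runs_pop (mem out [::] [::] [::] [:: ~~ b] e) 4.
rewrite mem_updateE /= in r3.
apply: (@runsW _ _ _ (36 * W + 7 + ((2 * size w).+1 + (1 + T).+1))); first by lia.
apply: runs_seq r1 (runs_seq r2 _); apply: runs_case.
by case: b h r2 r3 => /= h _ r3; apply: runs_seq r3 h.
Qed.

Lemma does_seq p q st st1 st2 T1 T2 :
  does p st st1 T1 -> does q st1 st2 T2 -> does (Seq p q) st st2 (T1 + T2).
Proof. exact: runs_seq. Qed.

Lemma doesW p st st' T T' : T <= T' -> does p st st' T -> does p st st' T'.
Proof. exact: runsW. Qed.

Lemma does_skip st : does Skip st st 0.
Proof. exact: runs_skip. Qed.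

Definition halve x := Pop x.+4.+1.

Lemma does_halve x e out : does (halve x) (e, out) (upd e x (e x)./2, out) 1.
Proof.
have := runs_pop (mem_of (e, out)) x.+4.+1.
by rewrite /= behead_binary mem_updateE.
Qed.

Definition if_odd x p q := Case x.+4.+1 q q p.

Lemma does_if_odd x p q e out st' T :
  does (if odd (e x) then p else q) (e, out) st' T ->
  does (if_odd x p q) (e, out) st' T.+1.
Proof.
move=> h; apply: runs_case; rewrite /mem_of /=.
case E: (e x) h => [|n]; first by [].
by rewrite binaryE // -E /select; case: (odd (e x)).
Qed.

Definition while_pos x p := While x.+4.+1 p.

Lemma does_while x p m T (L : nat -> state) :
  (forall i, i < m -> (L i).1 x <> 0 /\ does p (L i) (L i.+1) T) ->
  (L m).1 x = 0 ->
  does (while_pos x p) (L 0) (L m) (m * T.+1).+1.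
Proof.
elim: m L => [|m IH] L h h0.
  by apply: runs_stop; rewrite /mem_of /= h0.
have [hx hp] := h 0 isT.
have {}IH := IH (fun i => L i.+1) (fun i hi => h i.+1 hi) h0.
apply: (@runsW _ _ _ (T + (m * T.+1).+1).+1); first by lia.
apply: runs_step hp IH; rewrite /mem_of /=.
by case: (_ x) hx => // n _; rewrite binaryE.
Qed.

(** The output register is a stack, so the text is produced from its end: the closing [false] comes
    first, then the digits from the most significant one on, each pushed before its marker
    [true]. *)
Definition emit x :=
  Seq (move_stack x.+4.+1 3) (Seq (move2_stack 3 x.+4.+1 1) (Seq (move_stack 1 2)
  (Seq (Push 0 false)
   (While 2 (Case 2 Skip
      (Seq (Pop 2) (Seq (Push 0 false) (Push 0 true)))
      (Seq (Pop 2) (Seq (Push 0 true) (Push 0 true)))))))).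

Definition code (n : nat) : seq bool :=
  flatten [seq [:: true; d] | d <- binary n] ++ [:: false].

Lemma does_emit W x e out : e x < 2 ^ W -> 0 < W ->
  does (emit x) (e, out) (e, code (e x) ++ out) (24 * W).
Proof.
move=> /size_binary_le hx W0; rewrite /does /mem_of /=.
set w := binary (e x).
have r1 := @runs_move x.+4.+1 3 (mem out [::] [::] [::] [::] e) isT.
rewrite /= !mem_updateE in r1.
have r2 := @runs_move2 3 x.+4.+1 1
  (mem out [::] [::] (catrev w [::]) [::] (upd e x 0)) isT isT isT.
rewrite /= !mem_updateE !updE binary0 !catrev_catrev /= cats0 mem_update5 in r2.
rewrite mem_update1 updK upd_same -/w in r2.
have r3 := @runs_move 1 2 (mem out w [::] [::] [::] e) isT.
rewrite /= !mem_updateE in r3.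
have r4 := runs_push (mem out [::] (catrev w [::]) [::] [::] e) 0 false.
rewrite /= !mem_updateE in r4.
(* Here [u] holds the digits already written, which generalizes the claim enough for the induction
   on the digits [v] still to come. *)
have r5 : forall v u out', let p := While 2 (Case 2 Skip
      (Seq (Pop 2) (Seq (Push 0 false) (Push 0 true)))
      (Seq (Pop 2) (Seq (Push 0 true) (Push 0 true)))) in
   runs p (mem (flatten [seq [:: true; d] | d <- u] ++ out') [::] (catrev v [::]) [::] [::] e)
     (mem (flatten [seq [:: true; d] | d <- v ++ u] ++ out') [::] [::] [::] [::] e)
     (5 * size v).+1.
  elim/last_ind => [|v b IH] u out' p; first by apply: runs_stop.
  rewrite catrevE cats0 rev_rcons cat_rcons size_rcons.
  set o1 := flatten _ ++ out'.
  have := IH (b :: u) out'; rewrite catrevE cats0.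
  set s2 := mem _ _ (rev v) _ _ _ => h.
  apply: (@runsW _ _ _ (4 + (5 * size v).+1).+1); first by lia.
  apply: runs_step h => //; apply: runs_case => /=.
  have q1 := runs_pop (mem o1 [::] (b :: rev v) [::] [::] e) 2.
  have q2 := runs_push (mem o1 [::] (rev v) [::] [::] e) 0 b.
  have q3 := runs_push (mem (b :: o1) [::] (rev v) [::] [::] e) 0 true.
  rewrite /= !mem_updateE in q1, q2, q3.
  by have := runs_seq q1 (runs_seq q2 q3); rewrite {}/s2; case: (b).
have := r5 w [::] (false :: out); rewrite /= cats0 => {}r5.
rewrite /code -catA /=.
apply: runsW (runs_seq r1 (runs_seq r2 (runs_seq r3 (runs_seq r4 r5)))).
by rewrite catrevE cats0 size_rev; move: hx; rewrite -/w; lia.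
Qed.

End Programs.

(** * Galois conjugates of the generators *)

Section Cyclotomy.

Definition Phi (K : nzRingType) n : {poly K} := map_poly intr 'Phi_n.

Lemma map_Phi (K L : nzRingType) (f : {rmorphism K -> L}) n :
  map_poly f (Phi K n) = Phi L n.
Proof. by rewrite /Phi -map_poly_comp; apply: eq_map_poly => z /=; rewrite rmorph_int. Qed.

(** Both families factor [X^n - 1] over the divisors of [n]. By induction the factors for proper
    divisors agree, and since they are monic they cancel. *)
Lemma PhiE (K : fieldType) n (z : K) : n.-primitive_root z ->
  Phi K n = cyclotomic z n.
Proof.
elim/ltn_ind: n z => n IH z zP; have n0 := prim_order_gt0 zP.
have /(congr1 (map_poly (intr : int -> K))) := prod_Cyclotomic n0.
rewrite rmorphB rmorph1 rmorph_prod /= map_polyXn (prod_cyclotomic zP).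
have [uDn _ inDn] := divisors_correct n0.
rewrite !(bigD1_seq n) -?dvdn_divisors //= divnn n0 expr1.
rewrite (_ : \prod_(_ <- _ | _) map_poly _ _ =
   \prod_(i <- divisors n | i != n) cyclotomic (z ^+ (n %/ i)) i).
  apply: mulIf; apply/monic_neq0/monic_prod => i _; exact: cyclotomic_monic.
rewrite big_seq_cond [RHS]big_seq_cond; apply: eq_bigr => d.
rewrite -dvdn_divisors // => /andP[dn dn']; apply: IH.
  by rewrite ltn_neqAle dn' dvdn_leq.
by have := dvdn_prim_root zP dn.
Qed.

Lemma root_Phi (K : fieldType) n (z x : K) : n.-primitive_root z ->
  root (Phi K n) x = n.-primitive_root x.
Proof. by move=> zP; rewrite (PhiE zP) root_cyclotomic. Qed.

(** [Phi rat n] is the minimal polynomial of a primitive root in [algC]. If it factors as [r * q],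
    it divides one factor, and dividing [r] is excluded by degree once [q] is not constant. *)
Lemma Phi_irreducible n : (0 < n)%N -> irreducible_poly (Phi rat n).
Proof.
move=> n0; have [z zP] := C_prim_root_exists n0.
have [p [Dp monp] pP] := minCpolyP z.
have {Dp} -> : Phi rat n = p.
  apply: (map_poly_inj (ratr : {rmorphism rat -> algC})).
  by rewrite map_Phi (PhiE zP) -(minCpoly_cyclotomic zP) Dp.
split.
  have := size_minCpoly z; have [q [-> monq] qP] := minCpolyP z.
  have h1 : p %| q by rewrite -pP qP.
  have h2 : q %| p by rewrite -qP pP.
  by rewrite size_map_poly (eqp_size (_ : p %= q)) // /eqp h1 h2.
move=> q sq qp; rewrite /eqp qp /=.
have [r Dr] := dvdpP _ _ qp.
have /orP[] : root (map_poly ratr q) z || root (map_poly ratr r : {poly algC}) z.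
- by rewrite orbC -rootM -rmorphM -Dr pP.
- by rewrite pP.
rewrite pP => pr; have p0 := monic_neq0 monp.
have r0 : r != 0 by apply: contraNneq p0 => r0; rewrite Dr r0 mul0r.
have q0 : q != 0 by apply: contraNneq p0 => q0; rewrite Dr q0 mulr0.
have := dvdp_leq r0 pr; rewrite Dr size_mul //.
have r1 : (0 < size r)%N by rewrite size_poly_gt0.
have q1 : (0 < size q)%N by rewrite size_poly_gt0.
by case: (size q) sq q1 => [|[|m]] // _ _; rewrite addnS /= addnS ltnNge leq_addr.
Qed.

(** The right side does not mention [z]: whether a rational polynomial vanishes at a primitive root
    does not depend on the root. All transfers between conjugates rest on this. *)
Lemma Phi_dvd (K : numFieldType) n (z : K) (p : {poly rat}) :
  n.-primitive_root z -> root (map_poly ratr p) z = (Phi rat n %| p).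
Proof.
move=> zP; have n0 := prim_order_gt0 zP.
have zr : root (map_poly ratr (Phi rat n)) z by rewrite map_Phi (root_Phi _ zP).
apply/idP/idP => [pz|/dvdpP[q ->]]; last by rewrite rmorphM rootM zr orbT.
apply/negPn/negP; rewrite -(irreducible_poly_coprime _ (Phi_irreducible n0)).
rewrite -(coprimep_map (ratr : {rmorphism rat -> K})) => /coprimep_root /(_ zr).
by rewrite -[_ == 0]/(root _ _) pz.
Qed.

End Cyclotomy.

(** * Complex roots of unity and the real embeddings they induce *)

Section RootOfUnity.
Variable R : realType.
Local Notation C := R[i].

Definition cis (x : R) : C := (cos x +i* sin x)%C.

Lemma cisD x y : cis (x + y) = cis x * cis y.
Proof. by rewrite /cis cosD sinD; apply/eqP; rewrite eq_complex /= eqxx /= addrC. Qed.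

Lemma cis0 : cis 0 = 1.
Proof. by rewrite /cis cos0 sin0. Qed.

Lemma cisX x k : cis x ^+ k = cis (x *+ k).
Proof. by elim: k => [|k IH]; rewrite ?cis0 // exprS mulrS cisD IH. Qed.

(** Cosine takes the value 1 on [[0, pi]] only at 0; an angle beyond [pi] is reflected to
    [2 pi - x]. *)
Lemma cis_neq1 x : 0 < x < pi *+ 2 -> cis x != 1.
Proof.
move=> /andP[x0 x2]; apply/eqP => -[cx sx].
case: (leP x pi) => xp.
  have := @cos_inj R x 0; rewrite !in_itv /= lexx pi_ge0 xp (ltW x0) cx cos0.
  by move=> /(_ isT isT erefl) x0'; rewrite x0' ltxx in x0.
have := @cos_inj R (pi *+ 2 - x) 0.
rewrite !in_itv /= lexx pi_ge0 subr_ge0 (ltW x2) /= lerBlDr.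
have -> : pi *+ 2 <= pi + x by rewrite mulr2n lerD2l ltW.
rewrite -cosN opprB cosB cos2pi sin2pi cx cos0 mulr0 addr0 mulr1.
by move=> /(_ isT isT erefl) /eqP; rewrite subr_eq0 eq_sym lt_eqF.
Qed.

Definition zeta n : C := cis (pi *+ 2 / n%:R).

Lemma zetaX n k : zeta n ^+ k = cis (2 * pi * k%:R / n%:R).
Proof.
by rewrite /zeta cisX; congr cis; rewrite -mulr_natr -mulr_natl; ring.
Qed.

Lemma zeta_prim n : (0 < n)%N -> n.-primitive_root (zeta n).
Proof.
move=> n0; have n0' : n%:R != 0 :> R by rewrite pnatr_eq0 -lt0n.
have z1 : zeta n ^+ n = 1.
  rewrite zetaX mulfK // mulrC mulr_natr; rewrite /cis cos2pi sin2pi //.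
apply/andP; split=> //; apply/forallP => i; rewrite unity_rootE.
have [/eqP-> |ne] := boolP (i.+1 == n); first by rewrite z1 eqxx.
rewrite zetaX (negbTE (cis_neq1 _)) //.
have i1 : (i.+1 < n)%N by rewrite ltn_neqAle ne ltn_ord.
rewrite divr_gt0 ?mulr_gt0 ?pi_gt0 ?ltr0n //= -[X in X < _]mulrA.
have -> : (pi : R) *+ 2 = 2 * pi * 1 by rewrite mulr1 mulr_natl.
rewrite ltr_pM2l ?mulr_gt0 ?pi_gt0 //.
by rewrite ltr_pdivrMr ?ltr0n // mul1r ltr_nat.
Qed.

(** On roots of unity complex conjugation is inversion, hence a power map. As such it commutes with
    the maps sending [z] to [z ^+ k], which keeps conjugates of real numbers real. *)
Lemma conj_zetaX n k : (0 < n)%N -> conjc (zeta n ^+ k) = zeta n ^+ (k * n.-1).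
Proof.
move=> n0; have zP := zeta_prim n0.
have h : zeta n ^+ k * conjc (zeta n ^+ k) = 1.
  rewrite zetaX /cis; set x := _ / _; apply/eqP; rewrite eq_complex /=.
  by rewrite mulrN opprK -!expr2 cos2Dsin2 eqxx /= mulrN addrC mulrC subrr.
have h' : zeta n ^+ k * zeta n ^+ (k * n.-1) = 1.
  by rewrite -exprD -mulnS prednK // mulnC exprM (prim_expr_order zP) expr1n.
have z0 : zeta n ^+ k != 0 by apply/eqP => z0; move/eqP: h; rewrite z0 mul0r eq_sym oner_eq0.
by apply: (mulfI z0); rewrite h h'.
Qed.

Section Places.
Variables (S : set R) (n : nat).
Hypothesis n0 : (0 < n)%N.
Local Notation E := (genfield S).
Local Notation z := (zeta n).
Let zP := zeta_prim n0.

Definition evalq (x : C) (p : {poly rat}) : C := (map_poly ratr p).[x].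
Definition evalz (x : C) (p : {poly int}) : C := (map_poly intr p).[x].

Lemma evalq_int x p : evalq x (map_poly intr p) = evalz x p.
Proof.
rewrite /evalq /evalz -map_poly_comp; congr (_ .[x]).
by apply: eq_map_poly => m /=; rewrite ratr_int.
Qed.

Lemma evalq_eq0 (x y : C) p : n.-primitive_root x -> n.-primitive_root y ->
  (evalq x p == 0) = (evalq y p == 0).
Proof. by move=> hx hy; rewrite -!/(root _ _) (Phi_dvd p hx) (Phi_dvd p hy). Qed.

Lemma evalqB x p q : evalq x (p - q) = evalq x p - evalq x q.
Proof. by rewrite /evalq rmorphB hornerD hornerN. Qed.
Lemma evalqD x p q : evalq x (p + q) = evalq x p + evalq x q.
Proof. by rewrite /evalq rmorphD hornerD. Qed.
Lemma evalqM x p q : evalq x (p * q) = evalq x p * evalq x q.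
Proof. by rewrite /evalq rmorphM hornerM. Qed.
Lemma evalq1 x : evalq x 1 = 1.
Proof. by rewrite /evalq rmorph1 hornerC. Qed.
Lemma evalqXn x p m : evalq x (p \Po 'X^m) = evalq (x ^+ m) p.
Proof. by rewrite /evalq map_comp_poly map_polyXn horner_comp hornerXn. Qed.

Lemma evalq_inj (x y : C) p q : n.-primitive_root x -> n.-primitive_root y ->
  evalq x p = evalq x q -> evalq y p = evalq y q.
Proof.
move=> hx hy h; apply/eqP; rewrite -subr_eq0 -evalqB (evalq_eq0 _ hy hx).
by rewrite evalqB h subrr.
Qed.

Lemma conj_evalq x p : conjc (evalq x p) = evalq (conjc x) p.
Proof.
rewrite /evalq -horner_map /= -map_poly_comp; congr (_ .[_]).
by apply: eq_map_poly => q /=; rewrite fmorph_rat.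
Qed.

Hypothesis gensP : forall s, S s -> exists p, evalq z p = s%:C%C.

(** The values of rational polynomials at [z] contain the generators and are closed under division:
    a polynomial not vanishing at [z] is coprime to the irreducible [Phi rat n], and a Bezout
    relation evaluated at [z] yields the inverse. *)
Lemma genfield_eval (x : E) : exists p, evalq z p = (val x)%:C%C.
Proof.
pose F : {pred R} := fun x => `[< exists p, evalq z p = x%:C%C >].
have FP y : reflect (exists p, evalq z p = y%:C%C) (y \in F) by apply: asboolP.
case: x => x /= /in_genfieldP /(_ F) h; apply/FP; apply: h; last first.
  by move=> y /gensP ?; apply/FP.
split.
- by apply/FP; exists 1; rewrite evalq1.
- move=> u w /FP[p Dp] /FP[q Dq]; apply/FP; exists (p - q).
  by rewrite evalqB Dp Dq rmorphB.
- move=> u w /FP[p Dp] /FP[q Dq]; apply/FP.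
  have [w0|w0] := eqVneq w 0.
    by exists 0; rewrite w0 invr0 mulr0 /evalq rmorph0 horner0.
  have : ~~ (Phi rat n %| q).
    by rewrite -(Phi_dvd q zP) /root -/(evalq _ _) Dq fmorph_eq0.
  rewrite -(irreducible_poly_coprime _ (Phi_irreducible n0)).
  case/Bezout_eq1_coprimepP => -[a b] /= /(congr1 (evalq z)) Dab.
  exists (p * b); rewrite evalqM Dp rmorphM /= fmorphV; congr (_ * _).
  have wC : w%:C%C != 0 :> C by rewrite fmorph_eq0.
  apply: (mulIf wC); rewrite mulVf // -Dq -evalqM -(evalq1 z) -Dab.
  have hPhi : evalq z (Phi rat n) = 0.
    by apply/eqP; rewrite -[_ == 0]/(root _ _) (Phi_dvd _ zP).
  by rewrite evalqD [evalq _ (a * _)]evalqM hPhi mulr0 add0r.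
Qed.

Section Conjugate.
Variable k : nat.
Hypothesis kn : coprime k n.
Let zkP : n.-primitive_root (z ^+ k).
Proof. by rewrite prim_root_exp_coprime. Qed.

Definition conjugate (x : E) : R := complex.Re (evalq (z ^+ k) (sval (cid (genfield_eval x)))).

(** Equalities between values of rational polynomials transfer from [z] to [z ^+ k]. So the
    polynomial picked by [cid] is immaterial, and so is the real part: that [x] is real is the
    equality of the values of [p] at [z ^+ n.-1] and at [z], which transfers too. *)
Lemma conjugateE x p : evalq z p = (val x)%:C%C ->
  (conjugate x)%:C%C = evalq (z ^+ k) p.
Proof.
move=> hp; rewrite /conjugate; case: cid => q /= hq.
have -> : evalq (z ^+ k) q = evalq (z ^+ k) p.
  by apply: evalq_inj zP zkP _; rewrite hq hp.
apply: RRe_real; apply/complex_realP; exists (complex.Re (evalq (z ^+ k) p)).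
have : conjc (evalq (z ^+ k) p) = evalq (z ^+ k) p.
  rewrite conj_evalq conj_zetaX // exprM -evalqXn.
  apply: evalq_inj zP zkP _; rewrite evalqXn -[X in X ^+ _]expr1 -exprM.
  by rewrite -conj_zetaX // -conj_evalq expr1 hp conjc_real.
case: (evalq _ _) => u w /= [/eqP]; rewrite -subr_eq0 -opprD oppr_eq0 -mulr2n.
by rewrite mulrn_eq0 /= => /eqP ->.
Qed.

Fact conjugate_zmod : zmod_morphism conjugate.
Proof.
move=> x y; apply: complexI.
have [p hp] := genfield_eval x; have [q hq] := genfield_eval y.
rewrite [RHS]rmorphB /= (conjugateE hp) (conjugateE hq) -evalqB.
by apply: conjugateE; rewrite evalqB hp hq -rmorphB.
Qed.

Fact conjugate_monoid : monoid_morphism conjugate.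
Proof.
split=> [|x y]; apply: complexI.
  by rewrite (@conjugateE _ 1) ?evalq1.
have [p hp] := genfield_eval x; have [q hq] := genfield_eval y.
rewrite [RHS]rmorphM /= (conjugateE hp) (conjugateE hq) -evalqM.
by apply: conjugateE; rewrite evalqM hp hq -rmorphM.
Qed.

HB.instance Definition _ := GRing.isZmodMorphism.Build E R conjugate conjugate_zmod.
HB.instance Definition _ := GRing.isMonoidMorphism.Build E R conjugate conjugate_monoid.

Definition conjugate_place : {rmorphism E -> R} := conjugate.

End Conjugate.

(** The gcd [G] over [E] of [Phi E n] and all [p - x] has the root [z] under the inclusion of [E],
    so it is not constant. Its image under [v] then has a complex root too, which is a primitive
    root of unity, hence a power of [z], and takes the prescribed values. This avoids extending [v]
    to the cyclotomic field. *)
Lemma place_conjugate (v : {rmorphism E -> R}) (s : seq ({poly int} * E)) :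
  (forall px, px \in s -> evalz z px.1 = (val px.2)%:C%C) ->
  exists k, [/\ (k < n)%N, coprime k n &
    forall px, px \in s -> evalz (z ^+ k) px.1 = (v px.2)%:C%C].
Proof.
move=> sP.
pose f (px : {poly int} * E) : {poly E} := map_poly intr px.1 - px.2%:P.
pose G := foldr (fun px g => gcdp (f px) g) (Phi E n) s.
have rootG (w : {rmorphism E -> C}) x : root (map_poly w G) x =
    n.-primitive_root x && all (fun px => evalz x px.1 == w px.2) s.
  rewrite /G; elim: (s) => [|px s' IH] /=; first by rewrite map_Phi (root_Phi _ zP) andbT.
  rewrite gcdp_map root_gcd IH andbCA; congr (_ && (_ && _)).
  rewrite rmorphB /= map_polyC /= -map_poly_comp /root hornerD hornerN hornerC.
  rewrite subr_eq0; congr (_ == _); rewrite /evalz; congr (_ .[x]).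
  by apply: eq_map_poly => m /=; rewrite rmorph_int.
pose toC : {rmorphism R -> C} := (real_complex R : {rmorphism R -> C}).
have Gz : (size G != 1)%N.
  rewrite -(size_map_poly (toC \o val)); apply/negP => /size_poly1P [c c0 Dc].
  have := rootG (toC \o val) z; rewrite Dc rootC (negbTE c0) zP /=.
  by move/esym/negbT/negP; apply; apply/allP => px /sP /eqP.
have : size (map_poly (toC \o v) G) != 1%N by rewrite size_map_poly.
case/closed_rootP => x; rewrite rootG => /andP[xP /allP sx].
have [k Dx] := prim_rootP zP (prim_expr_order xP).
exists k; split => //.
  by rewrite -(prim_root_exp_coprime k zP) -Dx.
by move=> px /sx /eqP; rewrite Dx.
Qed.

End Places.
End RootOfUnity.

(** * Triples and their conjugates in integer arithmetic *)

Section Codes.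
Local Open Scope nat_scope.

(* [0] stands for infinity. With [D = vol a b c], the reciprocals of the three
   entries are [ht1 / D], [ht2 / D] and [ht3 / D], and [wt0], ..., [wt3] are [D]
   times the combinations [1/a + 1/b + 1/c], [1/a + 1/b - 1/c],
   [1/a - 1/b + 1/c] and [| 1/a - 1/b - 1/c |]. *)
Definition index_of (a : nat) : natinf := if a == 0 then None else Some a.
Definition den (a : nat) : nat := if a == 0 then 1 else a.
Definition height (a x : nat) : nat := if a == 0 then 0 else x.

Definition vol a b c := den a * den b * den c.
Definition ht1 a b c := height a (den b * den c).
Definition ht2 a b c := height b (den a * den c).
Definition ht3 a b c := height c (den a * den b).

Definition wt0 a b c := ht1 a b c + ht2 a b c + ht3 a b c.
Definition wt1 a b c := ht1 a b c + ht2 a b c - ht3 a b c.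
Definition wt2 a b c := ht1 a b c + ht3 a b c - ht2 a b c.
Definition wt3 a b c := (ht2 a b c + ht3 a b c - ht1 a b c) +
  (ht1 a b c - (ht2 a b c + ht3 a b c)).

(* The number of odd multiples of [pi / 2] that are crossed on the way from
   [0] to [pi * k * w / (2 * D)], whose parity gives the sign of the cosine. *)
Definition crossings D w k := (k * w + D) %/ (2 * D).

Definition split_at a b c k := let D := vol a b c in
  ~~ odd (crossings D (wt0 a b c) k + crossings D (wt1 a b c) k +
          crossings D (wt2 a b c) k + crossings D (wt3 a b c) k).

(* The representative in [0, D] of [k * h] modulo [2 * D] and up to sign, so
   that [pi * fold D h k / D] has the same cosine as [pi * k * h / D]. *)
Definition fold D h k := let x := (k * h) %% (2 * D) in minn (2 * D - x) x.

(* The conjugation preserves the squares of the three cosines and their product: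
   it changes the sign of an even number of them. *)
Definition fixed_by a b c k :=
  let D := vol a b c in
  let same h := fold D h k == h in
  let opp h := fold D h k == D - h in
  let x := ht1 a b c in let y := ht2 a b c in let z := ht3 a b c in
  [|| [&& same x, same y & same z], [&& same x, opp y & opp z],
      [&& opp x, same y & opp z] | [&& opp x, opp y & same z]].

Lemma den_gt0 a : 0 < den a. Proof. by case: a. Qed.

Lemma vol_gt0 a b c : 0 < vol a b c.
Proof. by rewrite /vol !muln_gt0 !den_gt0. Qed.

(** The form of [hyperbolic] in the coding with 0 for infinity: [a != 1] leaves infinity and the
    indices from 2 on, and the sum of reciprocals is multiplied by [vol]. *)
Definition admissible a b c :=
  [/\ [&& a != 1, b != 1 & c != 1], leqi (index_of a) (index_of b) && leqi (index_of b) (index_of c)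
    & wt0 a b c < vol a b c].

Lemma invi_index a b c : invi (index_of a) = ((ht1 a b c)%:R / (vol a b c)%:R)%R.
Proof.
rewrite /index_of /ht1 /height /vol; case: eqP => [_|/eqP a0] /=; first by rewrite mul0r.
have -> : den a = a by rewrite /den (negbTE a0).
rewrite -mulnA; have : (0 < den b * den c)%N by rewrite muln_gt0 !den_gt0.
move: (_ * _) => x x0; rewrite natrM invfM mulrCA mulfV ?mulr1 //.
by rewrite pnatr_eq0 -lt0n.
Qed.

Lemma hyperbolicE a b c : hyperbolic (index_of a, index_of b, index_of c) <-> admissible a b c.
Proof.
rewrite /hyperbolic /admissible.
have -> : invi (index_of b) = ((ht2 a b c)%:R / (vol a b c)%:R)%R.
  by rewrite (invi_index b a c) /ht1 /ht2 /vol [den b * den a]mulnC.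
have -> : invi (index_of c) = ((ht3 a b c)%:R / (vol a b c)%:R)%R.
  rewrite (invi_index c a b) /ht1 /ht3 /vol; congr (_ / _%:R)%R; ring.
rewrite (invi_index a b c) -!mulrDl -!natrD.
rewrite ltr_pdivrMr ?ltr0n ?vol_gt0 // mul1r ltr_nat.
have two x y : leqi (index_of x) (index_of y) ->
    [&& leqi (Some 2) (index_of x) & leqi (Some 2) (index_of y)] =
    (x != 1) && (y != 1).
  by rewrite /index_of; case: x y => [|[|x]] [|[|y]].
split=> -[h1 h2 h3]; split => //; case/andP: (h2) => /two h4 /two h5.
- case/and3P: h1 h4 h5 => -> -> -> /= /esym /andP[-> ->].
  by move/esym/andP => [_ ->].
- by case/and3P: h1 => a1 b1 c1; move: h4 h5; rewrite a1 b1 c1 /= => /andP[-> ->] /andP[_ ->].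
Qed.

Lemma ht_mul1 a b c : a != 0 -> ht1 a b c * a = vol a b c.
Proof. by move=> a0; rewrite /ht1 /vol /height /den (negbTE a0); ring. Qed.
Lemma ht_mul2 a b c : b != 0 -> ht2 a b c * b = vol a b c.
Proof. by move=> a0; rewrite /ht2 /vol /height /den (negbTE a0); ring. Qed.
Lemma ht_mul3 a b c : c != 0 -> ht3 a b c * c = vol a b c.
Proof. by move=> a0; rewrite /ht3 /vol /height /den (negbTE a0); ring. Qed.

Lemma ht_sorted a b c : leqi (index_of a) (index_of b) && leqi (index_of b) (index_of c) ->
  (ht2 a b c <= ht1 a b c) /\ (ht3 a b c <= ht2 a b c).
Proof.
move=> /andP[h1 h2]; split.
  move: h1; rewrite /ht1 /ht2 /index_of /height /den; case: b h2 => [|b] _; case: a => [|a] //= h.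
  by rewrite leq_mul2r h orbT.
move: h2; rewrite /ht3 /ht2 /index_of /height /den; case: c h1 => [|c] _; case: b => [|b] //= h.
by rewrite leq_mul2l h orbT.
Qed.

End Codes.

(** * Trigonometric identities, and signs and equalities of cosines in integer terms *)

Section Trigonometry.
Variable R : realType.
Implicit Types x y : R.

Lemma cosDn_pi x q : cos (x + pi *+ q) = (-1) ^+ q * cos x.
Proof.
elim: q => [|q IH]; first by rewrite mulr0n addr0 mul1r.
by rewrite mulrSr addrA cosDpi IH exprS mulN1r mulNr.
Qed.

Lemma cosDMcosB x y : cos (x + y) * cos (x - y) = cos x ^+ 2 + cos y ^+ 2 - 1.
Proof.
rewrite cosD cosB; have := cos2Dsin2 x; have := cos2Dsin2 y.
set a := cos x; set b := cos y; set c := sin x; set d := sin y => h1 h2.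
have -> : (a * b - c * d) * (a * b + c * d) = a ^+ 2 * b ^+ 2 - c ^+ 2 * d ^+ 2 by ring.
have -> : c ^+ 2 = 1 - a ^+ 2 by rewrite -h2; ring.
have -> : d ^+ 2 = 1 - b ^+ 2 by rewrite -h1; ring.
by ring.
Qed.

Lemma cos_double x : cos (2 * x) = 2 * cos x ^+ 2 - 1.
Proof. by rewrite mulr_natl cos_mulr2n mulr_natl. Qed.

(* The Gram determinant of a hyperbolic triangle with angles [2x], [2y], [2z]. *)
Lemma gram_cos x y z :
  let: (a, b, c) := (2 * cos (2 * x), 2 * cos (2 * y), 2 * cos (2 * z)) in
  a ^+ 2 + b ^+ 2 + c ^+ 2 + a * b * c - 4 =
  16 * (cos (x + y + z) * cos (x + y - z) * cos (x - y + z) * cos (x - y - z)).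
Proof.
have h1 := cosDMcosB (x + y) z; have h2 := cosDMcosB (x - y) z.
have h3 := cosDMcosB (2 * x) (2 * y).
have h4 := cosD (2 * x) (2 * y); have h5 := cosB (2 * x) (2 * y).
have h6 := cos_double (x + y); have h7 := cos_double (x - y).
have h8 := cos_double z.
have -> : cos (x + y + z) * cos (x + y - z) * cos (x - y + z) * cos (x - y - z)
  = (cos (x + y + z) * cos (x + y - z)) * (cos (x - y + z) * cos (x - y - z)) by ring.
rewrite h1 h2.
rewrite mulrDr in h6; rewrite mulrBr in h7.
set P := cos (2 * x) in h3 h4 h5 h6 h7 *; set Q := cos (2 * y) in h3 h4 h5 h6 h7 *.
set S := cos (2 * z) in h8 *.
have e1 : cos (x + y) ^+ 2 = (cos (2 * x + 2 * y) + 1) / 2 by rewrite h6; field.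
have e2 : cos (x - y) ^+ 2 = (cos (2 * x - 2 * y) + 1) / 2 by rewrite h7; field.
have e3 : cos z ^+ 2 = (S + 1) / 2 by rewrite h8; field.
rewrite e1 e2 e3.
set U := cos (2 * x + 2 * y) in h3 h4 *; set V := cos (2 * x - 2 * y) in h3 h5 *.
have e4 : U + V = 2 * (P * Q) by rewrite h4 h5; ring.
transitivity (4 * (U * V + S * (U + V) + S ^+ 2)); last by field.
by rewrite h3 e4; ring.
Qed.

(** The quotient [q] rounds the angle to the nearest multiple of [pi]: the angle minus [q * pi] lies
    in [[- pi / 2, pi / 2]], where cosine is nonnegative. *)
Lemma sign_cos_crossings D j : (0 < D)%N ->
  0 <= (-1) ^+ ((j + D) %/ (2 * D)) * cos (pi * j%:R / (2 * D%:R) : R).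
Proof.
move=> D0; set q := (_ %/ _)%N.
have D0' : D%:R != 0 :> R by rewrite pnatr_eq0 -lt0n.
have D1 : 0 < D%:R :> R by rewrite ltr0n.
set s := ((j + D) %% (2 * D))%N.
have sD : (s < 2 * D)%N by rewrite ltn_mod muln_gt0.
have e : j%:R + D%:R = q%:R * (2 * D%:R) + s%:R :> R.
  by rewrite -natrM -natrM -!natrD -divn_eq.
have -> : pi * j%:R / (2 * D%:R) = pi * (s%:R - D%:R) / (2 * D%:R) + pi *+ q :> R.
  have {}e : j%:R = q%:R * (2 * D%:R) + s%:R - D%:R :> R by rewrite -e addrK.
  by rewrite e -(mulr_natl pi); field.
rewrite cosDn_pi mulrA -exprD addnn -mul2n exprM sqrrN !expr1n mul1r.
apply: cos_ge0_pihalf.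
have pi0 := @pi_gt0 R.
have h1 : s%:R <= 2 * D%:R :> R by rewrite -natrM ler_nat ltnW.
have h0 : 0 <= s%:R :> R by rewrite ler0n.
have -> : - (pi / 2) = pi * (- D%:R) / (2 * D%:R) :> R by field.
have -> : pi / 2 = pi * D%:R / (2 * D%:R) :> R by field.
rewrite !ler_pM2r ?invr_gt0 ?mulr_gt0 // !ler_pM2l //.
by apply/andP; split; lra.
Qed.

Lemma cos_lt_pihalf D j : (j < D)%N -> 0 < cos (pi * j%:R / (2 * D%:R) : R).
Proof.
move=> jD; have D0 : (0 < D)%N by apply: leq_ltn_trans jD.
have D1 : 0 < D%:R :> R by rewrite ltr0n.
have pi0 := @pi_gt0 R.
apply: cos_gt0_pihalf; apply/andP; split.
  apply: (@lt_le_trans _ _ 0); first by rewrite oppr_lt0 divr_gt0.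
  by rewrite divr_ge0 ?mulr_ge0 // ltW.
by rewrite ltr_pdivrMr ?mulr_gt0 // mulrA divfK // ltr_pM2l // ltr_nat.
Qed.

(** Reduction modulo [2 pi] and reflection bring the angle into [[0, pi]], where cosine is
    injective. *)
Lemma cos_eq_fold D i j : (0 < D)%N -> (j <= D)%N ->
  cos (pi * i%:R / D%:R) = cos (pi * j%:R / D%:R) :> R ->
  fold D i 1 = j.
Proof.
move=> D0 jD; rewrite /fold mul1n.
have D1 : 0 < D%:R :> R by rewrite ltr0n.
have D0' : D%:R != 0 :> R by rewrite gt_eqF.
have pi0 := @pi_gt0 R.
set s := (i %% (2 * D))%N; set q := (i %/ (2 * D))%N.
have sD : (s < 2 * D)%N by rewrite ltn_mod muln_gt0.
have -> : cos (pi * i%:R / D%:R) = cos (pi * s%:R / D%:R) :> R.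
  have -> : pi * i%:R / D%:R = pi * s%:R / D%:R + pi *+ (2 * q) :> R.
    rewrite (divn_eq i (2 * D)) -/q -/s natrD !natrM -(mulr_natl pi) natrM; by field.
  by rewrite cosDn_pi exprM sqrrN !expr1n mul1r.
have inI m : (m <= D)%N -> pi * m%:R / D%:R \in `[0, pi : R].
  move=> mD; rewrite in_itv /= divr_ge0 ?mulr_ge0 ?(ltW pi0) ?ler0n //=.
  by rewrite ler_pdivrMr // ler_pM2l // ler_nat.
have injI m m' : (m <= D)%N -> (m' <= D)%N ->
    cos (pi * m%:R / D%:R) = cos (pi * m'%:R / D%:R) :> R -> m = m'.
  move=> h h' /(cos_inj (inI _ h) (inI _ h')) /(divIf D0') /(mulfI (lt0r_neq0 pi0)).
  by move/eqP; rewrite eqr_nat => /eqP.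
case: (leqP s D) => hs.
  by move=> /injI ->; lia.
have -> : cos (pi * s%:R / D%:R) = cos (pi * (2 * D - s)%:R / D%:R) :> R.
  rewrite natrB 1?ltnW // natrM.
  have -> : pi * (2 * D%:R - s%:R) / D%:R = - (pi * s%:R / D%:R) + pi *+ 2 :> R.
    by rewrite -(mulr_natl pi); field.
  by rewrite cosDn_pi cosN sqrrN expr1n mul1r.
by move/injI => <-; lia.
Qed.

Lemma cos_fold D i : (0 < D)%N ->
  cos (pi * i%:R / D%:R) = cos (pi * (fold D i 1)%:R / D%:R) :> R.
Proof.
move=> D0; rewrite /fold mul1n.
have D1 : 0 < D%:R :> R by rewrite ltr0n.
have D0' : D%:R != 0 :> R by rewrite gt_eqF.
set s := (i %% (2 * D))%N; set q := (i %/ (2 * D))%N.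
have sD : (s < 2 * D)%N by rewrite ltn_mod muln_gt0.
have -> : cos (pi * i%:R / D%:R) = cos (pi * s%:R / D%:R) :> R.
  have -> : pi * i%:R / D%:R = pi * s%:R / D%:R + pi *+ (2 * q) :> R.
    rewrite (divn_eq i (2 * D)) -/q -/s natrD !natrM -(mulr_natl pi) natrM; by field.
  by rewrite cosDn_pi exprM sqrrN !expr1n mul1r.
rewrite /minn; case: ifP => // _.
rewrite natrB 1?ltnW // natrM.
have -> : pi * (2 * D%:R - s%:R) / D%:R = - (pi * s%:R / D%:R) + pi *+ 2 :> R.
  by rewrite -(mulr_natl pi); field.
by rewrite cosDn_pi cosN sqrrN expr1n mul1r.
Qed.

End Trigonometry.

(** * Splitting of real quaternion algebras *)

Section QuaternionSplitting.
Variable R : realType.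

Section Split.
Variables (a b s : R).
Hypotheses (a0 : a != 0) (s0 : s != 0) (sb : s ^+ 2 = b).
Local Notation Q := (quaternion a b).

(* [i] and [j] act as [[0, a], [1, 0]] and [diag (s, - s)]. *)
Definition quat_mx (p : Q) : 'M[R]_2 :=
  let p_ := qcoef p in
  \matrix_(i < 2, j < 2)
    if i == 0 then (if j == 0 then p_ 0%N + s * p_ 2%N else a * p_ 1%N - a * s * p_ 3%N)
    else (if j == 0 then p_ 1%N + s * p_ 3%N else p_ 0%N - s * p_ 2%N).

Definition mx_quat (m : 'M[R]_2) : Q :=
  mkquat a b ((m 0 0 + m 1 1) / 2) ((m 0 1 / a + m 1 0) / 2)
         ((m 0 0 - m 1 1) / (2 * s)) ((m 1 0 - m 0 1 / a) / (2 * s)).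

Lemma I2P (i : 'I_2) : i = 0 \/ i = 1.
Proof. by case: i => [[|[|//]] hi]; [left|right]; apply: val_inj. Qed.

Lemma mx2P (m m' : 'M[R]_2) : m 0 0 = m' 0 0 -> m 0 1 = m' 0 1 ->
  m 1 0 = m' 1 0 -> m 1 1 = m' 1 1 -> m = m'.
Proof.
move=> h1 h2 h3 h4; apply/matrixP => i j.
by case: (I2P i) => ->; case: (I2P j) => ->.
Qed.

Fact quat_mx_linear : linear quat_mx.
Proof.
move=> c p q; apply: mx2P; rewrite !mxE /= !qcoefD !qcoefZ; ring.
Qed.

Fact quat_mx_monoid : monoid_morphism quat_mx.
Proof.
have q1 : (1 : Q) = onequat a b by [].
have qM (p q : Q) : p * q = mulquat p q by [].
split=> [|p q]; apply: mx2P; rewrite ?q1 ?qM !mxE /= ?big_ord_recl ?big_ord0 ?mxE /=;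
  rewrite /onequat /mulquat !qcoefE -?sb; ring.
Qed.

HB.instance Definition _ := GRing.isLinear.Build R Q 'M[R]_2 *:%R quat_mx quat_mx_linear.
HB.instance Definition _ := GRing.isMonoidMorphism.Build Q 'M[R]_2 quat_mx quat_mx_monoid.

Lemma quat_split : exists f : {lrmorphism quaternion a b -> 'M[R]_2}, bijective f.
Proof.
exists quat_mx; exists mx_quat => x.
- apply: quatP; rewrite !qcoefE !mxE /=; field; by rewrite ?a0 ?s0.
- apply: mx2P; rewrite !mxE /= !qcoefE; field; by rewrite ?a0 ?s0.
Qed.
End Split.

(** The matrix algebra contains a nonzero element of square 0. For a quaternion [q] with [q * q = 0]
    the last three coordinates give [x0 * xi = 0]; multiplying the first one by [x0 ^+ 2] then
    forces [x0 = 0], and what remains of it is a definite form in [x1], [x2], [x3]. *)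
Lemma quat_nonsplit (a b : R) : a < 0 -> b < 0 ->
  ~ exists f : {lrmorphism quaternion a b -> 'M[R]_2}, bijective f.
Proof.
move=> a0 b0 [f [g fK gK]].
pose N : 'M[R]_2 := delta_mx 0 1; pose q := g N.
have qq : q * q = 0.
  apply: (can_inj fK); transitivity (f q * f q); first exact: rmorphM.
  transitivity (N * N); first by congr (_ * _); exact: gK.
  rewrite -[LHS]/(delta_mx 0 1 *m delta_mx 0 1) mul_delta_mx_0 //.
  by apply/esym; exact: rmorph0.
have : q != 0.
  apply/eqP => q0; have : N = 0.
    by rewrite -[N]gK -/q q0; exact: rmorph0.
  move/matrixP => /(_ 0 1).
  by rewrite !mxE /= => /eqP; rewrite oner_eq0.
apply/negP/negPn/eqP.
have h i : qcoef (mulquat q q) i = 0 by rewrite -[mulquat q q]/(q * q) qq /qcoef mxE.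
have := h 0%N; have := h 1%N; have := h 2%N; have := h 3%N.
rewrite /mulquat !qcoefE.
set x0 := qcoef q 0; set x1 := qcoef q 1; set x2 := qcoef q 2; set x3 := qcoef q 3.
move=> e3 e2 e1 e0.
have {}e1 : x0 * x1 = 0 by lra.
have {}e2 : x0 * x2 = 0 by lra.
have {}e3 : x0 * x3 = 0 by lra.
have ab : 0 < a * b by rewrite nmulr_rgt0.
have z : x0 ^+ 2 * (x0 ^+ 2) = 0.
  transitivity (x0 ^+ 2 * (x0 * x0 + a * (x1 * x1) + b * (x2 * x2) - a * b * (x3 * x3))
     - a * (x0 * x1) ^+ 2 - b * (x0 * x2) ^+ 2 + a * b * (x0 * x3) ^+ 2); first by ring.
  by rewrite e0 e1 e2 e3; ring.
have {}z : x0 = 0 by move/eqP: z; rewrite -expr2 -exprM expf_eq0 => /eqP.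
have p1 : 0 <= - a * (x1 * x1) by rewrite mulr_ge0 ?oppr_ge0 ?(ltW a0) // -expr2 sqr_ge0.
have p2 : 0 <= - b * (x2 * x2) by rewrite mulr_ge0 ?oppr_ge0 ?(ltW b0) // -expr2 sqr_ge0.
have p3 : 0 <= a * b * (x3 * x3) by rewrite mulr_ge0 ?(ltW ab) // -expr2 sqr_ge0.
rewrite z in e0.
have q1 : - a * (x1 * x1) = 0 by lra.
have q2 : - b * (x2 * x2) = 0 by lra.
have q3 : a * b * (x3 * x3) = 0 by lra.
have y1 : x1 = 0.
  by move/eqP: q1; rewrite mulf_eq0 oppr_eq0 (lt_eqF a0) -expr2 expf_eq0 => /eqP.
have y2 : x2 = 0.
  by move/eqP: q2; rewrite mulf_eq0 oppr_eq0 (lt_eqF b0) -expr2 expf_eq0 => /eqP.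
have y3 : x3 = 0.
  by move/eqP: q3; rewrite mulf_eq0 (gt_eqF ab) -expr2 expf_eq0 => /eqP.
by apply: quatP; rewrite -/x0 -/x1 -/x2 -/x3 ?z ?y1 ?y2 ?y3 /qcoef mxE.
Qed.

End QuaternionSplitting.

(** * Real places of the trace field *)

Section TripleBasics.
Variables a b c : nat.
Hypothesis adm : admissible a b c.
Local Open Scope nat_scope.

Lemma ht21 : ht2 a b c <= ht1 a b c.
Proof. by case: adm => _ /ht_sorted[]. Qed.
Lemma ht32 : ht3 a b c <= ht2 a b c.
Proof. by case: adm => _ /ht_sorted[]. Qed.
Lemma wt0_lt : wt0 a b c < vol a b c. Proof. by case: adm. Qed.

(** Since [1/b <= 1/a], twice [1/b] is below 1. Hence [lambda] is positive at [2b] and [2c], whereas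
    at [2a] it vanishes when [a = 2]; for this reason [ht1_le] is not strict. *)
Lemma ht2_lt : 2 * ht2 a b c < vol a b c.
Proof. by have := wt0_lt; have := ht21; rewrite /wt0; lia. Qed.

Lemma ht1_le : 2 * ht1 a b c <= vol a b c.
Proof.
case: adm => /and3P[a1 _ _] _ _; have [->|a0] := eqVneq a 0; first by [].
by rewrite -(ht_mul1 b c a0) mulnC leq_mul2l; case: a a0 a1 => [|[|m]] // _ _; rewrite orbT.
Qed.
End TripleBasics.

Section TriplePlaces.
Variables (R : realType) (a b c : nat).
Hypothesis adm : admissible a b c.
Local Notation C := R[i].
Local Notation D := (vol a b c).
Local Notation n := (2 * vol a b c)%N.
Local Notation t := (index_of a, index_of b, index_of c).
Local Notation E := (trace_field R t).
Local Notation S := (@trace_gens R t).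
Local Notation h1 := (ht1 a b c).
Local Notation h2 := (ht2 a b c).
Local Notation h3 := (ht3 a b c).
Local Notation z := (zeta R n).

Let D0 : (0 < D)%N := vol_gt0 a b c.
Let n0 : (0 < n)%N. Proof. by rewrite muln_gt0. Qed.
Let DR0 : D%:R != 0 :> R. Proof. by rewrite pnatr_eq0 -lt0n. Qed.

(** With [h / D = 1 / y], this is the conjugate of [lambda] at [2y] under [z] to [z ^+ k]. Since
    [lambda] at [y] is its square minus 2, the three traces generate everything. *)
Definition trace h k : R := 2 * cos (pi * (k * h)%:R / D%:R).

Lemma lambda_trace y h : (if y == 0 then h == 0 else h * y == D)%N ->
  lambda R (doublei (index_of y)) = trace h 1 /\
  lambda R (index_of y) = trace h 1 ^+ 2 - 2.
Proof.
rewrite /index_of /trace mul1n; case: eqP => [_ /eqP ->|/eqP y0 /eqP hD] /=.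
  by rewrite mulr0 mul0r cos0; split; [rewrite mulr1|ring].
have yR : y%:R != 0 :> R by rewrite pnatr_eq0.
have hR : h%:R != 0 :> R.
  by rewrite pnatr_eq0; apply: contraTneq D0 => h0; rewrite -hD h0.
have -> : pi * h%:R / D%:R = pi / y%:R :> R by rewrite -hD natrM; field; rewrite yR hR.
split; first by congr (_ * cos _); rewrite -muln2 natrM; field.
have -> : 2 * pi / y%:R = 2 * (pi / y%:R) :> R by rewrite mulrA.
by rewrite cos_double; ring.
Qed.

Let hP1 : (if a == 0 then h1 == 0 else h1 * a == D)%N.
Proof. by case: eqP => [->|/eqP/(ht_mul1 b c) ->]. Qed.
Let hP2 : (if b == 0 then h2 == 0 else h2 * b == D)%N.
Proof. by case: eqP => [->|/eqP/(ht_mul2 a c) ->]. Qed.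
Let hP3 : (if c == 0 then h3 == 0 else h3 * c == D)%N.
Proof. by case: eqP => [->|/eqP/(ht_mul3 a b) ->]. Qed.

Definition gens k : R * R * R * R :=
  (trace h1 k ^+ 2 - 2, trace h2 k ^+ 2 - 2, trace h3 k ^+ 2 - 2,
   trace h1 k * trace h2 k * trace h3 k).

Definition beta_of (g : R * R * R * R) : R :=
  let: (x, y, u, w) := g in x + y + u + w + 2.

Definition beta_at k := beta_of (gens k).

(* [trace h k] is the value at [zeta ^ k] of the polynomial
   [X ^ h + X ^ (h * (n - 1))], since [n - 1] acts as [-1] on exponents. *)
Definition trace_poly h : {poly int} := 'X^h + 'X^(h * n.-1).

Lemma evalz_trace h k : evalz (z ^+ k) (trace_poly h) = (trace h k)%:C%C.
Proof.
rewrite /evalz rmorphD /= !map_polyXn hornerD !hornerXn -!exprM mulnA.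
rewrite -conj_zetaX // addcJ /trace zetaX /=.
rewrite [RHS]rmorphM [X in _ = X * _]rmorph_nat /=; congr (_ * (cos _)%:C%C).
by rewrite natrM; field.
Qed.

Lemma evalzD (x : C) p q : evalz x (p + q) = evalz x p + evalz x q.
Proof. by rewrite /evalz rmorphD hornerD. Qed.
Lemma evalzB (x : C) p q : evalz x (p - q) = evalz x p - evalz x q.
Proof. by rewrite /evalz rmorphB hornerD hornerN. Qed.
Lemma evalzM (x : C) p q : evalz x (p * q) = evalz x p * evalz x q.
Proof. by rewrite /evalz rmorphM hornerM. Qed.
Lemma evalz_nat (x : C) m : evalz x m%:R = m%:R.
Proof. by rewrite /evalz rmorph_nat -polyC_natr hornerC. Qed.

Definition square_poly h := trace_poly h * trace_poly h - 2%:R.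
Definition prod_poly := trace_poly h1 * trace_poly h2 * trace_poly h3.

Lemma evalz_square h k : evalz (z ^+ k) (square_poly h) = (trace h k ^+ 2 - 2)%:C%C.
Proof.
by rewrite evalzB evalzM evalz_nat evalz_trace -rmorphM -(rmorph_nat (real_complex R)) -rmorphB /= expr2.
Qed.

Lemma evalz_prod k : evalz (z ^+ k) prod_poly = (trace h1 k * trace h2 k * trace h3 k)%:C%C.
Proof. by rewrite !evalzM !evalz_trace -!rmorphM. Qed.

Definition gen_of (x : R) (Sx : S x) : E := Genfield (mem_genfield Sx).

Fact S1 : S (lambda R (index_of a)). Proof. by left; left; left. Qed.
Fact S2 : S (lambda R (index_of b)). Proof. by left; left; right. Qed.
Fact S3 : S (lambda R (index_of c)). Proof. by left; right. Qed.
Fact S4 : S (lambda2_prod R t). Proof. by right. Qed.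

Definition e1 := gen_of S1.
Definition e2 := gen_of S2.
Definition e3 := gen_of S3.
Definition e4 := gen_of S4.

Definition gens_of (v : E -> R) : R * R * R * R := (v e1, v e2, v e3, v e4).

Definition gen_table : seq ({poly int} * E) :=
  [:: (square_poly h1, e1); (square_poly h2, e2); (square_poly h3, e3);
      (prod_poly, e4)].

Lemma gen_tableP px : px \in gen_table -> evalz z px.1 = (val px.2)%:C%C.
Proof.
rewrite -[z]expr1 !inE => /or4P[] /eqP -> /=.
- by rewrite evalz_square (lambda_trace hP1).2.
- by rewrite evalz_square (lambda_trace hP2).2.
- by rewrite evalz_square (lambda_trace hP3).2.
- by rewrite evalz_prod (lambda_trace hP1).1 (lambda_trace hP2).1 (lambda_trace hP3).1.
Qed.

Lemma place_gens (v : {rmorphism E -> R}) :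
  exists k, [/\ (k < n)%N, coprime k n & gens_of v = gens k].
Proof.
have [k [kn ck kP]] := place_conjugate n0 v gen_tableP.
exists k; split => //.
have q1 := kP _ (mem_head _ _).
have q2 : (v e2)%:C%C = evalz (z ^+ k) (square_poly h2).
  by apply/esym; apply: (kP (square_poly h2, e2)); rewrite !inE eqxx orbT.
have q3 : (v e3)%:C%C = evalz (z ^+ k) (square_poly h3).
  by apply/esym; apply: (kP (square_poly h3, e3)); rewrite !inE eqxx !orbT.
have q4 : (v e4)%:C%C = evalz (z ^+ k) prod_poly.
  by apply/esym; apply: (kP (prod_poly, e4)); rewrite !inE eqxx !orbT.
rewrite /= evalz_square in q1; rewrite evalz_square in q2; rewrite evalz_square in q3.
rewrite evalz_prod in q4.
by rewrite /gens_of /gens -(complexI q1) (complexI q2) (complexI q3) (complexI q4).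
Qed.

Let evalS s : S s -> exists p, evalq z p = s%:C%C.
Proof.
have h px : px \in gen_table -> exists p, evalq z p = (val px.2)%:C%C.
  by move/gen_tableP => <-; exists (map_poly intr px.1); rewrite evalq_int.
case=> [[[->|->]|->]|->].
- by apply: (h (square_poly h1, e1)); rewrite !inE eqxx.
- by apply: (h (square_poly h2, e2)); rewrite !inE eqxx orbT.
- by apply: (h (square_poly h3, e3)); rewrite !inE eqxx !orbT.
- by apply: (h (prod_poly, e4)); rewrite !inE eqxx !orbT.
Qed.

Lemma gens_place k : coprime k n -> exists v : {rmorphism E -> R}, gens_of v = gens k.
Proof.
move=> ck; exists (conjugate_place n0 evalS ck).
have h px : px \in gen_table ->
    (conjugate_place n0 evalS ck px.2)%:C%C = evalz (z ^+ k) px.1.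
  move=> /gen_tableP hp; rewrite -evalq_int; apply: conjugateE => //.
  by rewrite evalq_int.
have q1 : (conjugate_place n0 evalS ck e1)%:C%C = evalz (z ^+ k) (square_poly h1).
  by apply: (h (square_poly h1, e1)); rewrite !inE eqxx.
have q2 : (conjugate_place n0 evalS ck e2)%:C%C = evalz (z ^+ k) (square_poly h2).
  by apply: (h (square_poly h2, e2)); rewrite !inE eqxx orbT.
have q3 : (conjugate_place n0 evalS ck e3)%:C%C = evalz (z ^+ k) (square_poly h3).
  by apply: (h (square_poly h3, e3)); rewrite !inE eqxx !orbT.
have q4 : (conjugate_place n0 evalS ck e4)%:C%C = evalz (z ^+ k) prod_poly.
  by apply: (h (prod_poly, e4)); rewrite !inE eqxx !orbT.
rewrite evalz_square in q1; rewrite evalz_square in q2; rewrite evalz_square in q3.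
rewrite evalz_prod in q4.
by rewrite /gens_of /gens (complexI q1) (complexI q2) (complexI q3) (complexI q4).
Qed.

Lemma rmorphism_eq (A B : pzRingType) (f g : {rmorphism A -> B}) : f =1 g -> f = g.
Proof.
move=> /funext; case: f => f [[f1] [f2] ]; case: g => g [[g1] [g2] ] /= fg.
case: _ / fg g1 g2 => g1 g2.
by rewrite (Prop_irrelevance f1 g1) (Prop_irrelevance f2 g2).
Qed.

(** The elements on which two embeddings agree form a division closed set, which contains the
    generators. *)
Lemma gens_of_inj (v w : {rmorphism E -> R}) : gens_of v = gens_of w -> v = w.
Proof.
move=> [q1 q2 q3 q4]; apply: rmorphism_eq => x.
pose F : {pred R} := fun y => `[< exists x : E, val x = y /\ v x = w x >].
have FP y : reflect (exists x : E, val x = y /\ v x = w x) (y \in F) by apply: asboolP.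
have : val x \in F.
  case: x => x /= /in_genfieldP; apply; last first.
    move=> y Sy; apply/FP; exists (gen_of Sy); split => //.
    case: Sy => [[[Sy|Sy]|Sy]|Sy].
    - by rewrite (_ : gen_of _ = e1) //; apply: val_inj.
    - by rewrite (_ : gen_of _ = e2) //; apply: val_inj.
    - by rewrite (_ : gen_of _ = e3) //; apply: val_inj.
    - by rewrite (_ : gen_of _ = e4) //; apply: val_inj.
  split.
  - by apply/FP; exists 1; rewrite !rmorph1.
  - move=> y1 y2 /FP[x1 [<- h1']] /FP[x2 [<- h2']]; apply/FP; exists (x1 - x2).
    by rewrite !rmorphB h1' h2'.
  - move=> y1 y2 /FP[x1 [<- h1']] /FP[x2 [<- h2']]; apply/FP; exists (x1 / x2).
    by rewrite !rmorphM !fmorphV h1' h2'.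
by case/FP => x' [/val_inj ->].
Qed.

Lemma trace_gt0 h : (2 * h < D)%N -> 0 < trace h 1.
Proof.
move=> hD; rewrite /trace mul1n mulr_gt0 //.
have -> : pi * h%:R / D%:R = pi * (2 * h)%:R / (2 * D%:R) :> R by rewrite natrM; field.
exact: cos_lt_pihalf.
Qed.

Lemma trace_lt2 h : (0 < h)%N -> (2 * h < D)%N -> trace h 1 < 2.
Proof.
move=> h0 hD; rewrite /trace mul1n -[ltRHS]mulr1 ltr_pM2l //.
rewrite lt_neqAle cos_le1 andbT; apply/eqP => h1.
have hD' : (h <= D)%N by lia.
have := @cos_eq_fold R D h 0 D0 (leq0n _); rewrite h1 mulr0 mul0r cos0 => /(_ erefl).
by rewrite /fold mul1n modn_small; lia.
Qed.

Lemma trace_norm h k : (trace h k) ^+ 2 <= 4.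
Proof.
have := cos_max (pi * (k * h)%:R / D%:R : R); rewrite /trace exprMn.
rewrite ler_norml => /andP[u1 u2]; set x := cos _ in u1 u2 *.
have : 0 <= (1 - x) * (1 + x) by apply: mulr_ge0; lra.
by move=> u3; rewrite -natrX; nra.
Qed.

Lemma beta_atE k : beta_at k =
  trace h1 k ^+ 2 + trace h2 k ^+ 2 + trace h3 k ^+ 2
  + trace h1 k * trace h2 k * trace h3 k - 4.
Proof. by rewrite /beta_at /beta_of /gens; ring. Qed.

Let hhR k h : trace h k = 2 * cos (2 * (pi * (k * h)%:R / (2 * D%:R))).
Proof. by rewrite /trace; congr (_ * cos _); field. Qed.

Lemma beta_prod k :
  let w i := cos (pi * (k * i)%:R / (2 * D%:R) : R) in
  beta_at k = 16 * (w (wt0 a b c) * w (wt1 a b c) * w (wt2 a b c) * w (wt3 a b c)).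
Proof.
move=> w; rewrite beta_atE !hhR.
have h21 := ht21 adm; have h32 := ht32 adm.
set x := pi * (k * h1)%:R / _; set y := pi * (k * h2)%:R / _; set u := pi * (k * h3)%:R / _.
have -> := gram_cos x y u; congr (16 * _).
have w0E : w (wt0 a b c) = cos (x + y + u).
  by congr cos; rewrite /wt0 !mulnDr !natrD /x /y /u; ring.
have w1E : w (wt1 a b c) = cos (x + y - u).
  congr cos; rewrite /wt1 mulnBr natrB ?leq_mul2l; last by apply/orP; right; lia.
  by rewrite mulnDr natrD /x /y /u; ring.
have w2E : w (wt2 a b c) = cos (x - y + u).
  congr cos; rewrite /wt2 mulnBr natrB ?leq_mul2l; last by apply/orP; right; lia.
  by rewrite mulnDr natrD /x /y /u; ring.
(* [wt3] is an absolute value, as weights are natural numbers; cosine is even. *)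
have w3E : w (wt3 a b c) = cos (x - y - u).
  rewrite /w /wt3; case: (leqP h1 (h2 + h3)) => hh.
    rewrite (_ : h1 - (h2 + h3) = 0)%N ?addn0; last by lia.
    rewrite -cosN; congr cos; rewrite mulnBr natrB ?leq_mul2l ?hh ?orbT //.
    by rewrite mulnDr natrD /x /y /u; ring.
  rewrite (_ : h2 + h3 - h1 = 0)%N ?add0n; last by lia.
  congr cos; rewrite mulnBr natrB ?leq_mul2l ?(ltnW hh) ?orbT //.
  by rewrite mulnDr natrD /x /y /u; ring.
by rewrite w0E w1E w2E w3E.
Qed.

(** Hyperbolicity puts the largest of the four angles, and hence all of them, below [pi / 2]. *)
Lemma beta1_gt0 : 0 < beta_at 1.
Proof.
have h21 := ht21 adm; have h32 := ht32 adm; have h0 := wt0_lt adm.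
have w0D : (wt0 a b c < D)%N by [].
have w1D : (wt1 a b c < D)%N by move: h0; rewrite /wt1 /wt0; lia.
have w2D : (wt2 a b c < D)%N by move: h0; rewrite /wt2 /wt0; lia.
have w3D : (wt3 a b c < D)%N by move: h0; rewrite /wt3 /wt0; lia.
rewrite beta_prod !mul1n; apply: mulr_gt0 => //.
by apply: mulr_gt0; [apply: mulr_gt0; [apply: mulr_gt0|]|]; apply: cos_lt_pihalf.
Qed.

Definition beta_poly := square_poly h1 + square_poly h2 + square_poly h3 + prod_poly + 2%:R.

Lemma evalz_beta k : evalz (z ^+ k) beta_poly = (beta_at k)%:C%C.
Proof.
rewrite /beta_poly evalzD evalz_nat evalzD evalz_prod evalzD evalz_square evalzD.
by rewrite !evalz_square -(rmorph_nat (real_complex R)) -!rmorphD.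
Qed.

Lemma evalz_eq0 k p : coprime k n -> (evalz (z ^+ k) p == 0) = (evalz z p == 0).
Proof.
move=> ck; have zP := zeta_prim R n0.
have zkP : n.-primitive_root (z ^+ k) by rewrite prim_root_exp_coprime.
by rewrite -!evalq_int; apply: evalq_eq0 zkP zP.
Qed.

(** A conjugate of a nonzero number is nonzero. This makes the weak inequality of
    [sign_cos_crossings] strict. *)
Lemma beta_neq0 k : coprime k n -> beta_at k != 0.
Proof.
move=> ck; have := evalz_eq0 beta_poly ck; rewrite -[in RHS](expr1 z) !evalz_beta.
by rewrite !fmorph_eq0 => ->; rewrite gt_eqF // beta1_gt0.
Qed.

Lemma beta_gt0_split k : coprime k n -> (0 < beta_at k) = split_at a b c k.
Proof.
move=> ck; have := beta_neq0 ck.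
pose q i := crossings D i k.
have hs i : 0 <= (-1) ^+ q i * cos (pi * (k * i)%:R / (2 * D%:R) : R).
  exact: sign_cos_crossings.
pose Q := (q (wt0 a b c) + q (wt1 a b c) + q (wt2 a b c) + q (wt3 a b c))%N.
have : 0 <= (-1) ^+ Q * beta_at k.
  have := mulr_ge0 (mulr_ge0 (hs (wt0 a b c)) (hs (wt1 a b c)))
                   (mulr_ge0 (hs (wt2 a b c)) (hs (wt3 a b c))).
  rewrite beta_prod /Q !exprD => h; rewrite -(pmulr_rge0 _ (ltr0n R 16)) in h.
  by apply: le_trans h _; rewrite le_eqVlt; apply/orP; left; apply/eqP; ring.
rewrite /split_at -/(q _) -/(q _) -/(q _) -/(q _) -/Q -signr_odd.
case: (odd Q) => /=; rewrite ?expr1 ?expr0 ?mul1r ?mulN1r ?oppr_ge0 => hb b0.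
  by apply/negbTE; rewrite -leNgt.
by rewrite lt_neqAle eq_sym b0.
Qed.

Let square_neq4 (x : R) : 0 < x -> x < 2 -> x ^+ 2 - 2 - 2 <> 0.
Proof. by move=> *; nra. Qed.

Let square_le4 (x : R) : x <= 4 -> x - 2 - 2 <= 0.
Proof. by move=> *; lra. Qed.

(** For finite [b], the conjugates of [lambda_b + 2] and [lambda_c + 2] are squares of traces and
    that of [lambda_b] is at most 2. None of the three bounds is attained, because [e2 + 2],
    [e3 + 2] and [e2 - 2] are nonzero in [E]. So the first entry of the symbol is negative and the
    second has the sign of beta. *)
Lemma split_place (v : {rmorphism E -> R}) :
  split_places v <-> 0 < beta_of (gens_of v).
Proof.
have [k [kn ck vk]] := place_gens v; rewrite vk -/(beta_at k).
have h21 := ht21 adm; have h32 := ht32 adm; have h2D := ht2_lt adm.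
have bb := beta_neq0 ck.
rewrite /split_places /= /splits_at.
(* For infinite [b] the symbol [(1, 1)] always splits, and the criterion stays valid because beta is
   then the square of [trace h1 k + 2]. *)
have [b0|b0] := eqVneq b 0%N.
  have s1 : symbol1 R t = 1 by apply: val_inj; rewrite /= b0.
  have s2 : symbol2 R t = 1 by apply: val_inj; rewrite /= b0.
  rewrite s1 s2 !rmorph1; split => _; last first.
    by apply: (@quat_split _ 1 1 1); rewrite ?oner_eq0 ?expr1n.
  rewrite lt_neqAle eq_sym bb beta_atE.
  have h20 : h2 = 0%N by rewrite /ht2 /height b0.
  have h30 : h3 = 0%N by lia.
  rewrite h20 h30 /trace !muln0 mulr0 mul0r cos0 mulr1 -/(trace h1 k).
  have -> : trace h1 k ^+ 2 + 2 ^+ 2 + 2 ^+ 2 + trace h1 k * 2 * 2 - 4 =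
    (trace h1 k + 2) ^+ 2 by ring.
  exact: sqr_ge0.
have h20 : (0 < h2)%N.
  by have := ht_mul2 a c b0; rewrite lt0n; case: eqP => // ->; move: D0; lia.
have [m bm] : exists m, index_of b = Some m by rewrite /index_of (negbTE b0); exists b.
have symE : symbol R t = (lambda R (index_of b) ^+ 2 - 4,
    (lambda R (index_of b) + 2) * (lambda R (index_of c) + 2) * beta R t).
  by rewrite /symbol bm.
have s1 : symbol1 R t = e2 ^+ 2 - 4.
  apply: val_inj; rewrite rmorphB rmorphXn rmorph_nat.
  exact: (congr1 fst symE).
have s2 : symbol2 R t = (e2 + 2) * (e3 + 2) * (e1 + e2 + e3 + e4 + 2).
  apply: val_inj; rewrite !rmorphM (rmorphD _ e2) (rmorphD _ e3) (rmorphD _ _ 2).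
  rewrite (rmorphD _ _ e4) (rmorphD _ _ e3) (rmorphD _ e1) !rmorph_nat.
  exact: (congr1 snd symE).
rewrite s1 s2; set A := v _; set B := v _.
have [v1 v2 v3 v4] := vk.
have BE : B = (v e2 + 2) * (v e3 + 2) * beta_at k.
  rewrite /B !rmorphM (rmorphD _ e2) (rmorphD _ e3) (rmorphD _ _ 2).
  by rewrite (rmorphD _ _ e4) (rmorphD _ _ e3) (rmorphD _ e1) !rmorph_nat /beta_at -vk.
have AE : A = v e2 ^+ 2 - 4 by rewrite /A rmorphB rmorphXn rmorph_nat.
clear vk.
have t2 := trace_gt0 h2D; have t2' := trace_lt2 h20 h2D.
have t3 : 0 < trace h3 1 by apply: trace_gt0; lia.
have e2n : e2 + 2 != 0.
  apply/eqP => /(congr1 (@genfield_val R S)) h.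
  have {}h : lambda R (index_of b) + 2 = 0 by exact: h.
  move: h; rewrite (lambda_trace hP2).2 subrK => /eqP.
  by rewrite expf_eq0 gt_eqF.
have e3n : e3 + 2 != 0.
  apply/eqP => /(congr1 (@genfield_val R S)) h.
  have {}h : lambda R (index_of c) + 2 = 0 by exact: h.
  move: h; rewrite (lambda_trace hP3).2 subrK => /eqP.
  by rewrite expf_eq0 gt_eqF.
have e2m : e2 - 2 != 0.
  apply/eqP => /(congr1 (@genfield_val R S)) h.
  have {}h : lambda R (index_of b) - 2 = 0 by exact: h.
  by move: h; rewrite (lambda_trace hP2).2; apply: square_neq4.
have p2 : 0 < v e2 + 2.
  rewrite lt_neqAle [in X in _ && (_ <= X)]v2 subrK sqr_ge0 andbT eq_sym.
  by rewrite -(rmorph_nat v 2) -rmorphD fmorph_eq0.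
have p3 : 0 < v e3 + 2.
  rewrite lt_neqAle [in X in _ && (_ <= X)]v3 subrK sqr_ge0 andbT eq_sym.
  by rewrite -(rmorph_nat v 2) -rmorphD fmorph_eq0.
have n2 : v e2 - 2 < 0.
  have : v e2 - 2 <= 0 by rewrite v2; apply/square_le4/trace_norm.
  rewrite le_eqVlt => /orP[|//].
  by rewrite -(rmorph_nat v 2) -rmorphB fmorph_eq0 (negbTE e2m).
have A0 : A < 0.
  have -> : A = (v e2 - 2) * (v e2 + 2) by rewrite AE; ring.
  by rewrite nmulr_rlt0.
have B0 : (0 < B) = (0 < beta_at k) by rewrite BE pmulr_rgt0 // mulr_gt0.
split=> [h|h].
  rewrite ltNge; apply/negP => hb.
  have : beta_at k < 0 by rewrite lt_neqAle bb.
  move=> hb'; apply: (@quat_nonsplit R A B A0) h.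
  by rewrite BE pmulr_rlt0 // mulr_gt0.
rewrite -B0 in h.
apply: (@quat_split _ A B (Num.sqrt B)); first by rewrite lt_eqF.
  by rewrite gt_eqF // sqrtr_gt0.
by rewrite sqr_sqrtr // ltW.
Qed.

End TriplePlaces.

(** * Counting places through the exponents that induce them *)

Section Counting.
Local Open Scope nat_scope.

Lemma card_eq_size (U : choiceType) (s : seq U) (r : nat) : uniq s ->
  ([set` s] #= `I_r)%card <-> size s = r.
Proof.
move=> us; have h : ([set` s] #= `I_(size s))%card.
  case: s us => [|x0 s] us.
    by rewrite set_nil /= II0; apply: card_eq00.
  have <- : nth x0 (x0 :: s) @` `I_(size (x0 :: s)) = [set` x0 :: s].
    apply/seteqP; split => [y [i hi <-]|y ys] /=; first exact: mem_nth.
    by exists (index y (x0 :: s));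
      [change (index y (x0 :: s) < size (x0 :: s))%N; rewrite index_mem|rewrite nth_index].
  apply: inj_card_eq => i j; rewrite !inE /= => hi hj /eqP.
  by rewrite nth_uniq // => /eqP.
split=> [h'|<-//]; apply: card_eq_II.
  by apply: card_eq_trans h'; rewrite card_eq_sym.
Qed.

Lemma size_undup_fibers (U : eqType) (s : seq U) m :
  (forall x, x \in s -> count_mem x s = m) -> size s = (size (undup s) * m)%N.
Proof.
move=> h; rewrite -sum1_size -big_undup_iterop_count big_seq.
under eq_bigr => x do rewrite mem_undup => /h ->.
rewrite -big_seq big_const_seq count_predT.
have -> : iterop m addn 1 0 = m :> nat.
  by case: m {h} => // m; rewrite /iterop /=; elim: m => //= m ->; rewrite add1n.
by elim: (size _) => //= k ->; rewrite mulSn.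
Qed.

Lemma count_iota_odd (P : pred nat) m :
  count P (iota 0 (2 * m)) =
  (count (fun j => P (2 * j)%N) (iota 0 m) + count (fun j => P (2 * j).+1) (iota 0 m))%N.
Proof.
elim: m => [|m IH]; first by rewrite muln0.
have -> : iota 0 m.+1 = iota 0 m ++ [:: m] by rewrite -addn1 iotaD.
have -> : iota 0 (2 * m.+1) = iota 0 (2 * m) ++ [:: (2 * m)%N; (2 * m).+1].
  by rewrite mulnS addnC iotaD.
by rewrite !count_cat IH /= !addn0 addnACA.
Qed.

Lemma coprime_mul2 m k : coprime k (2 * m) = odd k && coprime k m.
Proof. by rewrite coprimeMr coprimen2. Qed.

Lemma count_coprime_odd (P : pred nat) m :
  count (fun k => coprime k (2 * m) && P k) (iota 0 (2 * m)) =
  count (fun j => coprime (2 * j).+1 m && P (2 * j).+1) (iota 0 m).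
Proof.
rewrite count_iota_odd.
rewrite (eq_count (a2 := pred0)) ?count_pred0 ?add0n; last first.
  by move=> j /=; rewrite coprime_mul2 oddM.
by apply: eq_count => j; rewrite coprime_mul2 /= oddM.
Qed.

Lemma perm_mul_mod m k : (0 < m)%N -> coprime k m ->
  perm_eq [seq (i * k) %% m | i <- iota 0 m] (iota 0 m).
Proof.
move=> m0 ck.
have um : uniq [seq (i * k) %% m | i <- iota 0 m].
  rewrite map_inj_in_uniq ?iota_uniq // => i j.
  wlog ij : i j / i <= j.
    by move=> W hi hj h; case: (leqP i j) => [|/ltnW] ij; [|apply/esym]; apply: W.
  rewrite !mem_iota !add0n /= => hi hj /esym/eqP.
  rewrite eqn_mod_dvd ?leq_mul2r ?ij ?orbT // -mulnBl Gauss_dvdl 1?coprime_sym //.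
  by case: (posnP (j - i)) => [|p /(dvdn_leq p)]; lia.
apply: uniq_perm; rewrite ?iota_uniq //.
apply: (uniq_min_size um _ _).2; last by rewrite size_map.
by move=> x /mapP[i _ ->]; rewrite mem_iota add0n /= ltn_mod.
Qed.

End Counting.

Section TripleCount.
Variables (R : realType) (a b c : nat).
Hypothesis adm : admissible a b c.
Local Notation D := (vol a b c).
Local Notation n := (2 * vol a b c)%N.
Local Notation t := (index_of a, index_of b, index_of c).
Local Notation h1 := (ht1 a b c).
Local Notation h2 := (ht2 a b c).
Local Notation h3 := (ht3 a b c).
Local Notation z := (zeta R n).
Local Notation gensk := (gens R a b c).
Local Notation betak := (beta_at R a b c).
Local Notation tracek := (trace R a b c).

Let D0 : (0 < D)%N := vol_gt0 a b c.
Let n0 : (0 < n)%N. Proof. by rewrite muln_gt0. Qed.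
Let zP := zeta_prim R n0.

(** Repetitions are kept: a split place occurs once for each exponent that induces it. *)
Definition split_gens := [seq gensk k | k <- iota 0 n & coprime k n && (0 < betak k)].

Lemma has_adimE r : has_adim R t r <-> size (undup split_gens) = r.
Proof.
rewrite -card_eq_size ?undup_uniq // /has_adim.
pose gp (v : {rmorphism trace_field R t -> R}) := @gens_of R a b c v.
have inj : {in split_places (R := R) (t := t) &, injective gp}.
  by move=> v w _ _ /gens_of_inj.
rewrite (_ : [set` undup split_gens] = gp @` split_places (R := R) (t := t)).
  by rewrite (card_eql (inj_card_eq inj)).
apply/seteqP; split => [g|g [v vs <-]] /=; rewrite mem_undup.
  move/mapP => [k]; rewrite mem_filter => /andP[/andP[ck bk] _] ->.
  have [v vk] := @gens_place R a b c k ck; exists v => //.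
  by apply/(split_place adm); rewrite vk.
have [k [kn ck vk]] := @place_gens R a b c v.
apply/mapP; exists k => //; rewrite mem_filter ck mem_iota add0n kn !andbT /=.
by move/(split_place adm): vs; rewrite vk.
Qed.

Lemma gens_eq k k' : (gensk k == gensk k') =
  [&& evalz (z ^+ k) (square_poly a b c h1) == evalz (z ^+ k') (square_poly a b c h1),
      evalz (z ^+ k) (square_poly a b c h2) == evalz (z ^+ k') (square_poly a b c h2),
      evalz (z ^+ k) (square_poly a b c h3) == evalz (z ^+ k') (square_poly a b c h3)
    & evalz (z ^+ k) (prod_poly a b c) == evalz (z ^+ k') (prod_poly a b c)].
Proof.
rewrite !evalz_square !evalz_prod !(inj_eq (@complexI R)) /gens.
by rewrite !xpair_eqE -!andbA.
Qed.

(** The relation on the right says that [z] is a root of [p \Po 'X^k' - p]; the one on the left says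
    the same of its conjugate [z ^+ k]. *)
Lemma evalz_mul_eq k k' p : coprime k n ->
  (evalz (z ^+ (k' * k)) p == evalz (z ^+ k) p) = (evalz (z ^+ k') p == evalz (z ^+ 1) p).
Proof.
move=> ck; pose q := p \Po 'X^k' - p.
have qE x : evalz x q = evalz (x ^+ k') p - evalz x p.
  by rewrite /q evalzB /evalz map_comp_poly map_polyXn horner_comp hornerXn.
rewrite (mulnC k' k) exprM -subr_eq0 -qE evalz_eq0 // qE subr_eq0.
by rewrite expr1.
Qed.

Lemma gens_mul_eq k k' : coprime k n ->
  (gensk (k' * k)%N == gensk k) = (gensk k' == gensk 1).
Proof. by move=> ck; rewrite !gens_eq !evalz_mul_eq. Qed.

Lemma gens_mod k : gensk (k %% n)%N = gensk k.
Proof. by apply/eqP; rewrite gens_eq (prim_expr_mod zP) !eqxx. Qed.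

(** Multiplication by [k] modulo [n] permutes the residues and carries the stabilizer of the
    generators onto the fiber of [k]. *)
Lemma count_fiber k : coprime k n ->
  count (fun i => coprime i n && (gensk i == gensk k)) (iota 0 n) =
  count (fun i => coprime i n && (gensk i == gensk 1)) (iota 0 n).
Proof.
move=> ck; have /permP <- := perm_mul_mod n0 ck.
rewrite count_map; apply: eq_count => i /=.
by rewrite coprime_modl gens_mod coprimeMl ck andbT gens_mul_eq.
Qed.

Lemma size_split_gens : size split_gens =
  (size (undup split_gens) *
   count (fun i => coprime i n && (gensk i == gensk 1)) (iota 0 n))%N.
Proof.
apply: size_undup_fibers => x /mapP[k].
rewrite mem_filter => /andP[/andP[ck bk] _] ->.
rewrite count_map count_filter -(count_fiber ck); apply: eq_count => i /=.
case: eqP => [e|_]; rewrite ?andbF //= andbT /beta_at e.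
by rewrite -[X in 0 < X]/(betak k) bk andbT.
Qed.

Lemma foldE d h k : fold d h k = fold d (k * h) 1.
Proof. by rewrite /fold mul1n. Qed.

Lemma fold_same h k : (2 * h <= D)%N -> (fold D h k == h) = (tracek h k == tracek h 1).
Proof.
move=> hD; apply/eqP/eqP => e; rewrite /trace ?mul1n.
  by rewrite (cos_fold R (k * h) D0) -foldE e.
rewrite foldE; apply: (@cos_eq_fold R) => //; first by lia.
by move: e; rewrite /trace mul1n => /mulfI; apply; rewrite pnatr_eq0.
Qed.

Lemma fold_opp h k : (2 * h <= D)%N -> (fold D h k == D - h)%N = (tracek h k == - tracek h 1).
Proof.
move=> hD; have DR0 : D%:R != 0 :> R by rewrite pnatr_eq0 -lt0n.
have hN : cos (pi * (D - h)%:R / D%:R) = - cos (pi * h%:R / D%:R) :> R.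
  rewrite natrB; last by lia.
  have -> : pi * (D%:R - h%:R) / D%:R = - (pi * h%:R / D%:R) + pi :> R by field.
  by rewrite cosDpi cosN.
apply/eqP/eqP => e; rewrite /trace ?mul1n.
  by rewrite (cos_fold R (k * h) D0) -foldE e hN mulrN.
rewrite foldE; apply: (@cos_eq_fold R) => //; first by lia.
rewrite hN; move: e; rewrite /trace mul1n -mulrN => /mulfI; apply.
by rewrite pnatr_eq0.
Qed.

(** Equal squares determine each trace up to sign, and the equal product forbids an odd number of
    sign changes unless it is zero. As [ht2_lt] makes the other two traces nonzero, that means
    [x1 = 0], and then the sign of the first trace can be chosen freely. *)
Lemma gens_fixed k : (gensk k == gensk 1) = fixed_by a b c k.
Proof.
have l1 := ht1_le adm; have l2 := ht2_lt adm.
have l3 : (2 * h3 < D)%N by have := ht32 adm; lia.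
have p2 := trace_gt0 R l2; have p3 := trace_gt0 R l3.
rewrite /fixed_by !fold_same ?(ltnW l2) ?(ltnW l3) //.
rewrite !fold_opp ?(ltnW l2) ?(ltnW l3) //.
rewrite /gens !xpair_eqE -/(tracek _ _).
move: (tracek h1 k) (tracek h2 k) (tracek h3 k) (tracek h1 1) (tracek h2 1) (tracek h3 1) p2 p3.
clear => x y u x1 y1 u1 py pu.
have yu : y1 * u1 != 0 by rewrite mulf_neq0 ?gt_eqF.
rewrite !(inj_eq (addIr _)) !eqf_sqr; apply/idP/idP.
  move=> /andP[/andP[/andP[hx hy] hu] /eqP hp].
  have key : x * y * u = - (x1 * y1 * u1) -> x1 = 0.
    move=> e; move: hp; rewrite e => /eqP; rewrite -subr_eq0 -opprD oppr_eq0 -mulr2n.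
    by rewrite mulrn_eq0 /= -mulrA mulf_eq0 (negbTE yu) orbF => /eqP.
  case/orP: hx => /eqP ex; case/orP: hy => /eqP ey; case/orP: hu => /eqP eu;
    subst x y u; rewrite !eqxx ?orbT //=;
    (have -> : x1 = 0 by apply: key; ring); by rewrite ?oppr0 !eqxx ?orbT.
case/or4P => /and3P[/eqP -> /eqP -> /eqP ->]; rewrite ?eqxx ?orbT //=;
  apply/eqP; ring.
Qed.

Lemma count_fixed_gt0 :
  (0 < count (fun j => coprime (2 * j).+1 D && fixed_by a b c (2 * j).+1) (iota 0 D))%N.
Proof.
rewrite -has_count; apply/hasP; exists 0%N; first by rewrite mem_iota add0n.
by rewrite muln0 coprime1n -gens_fixed eqxx.
Qed.

(** The equation determines [r], since the stabilizer contains [k = 1] and its count is positive.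
    Exponents prime to [2 * D] are odd, hence the substitution [k = 2j + 1]. *)
Theorem has_adim_count r : has_adim R t r <->
  count (fun j => coprime (2 * j).+1 D && split_at a b c (2 * j).+1) (iota 0 D) =
  (r * count (fun j => coprime (2 * j).+1 D && fixed_by a b c (2 * j).+1) (iota 0 D))%N.
Proof.
have hs := size_split_gens.
rewrite size_map size_filter in hs.
have c1 k : (coprime k n && (0 < betak k)) = (coprime k n && split_at a b c k).
  by case E: (coprime k n) => //=; rewrite (beta_gt0_split R adm E).
have c2 k : (coprime k n && (gensk k == gensk 1)) = (coprime k n && fixed_by a b c k).
  by rewrite gens_fixed.
rewrite (eq_count c1) (eq_count c2) in hs.
rewrite !count_coprime_odd in hs; rewrite hs has_adimE.
have p := count_fixed_gt0; split=> [->//|/eqP].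
by rewrite eqn_pmul2r // => /eqP.
Qed.

Lemma adim_lower_bound r (ks : seq nat) : has_adim R t r ->
  (forall k, k \in ks -> [/\ (k < n)%N, coprime k n & split_at a b c k]) ->
  uniq [seq gensk k | k <- ks] -> (size ks <= r)%N.
Proof.
move=> /has_adimE <- hk uk; rewrite -(size_map gensk); apply: uniq_leq_size => // x.
move=> /mapP[k /hk[kn ck sk] ->]; rewrite mem_undup; apply/mapP; exists k => //.
by rewrite mem_filter ck (beta_gt0_split R adm ck) sk mem_iota add0n.
Qed.

(** The square of a trace is 2 plus the trace at the doubled angle, which stays below [pi], where
    cosine is injective. *)
Lemma cos_gens_inj h k k' : (0 < h)%N -> (2 * (k * h) < D)%N -> (2 * (k' * h) < D)%N ->
  tracek h k ^+ 2 = tracek h k' ^+ 2 -> k = k'.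
Proof.
move=> h0 kD kD' e.
have DR0 : D%:R != 0 :> R by rewrite pnatr_eq0 -lt0n.
have : tracek (2 * h) k = tracek (2 * h) k'.
  have dbl i : tracek (2 * h) i = tracek h i ^+ 2 - 2.
    rewrite /trace mulnCA natrM.
    have -> : pi * (2 * (i * h)%:R) / D%:R = 2 * (pi * (i * h)%:R / D%:R) :> R by field.
    by rewrite cos_double; ring.
  by rewrite !dbl e.
rewrite /trace => /mulfI; rewrite pnatr_eq0 => /(_ isT) {}e.
have := @cos_eq_fold R D (k * (2 * h)) (k' * (2 * h)) D0; rewrite e => /(_ _ erefl).
rewrite (mulnCA k) (mulnCA k') (ltnW kD') /fold mul1n modn_small => [/(_ isT)|]; last by lia.
rewrite /minn; case: ifP => [_|_ hk]; first by move=> h'; exfalso; lia.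
have {}hk : (k * h = k' * h)%N by lia.
by apply/eqP; rewrite -(eqn_pmul2r h0); apply/eqP.
Qed.

End TripleCount.

(** * Bounds on the triples of a given dimension *)

Section Chebyshev.
Local Open Scope nat_scope.

Definition prime_count x := count prime (iota 0 x).

(** By Legendre's formula the exponent is a sum over [k] of the quotient of [2 * m] by [p ^ k] minus
    twice that of [m]. Each term is at most 1 and vanishes once [p ^ k] exceeds [2 * m]. *)
Lemma logn_central_bin p m : prime p -> 0 < m -> p ^ logn p 'C(2 * m, m) <= 2 * m.
Proof.
move=> pp m0; have p1 := prime_gt1 pp.
have mm : m <= 2 * m by rewrite leq_pmull.
have e := bin_fact mm; have e2 : 2 * m - m = m by lia.
rewrite e2 in e.
have b0 : 0 < 'C(2 * m, m) by rewrite bin_gt0.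
have f0 := fact_gt0 m.
have : logn p (2 * m)`! = logn p 'C(2 * m, m) + 2 * logn p m`!.
  have := congr1 (logn p) e; rewrite lognM ?muln_gt0 ?f0 // lognM // => <-.
  by lia.
rewrite !logn_fact // => h.
set T := trunc_log p (2 * m).
have hT : p ^ T <= 2 * m by apply: trunc_logP => //; lia.
apply: leq_trans (hT); rewrite leq_exp2l //.
have h1 : \sum_(1 <= k < (2 * m).+1) (2 * m) %/ p ^ k <=
   \sum_(1 <= k < (2 * m).+1) ((k <= T) + 2 * (m %/ p ^ k)).
  rewrite big_nat_cond [X in _ <= X]big_nat_cond; apply: leq_sum => k /andP[/andP[k1 k2] _].
  have pk : 0 < p ^ k by rewrite expn_gt0 ltnW.
  case: (leqP k T) => kT.
    rewrite -ltnS addnC -addnS ltn_divLR // mulnDl -mulnA.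
    have := divn_eq m (p ^ k); have := ltn_pmod m pk; lia.
  rewrite divn_small // ltnNge; apply/negP => hk.
  by have := trunc_log_max p1 hk; rewrite -/T; lia.
have h2 : \sum_(1 <= k < (2 * m).+1) 2 * (m %/ p ^ k) = 2 * \sum_(1 <= k < m.+1) m %/ p ^ k.
  rewrite -big_distrr /=; congr (2 * _).
  rewrite (big_cat_nat (n := m.+1)) //= ?ltnS //.
  rewrite [X in _ + X](_ : _ = 0) ?addn0 // big_nat_cond big1 // => k /andP[/andP[k1 _] _].
  apply: divn_small; apply: leq_trans k1 _; exact: ltnW (ltn_expl _ p1).
have h3 : \sum_(1 <= k < (2 * m).+1) (k <= T) <= T.
  have TT : T <= 2 * m by apply: leq_trans (hT); apply: ltnW (ltn_expl _ p1).
  rewrite (big_cat_nat (n := T.+1)) //= ?ltnS //.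
  rewrite [X in _ + X](_ : _ = 0) ?addn0; last first.
    by rewrite big_nat_cond big1 // => k /andP[/andP[k1 _] _]; rewrite leqNgt k1.
  apply: (@leq_trans (\sum_(1 <= k < T.+1) 1)).
    by apply: leq_sum => k _; apply: leq_b1.
  by rewrite sum_nat_const_nat muln1 subn1.
rewrite big_split /= h2 in h1; rewrite h in h1.
by move: h1 h3; set A := \sum_(1 <= k < (2 * m).+1) (k <= T); lia.
Qed.

Lemma central_bin_ge m : 2 ^ m <= 'C(2 * m, m).
Proof.
elim: m => [|m IH] //.
have h : 'C(2 * m.+1, m.+1) = 2 * 'C((2 * m).+1, m).
  rewrite mulnS add2n binS.
  have -> : 'C((2 * m).+1, m.+1) = 'C((2 * m).+1, m).
    have mm : m <= (2 * m).+1 by lia.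
    by rewrite -(bin_sub mm) (_ : (2 * m).+1 - m = m.+1) //; lia.
  by lia.
rewrite h expnS leq_mul2l /=; apply: leq_trans IH _.
case: m {h} => [|m] //; rewrite [X in _ <= X]binS; lia.
Qed.

Lemma prime_dvd_fact p m : prime p -> p %| m`! -> p <= m.
Proof.
move=> pp; elim: m => [|m IH].
  by rewrite fact0 dvdn1 => /eqP p1; rewrite p1 in pp.
rewrite factS Euclid_dvdM // => /orP[/dvdn_leq|/IH/leqW //]; exact.
Qed.

(** The central binomial coefficient is at least [2 ^ m], and it is a product of prime powers of
    size at most [2 ^ l], one for each of its prime divisors, all of which are below [x]. *)
Lemma chebyshev x m l : (2 * m < x) -> 2 * m <= 2 ^ l -> m <= l * prime_count x.
Proof.
move=> mx ml; have [->|m0] := posnP m; first by [].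
have b0 : 0 < 'C(2 * m, m) by rewrite bin_gt0 leq_pmull.
rewrite -(@leq_exp2l 2) //; apply: leq_trans (central_bin_ge m) _.
rewrite {1}(prod_prime_decomp b0) prime_decompE big_map /=.
apply: (@leq_trans (\prod_(p <- primes 'C(2 * m, m)) 2 ^ l)).
  rewrite big_seq [X in _ <= X]big_seq; apply: leq_prod => p.
  rewrite mem_primes => /and3P[pp _ _].
  by apply: leq_trans (logn_central_bin pp m0) ml.
rewrite big_const_seq count_predT iter_muln muln1 -expnM leq_exp2l // leq_mul2l.
apply/orP; right; rewrite /prime_count -size_filter.
apply: uniq_leq_size; first exact: primes_uniq.
move=> p; rewrite mem_primes => /and3P[pp _ pd].
rewrite mem_filter pp mem_iota add0n /=; apply: leq_ltn_trans mx.
apply: prime_dvd_fact pp _.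
by rewrite -(bin_fact (leq_pmull m (isT : 0 < 2))) dvdn_mulr.
Qed.

Lemma size_primes_le k : 0 < k -> 2 ^ size (primes k) <= k.
Proof.
move=> k0; rewrite {2}(prod_prime_decomp k0) prime_decompE big_map /=.
apply: (@leq_trans (\prod_(p <- primes k) 2)).
  by rewrite big_const_seq count_predT iter_muln muln1.
rewrite big_seq [X in _ <= X]big_seq; apply: leq_prod => p pk.
have := pk; rewrite mem_primes => /and3P[pp _ _].
have : 0 < logn p k by rewrite logn_gt0.
case: (logn p k) => // e _; rewrite expnS.
by apply: leq_trans (leq_pmulr _ _); rewrite ?prime_gt1 // expn_gt0 prime_gt0.
Qed.

Definition good_primes x k := [seq p <- iota 0 x | prime p && ~~ (p %| k)].

(** The prime divisors of [k] have a product of at most [k] and are each at least 2, so at most [l]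
    primes are lost. *)
Lemma size_good_primes x k l : 0 < k -> k <= 2 ^ l ->
  prime_count x <= size (good_primes x k) + l.
Proof.
move=> k0 kl; rewrite /prime_count /good_primes size_filter.
have : count prime (iota 0 x) <= count (fun p => prime p && ~~ (p %| k)) (iota 0 x)
     + count (fun p => prime p && (p %| k)) (iota 0 x).
  rewrite -count_predUI; apply: leq_trans (leq_addr _ _); apply: sub_count => p /= ->.
  by case: (p %| k).
move/leq_trans; apply; rewrite leq_add2l.
have : size [seq p <- iota 0 x | prime p && (p %| k)] <= size (primes k).
  apply: uniq_leq_size; first by rewrite filter_uniq ?iota_uniq.
  by move=> p; rewrite mem_filter mem_primes k0 => /andP[].
rewrite size_filter => /leq_trans; apply.
by rewrite -(@leq_exp2l 2) //; apply: leq_trans (size_primes_le k0) kl.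
Qed.

End Chebyshev.

(** * Small exponents at which the algebra splits *)

Section SmallConjugates.
Local Open Scope nat_scope.
Variables (a b c : nat).
Hypothesis adm : admissible a b c.
Local Notation D := (vol a b c).
Local Notation h1 := (ht1 a b c).
Local Notation h2 := (ht2 a b c).
Local Notation h3 := (ht3 a b c).
Local Notation w0 := (wt0 a b c).
Local Notation w1 := (wt1 a b c).
Local Notation w2 := (wt2 a b c).
Local Notation w3 := (wt3 a b c).

Let D0 : 0 < D := vol_gt0 a b c.

Let D20 : 0 < 2 * D. Proof. by rewrite muln_gt0. Qed.

Lemma crossings_eq q w k : 2 * D * q <= k * w + D < 2 * D * q.+1 -> crossings D w k = q.
Proof.
move=> /andP[u1 u2]; rewrite /crossings; apply/eqP; rewrite eqn_leq.
apply/andP; split; last by rewrite leq_divRL // mulnC.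
by rewrite -ltnS ltn_divLR // [q.+1 * _]mulnC.
Qed.

(* If [k * v + D] is a multiple of [u] but not of [2 * D], where [u] divides
   [2 * D], then moving it by less than [u] crosses no multiple of [2 * D]. *)
Lemma crossings_near u v m w k : 2 * D = u * m -> u %| k * v + D ->
  ~~ (2 * D %| k * v + D) -> k * v < k * w + u -> k * w < k * v + u ->
  crossings D w k = crossings D v k.
Proof.
move=> Du /dvdnP[s hs] nd lo hi.
have u0 : 0 < u by have := D20; rewrite Du muln_gt0 => /andP[].
apply: crossings_eq; rewrite /crossings.
have e := divn_eq (k * v + D) (2 * D); set q := _ %/ _ in e *.
have r1 : (k * v + D) %% (2 * D) < 2 * D by rewrite ltn_mod.
have r0 : 0 < (k * v + D) %% (2 * D) by rewrite lt0n.
have [r hr] : exists r, (k * v + D) %% (2 * D) = u * r.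
  have : u %| (k * v + D) %% (2 * D).
    rewrite -(@dvdn_addr (q * (2 * D))); last by rewrite Du mulnCA dvdn_mulr.
    by rewrite -e hs dvdn_mull.
  by case/dvdnP => r ->; exists r; rewrite mulnC.
rewrite hr in e r1 r0.
have r2 : u <= u * r.
  rewrite -[X in X <= _]muln1 leq_mul2l.
  by case: r r0 {hr e r1} => [|r]; rewrite ?muln0 // orbT.
have r3 : u * r + u <= 2 * D.
  by move: r1; rewrite Du ltn_mul2l u0 /= => r1; rewrite -mulnSr leq_mul2l r1 orbT.
have e' : q * (2 * D) = 2 * D * q by rewrite mulnC.
rewrite mulnSr; apply/andP; split; lia.
Qed.

(** No weight exceeds [3 * h1], so [k * w < D] throughout and nothing is crossed. *)
Lemma split_small_a k : a != 0 -> 3 * k < a -> split_at a b c k.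
Proof.
move=> a0 ka; have h := ht_mul1 b c a0; have h21 := ht21 adm; have h32 := ht32 adm.
have kh : k * (3 * h1) < D.
  rewrite -h mulnCA mulnA mulnC ltn_mul2l ka andbT.
  by case: (posnP h1) h => [->|//] h; move: (D0); rewrite -h.
have near w : w <= 3 * h1 -> crossings D w k = 0.
  move=> hw; apply: crossings_eq; rewrite muln0 muln1 /=.
  have : k * w <= k * (3 * h1) by rewrite leq_mul2l hw orbT.
  by lia.
by rewrite /split_at !near ?/wt0 ?/wt1 ?/wt2 ?/wt3 //; lia.
Qed.

(** The four weights differ from [h1] by at most [h2 + h3], and [k * (h2 + h3) < h1]. The central
    value [k * h1 + D = h1 * (k + a)] is a multiple of [h1] but not of [2 * D], since [a] is greater
    than 1 and prime to [k]. So all four crossing numbers agree and their sum is even. *)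
Lemma split_small_b k : a != 0 -> b != 0 -> 0 < k -> coprime k a -> 2 * (k * a) < b ->
  split_at a b c k.
Proof.
move=> a0 b0 k0 cka kb; have e1 := ht_mul1 b c a0; have e2 := ht_mul2 a c b0.
have h32 := ht32 adm.
have a1 : 1 < a by case: adm => /and3P[]; move: a0; lia.
have h2p : 0 < h2 by case: (posnP h2) e2 => // ->; move=> h; move: (D0); rewrite -h.
have kh : k * (h2 + h3) < h1.
  have : k * (h2 + h3) * a < h1 * a; last by rewrite ltn_mul2r => /andP[].
  rewrite e1 -e2; apply: (@leq_ltn_trans (h2 * (2 * (k * a)))).
    have : k * h3 * a <= k * h2 * a by rewrite leq_mul2r leq_mul2l h32 !orbT.
    by rewrite mulnDr mulnDl; lia.
  by rewrite ltn_mul2l h2p.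
have kh' : h2 + h3 < h1 by apply: leq_ltn_trans kh; rewrite leq_pmull.
have hu : h1 %| k * h1 + D by rewrite -e1 (mulnC k) -mulnDr dvdn_mulr.
have hn : ~~ (2 * D %| k * h1 + D).
  rewrite -e1 (mulnC k) -mulnDr mulnCA dvdn_pmul2l; last by lia.
  apply/negP => /(dvdn_trans (dvdn_mull 2 (dvdnn a))).
  rewrite dvdn_addl // => ak; move: cka; rewrite /coprime.
  have /gcdn_idPr -> := ak; lia.
have near w : k * h1 < k * w + h1 -> k * w < k * h1 + h1 -> crossings D w k = crossings D h1 k.
  by apply: (crossings_near (m := 2 * a)) => //; rewrite -e1 mulnCA.
have n0 : crossings D w0 k = crossings D h1 k by apply: near; rewrite /wt0; nia.
have n1 : crossings D w1 k = crossings D h1 k by apply: near; rewrite /wt1; nia.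
have n2 : crossings D w2 k = crossings D h1 k by apply: near; rewrite /wt2; nia.
have n3 : crossings D w3 k = crossings D h1 k by apply: near; rewrite /wt3; nia.
by rewrite /split_at n0 n1 n2 n3 !oddD; case: (odd _).
Qed.

(** Now [h1 + h2] and [h1 - h2] are multiples of [c], and the weights differ from them by
    [h3 = a * b] with [k * h3 < c]. A multiple of [2 * D] at the center would make [a * b] divide
    [a + b] or [b - a], impossible by size unless [b = a]; in that case the center is [D] itself. So
    the crossing numbers agree in pairs. *)
Lemma split_small_c k : a != 0 -> b != 0 -> c != 0 -> 0 < k -> coprime k (a * b) ->
  k * (a * b) < c -> split_at a b c k.
Proof.
move=> a0 b0 c0 k0 ckab kc.
have E1 : h1 = b * c by rewrite /ht1 /height /den (negbTE a0) (negbTE b0) (negbTE c0).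
have E2 : h2 = a * c by rewrite /ht2 /height /den (negbTE a0) (negbTE b0) (negbTE c0).
have E3 : h3 = a * b by rewrite /ht3 /height /den (negbTE a0) (negbTE b0) (negbTE c0).
have ED : D = a * b * c by rewrite /vol /den (negbTE a0) (negbTE b0) (negbTE c0).
have h21 := ht21 adm; have h32 := ht32 adm.
have a1 : 1 < a by case: adm => /and3P[]; move: a0; lia.
have b2 : 2 < b.
  have := ht2_lt adm; rewrite E2 ED (_ : a * b * c = b * (a * c)); last by ring.
  by rewrite ltn_mul2r => /andP[].
have ab : a <= b by move: h21; rewrite E1 E2 leq_mul2r (negbTE c0).
have abp : 0 < a * b by rewrite muln_gt0; lia.
have Du : 2 * D = c * (2 * (a * b)) by rewrite ED; ring.
have nd x : ~~ (a * b %| x) || (x == 0) -> ~~ (2 * D %| k * (x * c) + D).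
  move=> hx; have -> : k * (x * c) + D = c * (k * x + a * b) by rewrite ED; ring.
  rewrite Du dvdn_pmul2l; last by lia.
  have [->|x0] := eqVneq x 0.
    by rewrite muln0 add0n; apply/negP => /dvdn_leq; lia.
  move: hx; rewrite (negbTE x0) orbF => nx; apply/negP => h.
  have := dvdn_trans (dvdn_mull 2 (dvdnn (a * b))) h.
  by rewrite dvdn_addl // Gauss_dvdr 1?coprime_sym // (negbTE nx).
have du x : c %| k * (x * c) + D by rewrite ED dvdn_add ?dvdn_mull // mulnA dvdn_mull.
have V1 : h1 + h2 = (a + b) * c by rewrite E1 E2; ring.
have V2 : h1 - h2 = (b - a) * c by rewrite E1 E2 mulnBl.
have ndp : ~~ (a * b %| a + b).
  by apply/negP => /dvdn_leq h; have := h (ltn_addr _ _); nia.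
have ndm : ~~ (a * b %| b - a) || (b - a == 0).
  by case: (posnP (b - a)) => [->|p]; rewrite ?orbT //; apply/orP; left; apply/negP => /(dvdn_leq p); nia.
have n0 : crossings D w0 k = crossings D (h1 + h2) k.
  rewrite V1; apply: (crossings_near Du (du _) (nd _ _)); first by rewrite ndp.
    by rewrite -V1 /wt0 mulnDr; lia.
  by rewrite -V1 /wt0 mulnDr E3; lia.
have n1 : crossings D w1 k = crossings D (h1 + h2) k.
  rewrite V1; apply: (crossings_near Du (du _) (nd _ _)); first by rewrite ndp.
    by rewrite -V1 /wt1 mulnBr E3; lia.
  by rewrite -V1 /wt1 mulnBr E3; lia.
have n2 : crossings D w2 k = crossings D (h1 - h2) k.
  rewrite V2; apply: (crossings_near Du (du _) (nd _ ndm)).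
    by rewrite -V2 /wt2 (_ : h1 + h3 - h2 = (h1 - h2) + h3) ?mulnDr; lia.
  by rewrite -V2 /wt2 (_ : h1 + h3 - h2 = (h1 - h2) + h3) ?mulnDr ?E3; lia.
(* The absolute value in [wt3] changes branch only if [(b - a) * c < a * b < c]. Then [b = a], and
   [wt3] equals [wt2]. *)
have n3 : crossings D w3 k = crossings D (h1 - h2) k.
  case: (leqP (h2 + h3) h1) => hh.
    have -> : w3 = (h1 - h2) - h3 by rewrite /wt3; lia.
    rewrite V2; apply: (crossings_near Du (du _) (nd _ ndm)).
      by rewrite -V2 (mulnBr k (h1 - h2)) E3; move: (k * (h1 - h2)) => X; lia.
    by rewrite -V2 (mulnBr k (h1 - h2)) E3; move: (k * (h1 - h2)) => X; lia.
  have ba : b - a = 0.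
    have : h1 - h2 < h3 by lia.
    rewrite V2 E3 => h; case: (posnP (b - a)) => // p.
    have : c <= (b - a) * c by rewrite leq_pmull.
    have : a * b <= k * (a * b) by rewrite leq_pmull.
    by lia.
  by rewrite -n2; congr crossings; move: V2; rewrite ba mul0n /wt3 /wt2; lia.
by rewrite /split_at n0 n1 n2 n3 !oddD; case: (odd _); case: (odd _).
Qed.

End SmallConjugates.

Section Bounds.
Local Open Scope nat_scope.
Variables (R : realType) (a b c r : nat).
Hypothesis adm : admissible a b c.
Hypothesis adim : has_adim R (index_of a, index_of b, index_of c) r.
Local Notation D := (vol a b c).

(* A range of small exponents that split and are told apart by one of the
   generators yields that many split places. *)
Lemma prime_count_le h x l : 2 * D <= 2 ^ l ->
  h \in [:: ht1 a b c; ht2 a b c; ht3 a b c] -> 0 < h ->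
  (forall k, k < x -> 2 * (k * h) < D) ->
  (forall k, 0 < k < x -> coprime k (2 * D) -> split_at a b c k) ->
  prime_count x <= r + l.
Proof.
move=> Dl hin h0 hx hs.
have D0 : 0 < D := vol_gt0 a b c.
have D20 : 0 < 2 * D by rewrite muln_gt0.
apply: leq_trans (size_good_primes x D20 Dl) _; rewrite leq_add2r.
have gP k : k \in good_primes x (2 * D) -> [/\ prime k, k < x & coprime k (2 * D)].
  rewrite mem_filter mem_iota add0n => /andP[/andP[pk nk] kx]; split => //.
  by rewrite prime_coprime.
apply: (@adim_lower_bound R a b c adm) => //.
  move=> k /gP[pk kx ck]; split => //; last by apply: hs; rewrite ?prime_gt0.
  have := hx k kx; have : k <= k * h by rewrite leq_pmulr.
  by lia.
rewrite map_inj_in_uniq ?filter_uniq ?iota_uniq // => k k' /gP[_ kx _] /gP[_ kx' _].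
move=> [e1 e2 e3 _]; apply: (@cos_gens_inj R a b c h) => //; try exact: hx.
by move: hin; rewrite !inE => /or3P[] /eqP ->; apply: (addIr (- 2)%R).
Qed.

Lemma prime_count_a l : a != 0 -> 2 * D <= 2 ^ l -> prime_count (a.-1 %/ 3).+1 <= r + l.
Proof.
move=> a0 Dl; have e := ht_mul1 b c a0; have D0 := vol_gt0 a b c.
have h0 : 0 < ht1 a b c by case: (posnP (ht1 a b c)) e => // -> h; rewrite -h in D0.
have ka k : k < (a.-1 %/ 3).+1 -> 3 * k < a.
  by rewrite ltnS leq_divRL // => h; lia.
apply: (prime_count_le (h := ht1 a b c)) => //; first by rewrite inE eqxx.
  by move=> k /ka h; rewrite -e mulnA mulnC ltn_mul2l h0; lia.
by move=> k /andP[k0 /ka h] _; apply: split_small_a.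
Qed.

Lemma prime_count_b l : a != 0 -> b != 0 -> 2 * D <= 2 ^ l ->
  prime_count (b.-1 %/ (2 * a)).+1 <= r + l.
Proof.
move=> a0 b0 Dl; have e := ht_mul2 a c b0; have D0 := vol_gt0 a b c.
have h0 : 0 < ht2 a b c by case: (posnP (ht2 a b c)) e => // -> h; rewrite -h in D0.
have kb k : k < (b.-1 %/ (2 * a)).+1 -> 2 * (k * a) < b.
  by rewrite ltnS leq_divRL ?muln_gt0 ?lt0n // => h; lia.
apply: (prime_count_le (h := ht2 a b c)) => //; first by rewrite !inE eqxx orbT.
  move=> k /kb h; rewrite -e mulnA mulnC ltn_mul2l h0 /=; apply: leq_ltn_trans h.
  by rewrite leq_mul2l /= leq_pmulr // lt0n.
move=> k /andP[k0 /kb h] ck; apply: split_small_b => //.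
apply: coprime_dvdr ck; rewrite -(ht_mul1 b c a0) mulnA; exact: dvdn_mull.
Qed.

Lemma prime_count_c l : a != 0 -> b != 0 -> c != 0 -> 2 * D <= 2 ^ l ->
  prime_count (c.-1 %/ (a * b)).+1 <= r + l.
Proof.
move=> a0 b0 c0 Dl; have e := ht_mul3 a b c0; have D0 := vol_gt0 a b c.
have h0 : 0 < ht3 a b c by case: (posnP (ht3 a b c)) e => // -> h; rewrite -h in D0.
have kc k : k < (c.-1 %/ (a * b)).+1 -> k * (a * b) < c.
  by rewrite ltnS leq_divRL ?muln_gt0 ?lt0n ?a0 // => h; lia.
have a1 : 1 < a by case: adm => /and3P[]; move: a0; lia.
apply: (prime_count_le (h := ht3 a b c)) => //; first by rewrite !inE eqxx !orbT.
  move=> k /kc h; rewrite -e mulnA mulnC ltn_mul2l h0 /=; apply: leq_ltn_trans h.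
  rewrite mulnC leq_mul2l; apply/orP; right; apply: leq_trans a1 _.
  by rewrite leq_pmulr // lt0n.
move=> k /andP[k0 /kc h] ck; apply: split_small_c => //.
apply: coprime_dvdr ck; rewrite /vol /den (negbTE a0) (negbTE b0).
by rewrite dvdn_mull // dvdn_mulr.
Qed.

(** [m] is the longest of the three ranges of exponents, so its prime count is bounded by whichever
    range attains the maximum, while all three entries are bounded in terms of [m]. An infinite
    entry gets the range 1, which contains no prime. *)
Lemma index_bounds : exists m, [/\ 0 < m, a <= 3 * m, b <= 6 * m ^ 2, c <= 18 * m ^ 4 &
  forall l, m <= 2 ^ l -> prime_count m <= r + (10 + 7 * l)].
Proof.
have D0 := vol_gt0 a b c.
pose xa := if a == 0 then 1 else (a.-1 %/ 3).+1.
pose xb := if b == 0 then 1 else (b.-1 %/ (2 * a)).+1.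
pose xc := if c == 0 then 1 else (c.-1 %/ (a * b)).+1.
pose m := maxn xa (maxn xb xc).
have [ord1 ord2] : leqi (index_of a) (index_of b) /\ leqi (index_of b) (index_of c).
  by case: adm => _ /andP[].
have ba0 : b != 0 -> a != 0.
  by move: ord1; rewrite /index_of; case: (a) => [|?]; case: (b) => [|?] //=.
have cb0 : c != 0 -> b != 0.
  by move: ord2; rewrite /index_of; case: (b) => [|?]; case: (c) => [|?] //=.
have up d y : 0 < d -> y <= d * (y.-1 %/ d).+1.
  by move=> d0; have := ltn_ceil y.-1 d0; rewrite mulnC; case: y.
have ha : a <= 3 * xa by rewrite /xa; case: eqP => [->|_] //; apply: up.
have hb : b <= 2 * a * xb.
  by rewrite /xb; case: eqP => [->|/eqP/ba0 a0] //; apply: up; rewrite muln_gt0 /= lt0n.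
have hc : c <= a * b * xc.
  rewrite /xc; case: eqP => [->|/eqP c0] //; apply: up.
  by rewrite muln_gt0 !lt0n ba0 cb0 ?c0 ?cb0.
have xa0 : 0 < xa by rewrite /xa; case: eqP.
have [ma mb mc] : [/\ xa <= m, xb <= m & xc <= m].
  by split; rewrite !leq_max leqnn ?orbT.
have m0 : 0 < m by apply: leq_trans ma.
have a3 : a <= 3 * m by apply: leq_trans ha _; rewrite leq_mul2l ma.
have b6 : b <= 6 * m ^ 2.
  apply: leq_trans hb _; rewrite (_ : 6 * m ^ 2 = 2 * (3 * m) * m); last by ring.
  by rewrite leq_mul // leq_mul.
have c18 : c <= 18 * m ^ 4.
  apply: leq_trans hc _; rewrite (_ : 18 * m ^ 4 = 3 * m * (6 * m ^ 2) * m); last by ring.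
  by rewrite leq_mul // leq_mul.
exists m; split => // l ml.
(* The constants multiply to [2 * 3 * 6 * 18 = 648], which is at most [2 ^ 10]. *)
have Dl : 2 * D <= 2 ^ (10 + 7 * l).
  have dm x y : x <= y -> 0 < y -> den x <= y by rewrite /den; case: eqP.
  apply: (@leq_trans (2 * (3 * m * (6 * m ^ 2) * (18 * m ^ 4)))).
    rewrite leq_mul2l /= /vol !leq_mul // dm // ?muln_gt0 ?expn_gt0 ?m0 //.
  rewrite (_ : 2 * _ = 648 * m ^ 7); last by ring.
  by rewrite expnD [7 * l]mulnC expnM leq_mul // leq_exp2r.
rewrite /m /maxn; case: ifP => _.
  case: ifP => _.
    rewrite /xc; case: eqP => [_ |/eqP c0]; first by rewrite /prime_count.
    by apply: prime_count_c; rewrite ?ba0 ?cb0.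
  rewrite /xb; case: eqP => [_ |/eqP b0]; first by rewrite /prime_count.
  by apply: prime_count_b; rewrite ?ba0.
rewrite /xa; case: eqP => [_ |/eqP a0]; first by rewrite /prime_count.
exact: prime_count_a.
Qed.

End Bounds.

(** * Resolving the self-referential bound on the box *)

Section FinalBound.
Local Open Scope nat_scope.

Lemma sq_le_exp x : 20 <= x -> 38 * (2 * x + 1) ^ 2 <= 2 ^ x.-1.
Proof.
move=> hx; rewrite -(subnKC hx); elim: (x - 20) => [|y IH].
  have -> : (20 + 0).-1 = 10 + 9 by [].
  rewrite expnD; have -> : 2 ^ 10 = 1024 by []. have -> : 2 ^ 9 = 512 by [].
  lia.
rewrite addnS /= addSn expnS; apply: leq_trans (_ : 2 * (38 * (2 * (20 + y) + 1) ^ 2) <= _).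
  by nia.
by rewrite leq_mul2l.
Qed.

Lemma prime_count_bound r m l : 0 < r -> 0 < m -> r < 2 ^ l -> l <= r ->
  (forall i, m <= 2 ^ i -> prime_count m <= r + (10 + 7 * i)) ->
  m <= 80 * 300 * (r * l).
Proof.
move=> r0 m0 rl lr hm.
have l0 : 0 < l by rewrite lt0n; apply: contraTneq rl => ->; rewrite expn0 -leqNgt.
have [m1|m1] := leqP m 1; first by apply: leq_trans m1 _; rewrite !muln_gt0 r0 l0.
pose L := up_log 2 m.
have mL : m <= 2 ^ L by apply: up_logP.
have L0 : 0 < L by rewrite up_log_gt0.
have Lm : 2 ^ L.-1 < m by apply: up_log_gtn.
have h1 : m <= 2 * (L * (r + (10 + 7 * L))) + 2.
  have := chebyshev (x := m) (m := m.-1 %/ 2) (l := L).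
  have := divn_eq m.-1 2; have := ltn_pmod m.-1 (isT : 0 < 2) => h2 h3.
  move=> /(_ ltac:(lia) ltac:(lia)) h4.
  have : L * prime_count m <= L * (r + (10 + 7 * L)) by rewrite leq_mul2l hm ?orbT.
  by lia.
have L40 : L <= 40 * l.
  case: (leqP L 40) => [h|h]; first by apply: leq_trans h _; rewrite leq_pmulr.
  (* The coefficients add up to [2 + 20 + 14 + 2 = 38]. With [x] half of [L], the square is absorbed
     by [2 ^ x], so [2 ^ L] is at most about [r * 2 ^ x] and [L] is [O(l)]; the threshold 40
     provides [20 <= x]. *)
  have h2 : m <= 38 * (r * L ^ 2) by nia.
  pose x := L %/ 2.
  have hx : L <= 2 * x + 1 by have := divn_eq L 2; have := ltn_pmod L (isT : 0 < 2); rewrite -/x; lia.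
  have x20 : 20 <= x by rewrite leq_divRL //; lia.
  have xL : 2 * x <= L by rewrite mulnC leq_trunc_div.
  have h3 := sq_le_exp x20.
  have h4 : 2 ^ L.-1 < 2 ^ (l + x.-1).
    apply: leq_trans Lm _; apply: leq_trans h2 _; rewrite expnD mulnCA.
    apply: leq_mul; first exact: ltnW.
    by apply: leq_trans h3; rewrite leq_mul2l leq_sqr.
  rewrite ltn_exp2l // in h4; lia.
have h5 : L * (r + (10 + 7 * L)) <= 40 * l * (291 * r).
  by apply: leq_mul => //; lia.
have : 0 < r * l by rewrite muln_gt0 r0.
by lia.
Qed.

(** The factor 18 is put inside the powers, so that one number [n] serves all three bounds. *)
Lemma adim_bounds : exists K, forall (R : realType) a b c r,
  admissible a b c -> 0 < r -> has_adim R (index_of a, index_of b, index_of c) r ->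
  let n := K * (r * up_log 2 r.+1) in
  [/\ a <= n, b <= n ^ 2 & c <= n ^ 4].
Proof.
exists (18 * (80 * 300)) => R a b c r adm r0 adim n.
have [m [m0 ha hb hc hm]] := index_bounds adm adim.
have rl : r < 2 ^ up_log 2 r.+1 by apply: up_logP.
have lr : up_log 2 r.+1 <= r by apply: up_log_min => //; apply: ltn_expl.
have mK := prime_count_bound r0 m0 rl lr hm.
have mn : 18 * m <= n by rewrite /n -mulnA leq_mul2l /= mK.
have m2 : (18 * m) ^ 2 <= n ^ 2 by rewrite leq_exp2r.
have m4 : (18 * m) ^ 4 <= n ^ 4 by rewrite leq_exp2r.
split.
- by apply: leq_trans ha _; apply: leq_trans mn; rewrite leq_mul2r orbT.
- apply: leq_trans hb _; apply: leq_trans m2; rewrite expnMn leq_mul2r; apply/orP; right.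
  by [].
- apply: leq_trans hc _; apply: leq_trans m4; rewrite expnMn leq_mul2r; apply/orP; right.
  by rewrite -[X in X <= _]expn1 leq_exp2l.
Qed.

End FinalBound.

(** * The algorithm *)

Section Macros.
Local Open Scope nat_scope.
Variable W : nat.
Hypothesis W0 : 0 < W.

(* [costs p st st' s]: [p] runs from [st] to [st'] within [s] elementary
   operations on numbers of at most [W] bits. *)
Definition costs (p : prog) (st st' : state) (s : nat) := does p st st' (s * (70 * W)).

Lemma costs_weaken p st st' s s' : s <= s' -> costs p st st' s -> costs p st st' s'.
Proof. by move=> h; apply: doesW; rewrite leq_mul2r h orbT. Qed.

Lemma costs_seq p q st st1 st2 s1 s2 :
  costs p st st1 s1 -> costs q st1 st2 s2 -> costs (Seq p q) st st2 (s1 + s2).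
Proof. by move=> h1 h2; rewrite /costs mulnDl; apply: does_seq h1 h2. Qed.

Lemma costs_skip st : costs Skip st st 0.
Proof. exact: does_skip. Qed.

Lemma costs_add z x y e out : oval e x < 2 ^ W -> oval e y < 2 ^ W -> e z < 2 ^ W ->
  costs (add_to z x y) (e, out) (upd e z (oval e x + oval e y), out) 1.
Proof. by move=> *; rewrite /costs mul1n; apply: does_add. Qed.

Lemma costs_sub z x y e out : oval e x < 2 ^ W -> oval e y < 2 ^ W -> e z < 2 ^ W ->
  costs (sub_to z x y) (e, out) (upd e z (oval e x - oval e y), out) 1.
Proof. by move=> *; rewrite /costs mul1n; apply: does_sub. Qed.

Lemma costs_halve x e out : costs (halve x) (e, out) (upd e x (e x)./2, out) 1.
Proof. by apply: doesW (does_halve x e out); lia. Qed.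

Lemma costs_if_le x y p q e out st' s :
  oval e x < 2 ^ W -> oval e y < 2 ^ W ->
  costs (if oval e x <= oval e y then p else q) (e, out) st' s ->
  costs (if_le x y p q) (e, out) st' s.+1.
Proof. by move=> hx hy h; apply: doesW (does_if_le hx hy W0 h); lia. Qed.

Lemma costs_if_odd x p q e out st' s :
  costs (if odd (e x) then p else q) (e, out) st' s ->
  costs (if_odd x p q) (e, out) st' s.+1.
Proof. by move=> h; apply: doesW (does_if_odd h); lia. Qed.

Lemma costs_while x p m s (L : nat -> state) :
  (forall i, i < m -> (L i).1 x <> 0 /\ costs p (L i) (L i.+1) s) ->
  (L m).1 x = 0 ->
  costs (while_pos x p) (L 0) (L m) (m * s.+1).+1.
Proof.
move=> h1 h2; apply: doesW (does_while h1 h2).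
have : 0 < 70 * W by lia.
move: (70 * W) => V V0; have : m <= m * V by rewrite leq_pmulr.
by lia.
Qed.

Lemma costs_emit x e out : e x < 2 ^ W ->
  costs (emit x) (e, out) (e, code (e x) ++ out) 1.
Proof. by move=> h; apply: doesW (does_emit out h W0); lia. Qed.

Definition set_to z o := add_to z o (Lit 0).

Lemma costs_set z o e out : oval e o < 2 ^ W -> e z < 2 ^ W ->
  costs (set_to z o) (e, out) (upd e z (oval e o), out) 1.
Proof.
move=> ho hz; have := @costs_add z o (Lit 0) e out ho _ hz.
by rewrite /= addn0 expn_gt0; apply.
Qed.

Fixpoint when (cs : seq (operand * operand)) (p : prog) : prog :=
  if cs is (x, y) :: cs' then if_le x y (when cs' p) Skip else p.

Definition holds e (cs : seq (operand * operand)) :=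
  all (fun c => oval e c.1 <= oval e c.2) cs.

Definition fits e (cs : seq (operand * operand)) :=
  all (fun c => (oval e c.1 < 2 ^ W) && (oval e c.2 < 2 ^ W)) cs.

Lemma costs_when cs p e out st s : fits e cs ->
  (holds e cs -> costs p (e, out) st s) ->
  costs (when cs p) (e, out) (if holds e cs then st else (e, out)) (size cs + s).
Proof.
elim: cs => [|[x y] cs IH] /=; first by move=> _; apply.
move=> /andP[/andP[hx hy] hcs] h; rewrite addSn.
apply: costs_if_le => //; case: leqP h => [_ /= h|_ _ /=]; first exact: IH.
by apply: costs_weaken (costs_skip _).
Qed.

Definition eqc x y : seq (operand * operand) := [:: (x, y); (y, x)].

(* A conditional assignment. *)
Lemma costs_when_set cs z o e out : fits e cs -> oval e o < 2 ^ W -> e z < 2 ^ W ->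
  costs (when cs (set_to z o)) (e, out)
    (upd e z (if holds e cs then oval e o else e z), out) (size cs).+1.
Proof.
move=> h1 h2 h3; rewrite -addn1.
have := @costs_when cs (set_to z o) e out _ 1 h1 (fun _ => @costs_set z o e out h2 h3).
by case: (holds e cs); rewrite ?upd_same.
Qed.

(** Repeated addition, at a cost linear in the value of [x]. It is used only outside the loop over
    the exponents, where this cost is dominated by that loop or by the size of the box. *)
Definition mul_to z x y i :=
  Seq (set_to z (Lit 0)) (Seq (set_to i x) (while_pos i
    (Seq (sub_to i (Var i) (Lit 1)) (add_to z (Var z) (Var y))))).

Lemma updN e x y v : y != x -> upd e x v y = e y.
Proof. by rewrite /upd => /negbTE ->. Qed.

Lemma updC e x y v w : x != y -> upd (upd e x v) y w = upd (upd e y w) x v.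
Proof.
move=> xy; apply/funext => z; rewrite /upd.
by case: (eqVneq z y) => // ->; rewrite eq_sym (negbTE xy).
Qed.

Lemma costs_mul z x y i e out : z != i -> y != z -> y != i ->
  (if x is Var x' then x' != z else true) ->
  oval e x < 2 ^ W -> e y < 2 ^ W -> oval e x * e y < 2 ^ W ->
  e z < 2 ^ W -> e i < 2 ^ W ->
  costs (mul_to z x y i) (e, out) (upd (upd e z (oval e x * e y)) i 0, out)
    (3 * oval e x + 3).
Proof.
move=> zi yz yi xz hx hy hxy hz hi.
have W1 : 1 < 2 ^ W by rewrite -{1}(expn0 2) ltn_exp2l.
set m := oval e x.
pose L j : state := (upd (upd e z (j * e y)) i (m - j), out).
have s1 : costs (set_to z (Lit 0)) (e, out) (upd e z 0, out) 1.
  by apply: costs_set => //=; rewrite expn_gt0.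
have s2 : costs (set_to i x) (upd e z 0, out) (L 0) 1.
  have ox : oval (upd e z 0) x = m by rewrite /m; case: (x) xz => //= x' h; rewrite updN.
  have := @costs_set i x (upd e z 0) out; rewrite ox updN; last by rewrite eq_sym.
  by rewrite /L mul0n subn0; apply.
have s3 : costs (while_pos i (Seq (sub_to i (Var i) (Lit 1)) (add_to z (Var z) (Var y))))
   (L 0) (L m) (m * 3).+1.
  apply: costs_while => [j jm|]; rewrite /L /= updE; last by rewrite subnn.
  split; first by lia.
  have q1 := @costs_sub i (Var i) (Lit 1) (upd (upd e z (j * e y)) i (m - j)) out.
  rewrite /= !updE updK in q1.
  have mj : m - j < 2 ^ W by apply: leq_ltn_trans hx; apply: leq_subr.
  have {}q1 := q1 mj W1 mj.
  have q2 := @costs_add z (Var z) (Var y) (upd (upd e z (j * e y)) i (m - j - 1)) out.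
  rewrite /= !(updN _ _ zi) !(updN _ _ yi) !updE (updN _ _ yz) in q2.
  have jy : j * e y < 2 ^ W by apply: leq_ltn_trans hxy; rewrite leq_mul2r ltnW ?orbT.
  have {}q2 := q2 jy hy jy.
  have iz : i != z by rewrite eq_sym.
  have := costs_seq q1 q2; rewrite (updC _ _ _ iz) updK.
  rewrite (_ : m - j - 1 = m - j.+1); last by lia.
  by rewrite mulSn addnC.
have := costs_seq s1 (costs_seq s2 s3).
rewrite /L subnn; apply: costs_weaken; lia.
Qed.

Definition zeros (xs : seq nat) := foldr (fun x p => Seq (set_to x (Lit 0)) p) Skip xs.

Lemma costs_zeros xs e out : all (fun x => e x < 2 ^ W) xs ->
  costs (zeros xs) (e, out) (fun x => if x \in xs then 0 else e x, out) (size xs).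
Proof.
elim: xs e => [|x xs IH] e /=.
  by move=> _; apply: costs_skip.
move=> /andP[hx hxs]; rewrite -add1n.
apply: costs_seq; first by apply: costs_set => //=; rewrite expn_gt0.
have -> : (fun y => if y \in x :: xs then 0 else e y) =
          (fun y => if y \in xs then 0 else upd e x 0 y).
  by apply/funext => y; rewrite inE /upd; case: eqP; case: (y \in xs).
apply: IH; apply: sub_all hxs => y; rewrite /upd; case: eqP => // _ _.
by rewrite expn_gt0.
Qed.

End Macros.

Section Blocks.
Local Open Scope nat_scope.
Variable W : nat.
Hypothesis W0 : 0 < W.
Local Notation costs := (costs W).

Lemma costs_to p st st1 st' s s' :
  costs p st st1 s -> st1 = st' -> s <= s' -> costs p st st' s'.
Proof. by move=> h <- /costs_weaken; apply. Qed.

Lemma costs_stop x p st : st.1 x = 0 -> costs (while_pos x p) st st 1.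
Proof.
move=> h; apply: (@runsW _ _ _ 1); first by rewrite mul1n; lia.
by apply: runs_stop; rewrite /mem_of /= h.
Qed.

Lemma costs_step x p st st1 st2 s1 s2 : st.1 x <> 0 -> costs p st st1 s1 ->
  costs (while_pos x p) st1 st2 s2 -> costs (while_pos x p) st st2 (s1 + s2).+1.
Proof.
move=> hx h1 h2; rewrite /costs /does.
apply: (runsW _ (runs_step _ h1 h2)).
  by move: (70 * W) (ltac:(lia) : 0 < 70 * W) => V V0; rewrite mulSn mulnDl; lia.
by rewrite /mem_of /=; case: (_ x) hx => // n _; rewrite binaryE.
Qed.

(* Stein's binary gcd, for an odd first argument. *)
Definition gcd_step u v :=
  if_odd v
    (Seq (if_le (Var u) (Var v) (sub_to v (Var v) (Var u))
            (Seq (sub_to v (Var u) (Var v)) (sub_to u (Var u) (Var v))))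
         (halve v))
    (halve v).

Definition gcd_loop u v := while_pos v (gcd_step u v).

(** Two odd numbers have an even difference, and halving does not change a gcd with an odd number.
    When [u] exceeds [v], setting [v] to [u - v] and then [u] to [u - v] leaves the old [v] in [u]
    without a temporary. Every step at least halves the product, which therefore bounds the number
    of rounds. *)
Lemma costs_gcd_step u v e out : u != v -> odd (e u) -> e u < 2 ^ W -> e v < 2 ^ W ->
  exists x y, [/\ odd x, gcdn x y = gcdn (e u) (e v), 2 * (x * y) <= e u * e v,
    x < 2 ^ W /\ y < 2 ^ W &
    costs (gcd_step u v) (e, out) (upd (upd e u x) v y, out) 5].
Proof.
move=> uv ou hu hv; have vu : v != u by rewrite eq_sym.
case ov: (odd (e v)); last first.
  have ev : e v = 2 * (e v)./2 by have := odd_double_half (e v); rewrite ov -mul2n.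
  exists (e u), (e v)./2; split => //.
  - by rewrite [in RHS]ev Gauss_gcdr // coprimen2.
  - by rewrite [in X in _ <= X]ev mulnCA.
  - by split => //; apply: leq_ltn_trans hv; lia.
  - rewrite upd_same; apply: costs_weaken (costs_if_odd (s := 1) W0 _) => //.
    by rewrite ov; apply: (costs_halve W0).
case: (leqP (e u) (e v)) => le.
  have od : odd (e v - e u) = false by rewrite oddB // ov ou.
  have ed : e v - e u = 2 * (e v - e u)./2.
    by have := odd_double_half (e v - e u); rewrite od -mul2n.
  exists (e u), (e v - e u)./2; split => //.
  - rewrite -(@Gauss_gcdr _ 2) ?coprimen2 // -ed.
    by rewrite -{2}(subnK le) gcdnDr.
  - by rewrite mulnCA -ed leq_mul2l leq_subr orbT.
  - by split => //; apply: leq_ltn_trans hv; lia.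
  - rewrite upd_same; apply: costs_weaken (costs_if_odd (s := 4) W0 _) => //; rewrite ov.
    apply: costs_to; first (apply: costs_seq).
    + apply: (costs_if_le W0) => /=; [exact: hu|exact: hv|rewrite le].
      by apply: (costs_sub W0) => /=.
    + exact: (costs_halve W0).
    + by rewrite /= updE updK.
    + by [].
have le' := ltnW le.
have od : odd (e u - e v) = false by rewrite oddB // ov ou.
have ed : e u - e v = 2 * (e u - e v)./2.
  by have := odd_double_half (e u - e v); rewrite od -mul2n.
exists (e v), (e u - e v)./2; split => //.
- rewrite -(@Gauss_gcdr _ 2) ?coprimen2 // -ed gcdnC [RHS]gcdnC.
  by rewrite -{2}(subnK le') gcdnC gcdnDr gcdnC.
- by rewrite mulnCA -ed mulnC leq_mul2r leq_subr orbT.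
- by split => //; apply: leq_ltn_trans hu; lia.
- apply: costs_weaken (costs_if_odd (s := 4) W0 _) => //; rewrite ov.
  apply: costs_to; first (apply: costs_seq).
  + apply: (costs_if_le W0) => /=; [exact: hu|exact: hv|rewrite leqNgt le /=].
    apply: costs_seq; first by apply: (costs_sub W0) => /=.
    by apply: (costs_sub W0) => //=; rewrite ?updE ?(updN _ _ uv) //; apply: leq_ltn_trans (leq_subr _ _) hu.
  + exact: (costs_halve W0).
  + rewrite /= updE (updN _ _ uv) (updN _ _ vu) updE subKn // (updC _ _ _ vu) updK.
    by rewrite (updC _ _ _ uv).
  + by [].
Qed.

Lemma costs_gcd F u v e out : u != v -> odd (e u) -> e u < 2 ^ W -> e v < 2 ^ W ->
  e u * e v < 2 ^ F ->
  costs (gcd_loop u v) (e, out) (upd (upd e u (gcdn (e u) (e v))) v 0, out) (6 * F + 1).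
Proof.
move=> uv; elim: F e => [|F IH] e ou hu hv hF.
  have v0 : e v = 0 by move: hF ou; rewrite expn0; case: (e u) (e v) => [|x] [|y].
  apply: costs_to; first by apply: costs_stop.
    by rewrite v0 gcdn0 -v0 !upd_same.
  by [].
have [v0|v0] := eqVneq (e v) 0.
  apply: costs_to; first by apply: costs_stop.
    by rewrite v0 gcdn0 -v0 !upd_same.
  by lia.
have [x [y [ox gxy xy [hx hy] h]]] := costs_gcd_step out uv ou hu hv.
have vu : v != u by rewrite eq_sym.
have := IH (upd (upd e u x) v y); rewrite updE (updN _ _ uv) updE.
rewrite (updC _ _ _ vu) updK (updC _ _ _ uv) updK (updC _ _ _ vu) gxy.
move=> /(_ ox hx hy) IH'.
apply: costs_to (costs_step _ h (IH' _)) _ _ => //.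
- exact/eqP.
- by move: hF; rewrite expnS; lia.
- by lia.
Qed.

(* Adds [w] to [x] modulo [d], and toggles [g] when the sum wraps around. *)
Definition acc_block x w d g :=
  Seq (add_to x (Var x) (Var w))
      (when [:: (Var d, Var x)] (Seq (sub_to x (Var x) (Var d)) (sub_to g (Lit 1) (Var g)))).

Lemma mod_add_lt x w d : x < d -> w < d ->
  (x + w) %% d = if d <= x + w then x + w - d else x + w.
Proof.
move=> xd wd; case: leqP => h; last exact: modn_small.
by rewrite -{1}(subnK h) modnDr modn_small //; lia.
Qed.

Lemma costs_acc x w d g e out : x != w -> x != d -> x != g -> d != g ->
  e x < e d -> e w < e d -> 2 * e d < 2 ^ W -> e g <= 1 ->
  costs (acc_block x w d g) (e, out)
    (upd (upd e x ((e x + e w) %% e d)) g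
       (if e d <= e x + e w then 1 - e g else e g), out) 4.
Proof.
move=> xw xd xg dg hx hw hd hg.
have [wx dx gx] : [/\ w != x, d != x & g != x] by rewrite ![_ == x]eq_sym.
have W1 : 1 < 2 ^ W by lia.
apply: costs_to; first (apply: costs_seq).
- by apply: (costs_add W0) => /=; lia.
- apply: (costs_when W0); first by rewrite /fits /= updE updN //; lia.
  rewrite /holds /= updE updN // andbT => hh.
  apply: costs_seq; first by apply: (costs_sub W0); rewrite /= ?updE ?updN //; lia.
  by apply: (costs_sub W0) => //; rewrite /= !updN //; lia.
- rewrite /holds /= andbT !updE updN // mod_add_lt //; case: ifP => h.
    by rewrite ?updK ?updE ?updN // ?updN //.
  by congr (_, _); apply/funext => y; rewrite /upd; case: (eqVneq y g) => // ->; rewrite (negbTE gx).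
- by [].
Qed.

Definition mod_block x w d :=
  Seq (add_to x (Var x) (Var w)) (when [:: (Var d, Var x)] (sub_to x (Var x) (Var d))).

Lemma costs_mod x w d e out : x != w -> x != d ->
  e x < e d -> e w < e d -> 2 * e d < 2 ^ W ->
  costs (mod_block x w d) (e, out) (upd e x ((e x + e w) %% e d), out) 3.
Proof.
move=> xw xd hx hw hd.
have [wx dx] : w != x /\ d != x by rewrite ![_ == x]eq_sym.
apply: costs_to; first (apply: costs_seq).
- by apply: (costs_add W0) => /=; lia.
- apply: (costs_when W0); first by rewrite /fits /= updE updN //; lia.
  rewrite /holds /= updE updN // andbT => hh.
  by apply: (costs_sub W0); rewrite /= ?updE ?updN //; lia.
- rewrite /holds /= andbT !updE updN // mod_add_lt //; case: ifP => h //.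
  by rewrite updK.
- by [].
Qed.

Definition fold_block f y d :=
  Seq (sub_to f (Var d) (Var y)) (when [:: (Var y, Var f)] (set_to f (Var y))).

Lemma costs_fold f y d e out : y != f -> e y < 2 ^ W -> e d < 2 ^ W -> e f < 2 ^ W ->
  costs (fold_block f y d) (e, out) (upd e f (minn (e d - e y) (e y)), out) 3.
Proof.
move=> yf hy hd hf.
apply: costs_to; first (apply: costs_seq).
- by apply: (costs_sub W0).
- by apply: (costs_when_set W0); rewrite /fits /= ?updE ?updN //; lia.
- rewrite /holds /= andbT !updE !updN // updK /minn.
  by congr (upd _ _ _, _); rewrite leqNgt; case: ltnP.
- by [].
Qed.

End Blocks.

(** * The loop over the exponents of one triple *)

Section Inner.
Local Open Scope nat_scope.
Variable W : nat.
Hypothesis W0 : 0 < W.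
Local Notation costs := (costs W).
Local Arguments when : simpl never.
Local Arguments set_to : simpl never.
Local Arguments add_to : simpl never.
Local Arguments sub_to : simpl never.

(** Environments are given as explicit lists, so that straight-line code is executed symbolically by
    simplification. *)
Lemma upd_nth l x v : upd (nth 0 l) x v = nth 0 (set_nth 0 l x v).
Proof. by apply/funext => y; rewrite nth_set_nth. Qed.

Definition prog_seq := foldr Seq Skip.

Lemma costs_when_add cs z x y e out : fits W e cs -> oval e x < 2 ^ W ->
  oval e y < 2 ^ W -> e z < 2 ^ W ->
  costs (when cs (add_to z x y)) (e, out)
    (upd e z (if holds e cs then oval e x + oval e y else e z), out) (size cs).+1.
Proof.
move=> h1 h2 h3 h4; rewrite -addn1.
have := costs_when W0 h1 (fun _ => costs_add W0 out h2 h3 h4).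
by case: (holds e cs); rewrite ?upd_same.
Qed.

Definition toggle (b : bool) s := if b then 1 - s else s.

Lemma toggle_le1 b s : s <= 1 -> toggle b s <= 1.
Proof. by rewrite /toggle; case: b => //; lia. Qed.

Lemma orb_rev p1 p2 p3 p4 : [|| p1, p2, p3 | p4] = p4 || (p3 || (p2 || p1)).
Proof. by case: p1; case: p2; case: p3; case: p4. Qed.

Lemma if_one0 (b : bool) : (if b then 1 else 0) = b.
Proof. by case: b. Qed.

Lemma if_one (b c : bool) : (if b then 1 else c : nat) = b || c.
Proof. by case: b. Qed.

Definition test_eqs x y x' y' x'' y'' :=
  eqc (Var x) (Var y) ++ eqc (Var x') (Var y') ++ eqc (Var x'') (Var y'').

Local Arguments test_eqs : simpl never.

(* Variables 31 and 32 hold [k] and the number of remaining rounds; 33 to 36 the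
   residues of [k * w + D] for the four weights [w] and 37 the parity of their
   quotients; 38 to 40 the residues of [k * h] for the three heights [h]; 47 the
   number of split [k], and 48 the number of [k] fixing the generators times [r]. *)
Definition inner_body := prog_seq [::
  sub_to 32 (Var 32) (Lit 1);
  set_to 41 (Var 31);
  set_to 42 (Var 16);
  gcd_loop 41 42;
  fold_block 43 38 17;
  fold_block 44 39 17;
  fold_block 45 40 17;
  when (test_eqs 43 18 44 19 45 20) (set_to 46 (Lit 1));
  when (test_eqs 43 18 44 29 45 30) (set_to 46 (Lit 1));
  when (test_eqs 43 28 44 19 45 30) (set_to 46 (Lit 1));
  when (test_eqs 43 28 44 29 45 20) (set_to 46 (Lit 1));
  when (eqc (Var 41) (Lit 1) ++ eqc (Var 46) (Lit 1)) (add_to 48 (Var 48) (Var 0));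
  when (eqc (Var 41) (Lit 1) ++ [:: (Var 37, Lit 0)]) (add_to 47 (Var 47) (Lit 1));
  acc_block 33 24 17 37;
  acc_block 34 25 17 37;
  acc_block 35 26 17 37;
  acc_block 36 27 17 37;
  mod_block 38 21 17;
  mod_block 39 22 17;
  mod_block 40 23 17;
  add_to 31 (Var 31) (Lit 2);
  set_to 41 (Lit 0);
  set_to 43 (Lit 0);
  set_to 44 (Lit 0);
  set_to 45 (Lit 0);
  set_to 46 (Lit 0)].

Variables (r n n2 n4 a b c ia ib ic a' b' c' da db dc D h1 h2 h3 : nat).
Variables (g1 g2 g3 w0 w1 w2 w3 : nat).
Local Notation d := (2 * D).

(** The position in the list is the number of the variable. Variables 21 to 27 are doubled because
    [k] advances in steps of 2; 41 to 46 are scratch and return to 0 after each round. *)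
Definition inner_env k j x0 x1 x2 x3 sg y1 y2 y3 cnt tot :=
  [:: r; n; n2; n4; a; b; c; ia; ib; ic; a'; b'; c'; da; db; dc; D; d;
      h1; h2; h3; 2 * h1; 2 * h2; 2 * h3; 2 * w0; 2 * w1; 2 * w2; 2 * w3; g1; g2; g3;
      k; j; x0; x1; x2; x3; sg; y1; y2; y3; 0; 0; 0; 0; 0; 0; cnt; tot; 0].

Definition same_flag f1 f2 f3 : bool :=
  [|| [&& f1 == h1, f2 == h2 & f3 == h3], [&& f1 == h1, f2 == g2 & f3 == g3],
      [&& f1 == g1, f2 == h2 & f3 == g3] | [&& f1 == g1, f2 == g2 & f3 == h3]].

Lemma costs_inner_body F out k j x0 x1 x2 x3 sg y1 y2 y3 cnt tot :
  odd k -> k < d -> k * D < 2 ^ F -> 2 * d + 4 < 2 ^ W -> j <= D ->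
  w0 < D -> w1 < D -> w2 < D -> w3 < D -> h1 < D -> h2 < D -> h3 < D ->
  g1 <= D -> g2 <= D -> g3 <= D ->
  x0 < d -> x1 < d -> x2 < d -> x3 < d -> y1 < d -> y2 < d -> y3 < d -> sg <= 1 ->
  cnt < D -> tot + r < 2 ^ W ->
  costs inner_body
    (nth 0 (inner_env k j x0 x1 x2 x3 sg y1 y2 y3 cnt tot), out)
    (nth 0 (inner_env (k + 2) (j - 1)
       ((x0 + 2 * w0) %% d) ((x1 + 2 * w1) %% d) ((x2 + 2 * w2) %% d) ((x3 + 2 * w3) %% d)
       (toggle (d <= x3 + 2 * w3) (toggle (d <= x2 + 2 * w2)
          (toggle (d <= x1 + 2 * w1) (toggle (d <= x0 + 2 * w0) sg))))
       ((y1 + 2 * h1) %% d) ((y2 + 2 * h2) %% d) ((y3 + 2 * h3) %% d)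
       (cnt + (coprime k D && (sg == 0)))
       (tot + r * (coprime k D && same_flag (minn (d - y1) y1) (minn (d - y2) y2) (minn (d - y3) y3)))),
     out) (6 * F + 100).
Proof.
move=> ok kd kF dW jD hw0 hw1 hw2 hw3 hh1 hh2 hh3 hg1 hg2 hg3 hx0 hx1 hx2 hx3 hy1 hy2 hy3 hsg hcnt htot.
rewrite /inner_env /inner_body; set gk := gcdn k D.
have small (q : bool) : q < 2 ^ W by case: q; lia.
have gD : gk <= D by apply: dvdn_leq; [lia|exact: dvdn_gcdr].
set f1 := minn (d - y1) y1; set f2 := minn (d - y2) y2; set f3 := minn (d - y3) y3.
set sf := same_flag f1 f2 f3.
have [hf1 hf2 hf3] : [/\ f1 <= d, f2 <= d & f3 <= d] by split; rewrite geq_min; lia.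
have bd : ((f1 < 2 ^ W) * (f2 < 2 ^ W) * (f3 < 2 ^ W) * (h1 < 2 ^ W) * (h2 < 2 ^ W) *
  (h3 < 2 ^ W) * (g1 < 2 ^ W) * (g2 < 2 ^ W) * (g3 < 2 ^ W) * (1 < 2 ^ W) *
  (gk < 2 ^ W) * (sg < 2 ^ W) * (0 < 2 ^ W) * (cnt < 2 ^ W))%type.
  by repeat split; lia.
apply: costs_to.
  apply: costs_seq; first by apply: (costs_sub W0) => /=; lia.
  rewrite upd_nth /=.
  do 2 (apply: costs_seq; [by apply: (costs_set W0) => /=; lia | rewrite upd_nth /=]).
  apply: costs_seq; first by apply: (costs_gcd W0 (F := F)) => //=; lia.
  rewrite !upd_nth /= -/gk.
  apply: costs_seq; first by apply: (costs_fold W0) => //=; lia.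
  rewrite upd_nth /= -/f1.
  apply: costs_seq; first by apply: (costs_fold W0) => //=; lia.
  rewrite upd_nth /= -/f2.
  apply: costs_seq; first by apply: (costs_fold W0) => //=; lia.
  rewrite upd_nth /= -/f3.
  apply: costs_seq; first by apply: (costs_when_set W0); rewrite /fits /= ?bd ?small.
  rewrite upd_nth /holds /= if_one0; move E1 : [&& _, _ & _] => q1.
  apply: costs_seq; first by apply: (costs_when_set W0); rewrite /fits /= ?bd ?small.
  rewrite upd_nth /holds /= if_one; move E2 : [&& _, _ & _] => q2.
  apply: costs_seq; first by apply: (costs_when_set W0); rewrite /fits /= ?bd ?small.
  rewrite upd_nth /holds /= if_one; move E3 : [&& _, _ & _] => q3.
  apply: costs_seq; first by apply: (costs_when_set W0); rewrite /fits /= ?bd ?small.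
  rewrite upd_nth /holds /= if_one; move E4 : [&& _, _ & _] => q4.
  have sfE : q4 || (q3 || (q2 || q1)) = sf.
    by rewrite /sf /same_flag orb_rev -E1 -E2 -E3 -E4 !eqn_leq !andbT -!andbA.
  rewrite sfE {sfE E1 E2 E3 E4 q1 q2 q3 q4}.
  apply: costs_seq; first by apply: costs_when_add; rewrite /fits /= ?bd ?small //; lia.
  rewrite upd_nth /holds /=.
  apply: costs_seq; first by apply: costs_when_add; rewrite /fits /= ?bd ?small //; lia.
  rewrite upd_nth /holds /=.
  apply: costs_seq; first by apply: (costs_acc W0) => //=; rewrite ?toggle_le1; lia.
  rewrite !upd_nth /= -/(toggle _ _).
  apply: costs_seq; first by apply: (costs_acc W0) => //=; rewrite ?toggle_le1; lia.
  rewrite !upd_nth /= -/(toggle _ _).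
  apply: costs_seq; first by apply: (costs_acc W0) => //=; rewrite ?toggle_le1; lia.
  rewrite !upd_nth /= -/(toggle _ _).
  apply: costs_seq; first by apply: (costs_acc W0) => //=; rewrite ?toggle_le1; lia.
  rewrite !upd_nth /= -/(toggle _ _).
  do 3 (apply: costs_seq; [by apply: (costs_mod W0) => //=; lia | rewrite upd_nth /=]).
  apply: costs_seq; first by apply: (costs_add W0) => /=; lia.
  rewrite upd_nth /=.
  do 5 (apply: costs_seq; [by apply: (costs_set W0) => /=; lia | rewrite upd_nth /=]).
  exact: costs_skip.
  rewrite /coprime -/gk eqn_leq.
  congr (nth 0 [:: _; _; _; _; _; _; _; _; _; _; _; _; _; _; _; _; _; _;
    _; _; _; _; _; _; _; _; _; _; _; _; _; _; _; _; _; _; _; _; _; _; _;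
    _; _; _; _; _; _; _; _; _], _).
  - rewrite leqn0 andbT -andbA; case: ifP => _; rewrite ?addn1 ?addn0 //.
  - by case: (gk <= 1); case: (1 <= gk); case: sf; rewrite /= ?muln1 ?muln0 ?addn0.
by rewrite /test_eqs /=; lia.
Qed.

(** A summand below the modulus raises the quotient by at most 1. Therefore the parity of a crossing
    number can be maintained by toggling one bit at each wrap-around. *)
Lemma div_add_lt x w m : w < m -> (x + w) %/ m = x %/ m + (m <= x %% m + w).
Proof.
move=> wm; have m0 : 0 < m by apply: leq_ltn_trans wm.
rewrite {1}(divn_eq x m) -addnA divnMDl //; congr (_ + _).
have xm := ltn_pmod x m0; case: leqP => h; last exact: divn_small.
by rewrite -(subnK h) addnC -{1}[m]mul1n divnMDl // divn_small //; lia.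
Qed.

Lemma toggle_odd (t : bool) q : toggle t (odd q) = odd (q + t).
Proof. by rewrite /toggle; case: t; rewrite ?addn1 ?addn0 //=; case: (odd q). Qed.

Definition phase w i := ((2 * i + 1) * w + D) %% d.
Definition turns w i := crossings D w (2 * i + 1).
Definition all_turns i := turns w0 i + turns w1 i + turns w2 i + turns w3 i.
Definition counted i := coprime (2 * i).+1 D && ~~ odd (all_turns i).
Definition stable i := coprime (2 * i).+1 D &&
  same_flag (fold D h1 (2 * i).+1) (fold D h2 (2 * i).+1) (fold D h3 (2 * i).+1).

Definition inner_at i :=
  inner_env (2 * i + 1) (D - i) (phase w0 i) (phase w1 i) (phase w2 i) (phase w3 i)
    (odd (all_turns i)) ((2 * i + 1) * h1 %% d) ((2 * i + 1) * h2 %% d)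
    ((2 * i + 1) * h3 %% d) (count counted (iota 0 i)) (r * count stable (iota 0 i)).

Lemma costs_inner_loop F out : d * D < 2 ^ F -> 2 * d + 4 < 2 ^ W -> r * D + r < 2 ^ W ->
  w0 < D -> w1 < D -> w2 < D -> w3 < D -> h1 < D -> h2 < D -> h3 < D ->
  g1 <= D -> g2 <= D -> g3 <= D ->
  costs (while_pos 32 inner_body) (nth 0 (inner_at 0), out) (nth 0 (inner_at D), out)
    (D * (6 * F + 101) + 1).
Proof.
move=> dF dW rW hw0 hw1 hw2 hw3 hh1 hh2 hh3 hg1 hg2 hg3.
have D0 : 0 < D by apply: leq_ltn_trans hw0.
have d0 : 0 < d by rewrite muln_gt0.
pose L i : state := (nth 0 (inner_at i), out).
apply: costs_to; first apply: (costs_while W0 (s := 6 * F + 100) (L := L) (m := D)).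
- move=> i iD; split; first by rewrite /L /=; lia.
- have phS w : w < D -> (phase w i + 2 * w) %% d = phase w i.+1.
    by move=> hw; rewrite /phase modnDml; congr (_ %% _); ring.
  have tuS w : w < D -> turns w i.+1 = turns w i + (d <= phase w i + 2 * w).
    move=> hw; rewrite /turns /crossings /phase -div_add_lt ?ltn_mul2l //.
    by congr (_ %/ _); ring.
  have yS h : ((2 * i + 1) * h %% d + 2 * h) %% d = (2 * i.+1 + 1) * h %% d.
    by rewrite modnDml; congr (_ %% _); ring.
  have fE h : minn (d - (2 * i + 1) * h %% d) ((2 * i + 1) * h %% d) = fold D h (2 * i).+1.
    by rewrite /fold addn1.
  have cS P : count P (iota 0 i.+1) = count P (iota 0 i) + P i :> nat.
    by rewrite -[i.+1]addn1 iotaD count_cat /= add0n addn0.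
  have ci P : count P (iota 0 i) <= i by rewrite -[X in _ <= X](size_iota 0) count_size.
  apply: costs_to; first apply: (costs_inner_body (F := F)) => //.
  + by rewrite oddD oddM.
  + by lia.
  + apply: leq_ltn_trans dF; rewrite leq_mul2r; apply/orP; right; lia.
  + by rewrite leq_subr.
  + by rewrite ltn_mod.
  + by rewrite ltn_mod.
  + by rewrite ltn_mod.
  + by rewrite ltn_mod.
  + by rewrite ltn_mod.
  + by rewrite ltn_mod.
  + by rewrite ltn_mod.
  + by case: (odd _).
  + by apply: leq_ltn_trans (ci _) iD.
  + apply: leq_ltn_trans rW; rewrite leq_add2r leq_mul2l; apply/orP; right.
    by apply: leq_trans (ci _) (ltnW iD).
  + rewrite /L /inner_at !phS // !yS !fE !cS mulnDr !toggle_odd.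
    rewrite /counted /stable /all_turns !tuS //.
    congr (nth 0 (inner_env _ _ _ _ _ _ _ _ _ _ _ _), out).
    * by lia.
    * by lia.
    * by congr nat_of_bool; congr odd; ring.
    * by rewrite addn1; case: (odd _).
    * by rewrite addn1.
  + by [].
- by rewrite /L /= subnn.
- by [].
- by lia.
Qed.

End Inner.

(** * The test of a single triple *)

Section Test.
Local Open Scope nat_scope.
Variable W : nat.
Hypothesis W0 : 0 < W.
Local Notation costs := (costs W).
Local Arguments when : simpl never.
Local Arguments set_to : simpl never.
Local Arguments add_to : simpl never.
Local Arguments sub_to : simpl never.
Local Arguments mul_to : simpl never.
Local Arguments emit : simpl never.
Local Arguments zeros : simpl never.
Local Arguments inner_body : simpl never.

Definition is_zero x : seq (operand * operand) := [:: (Var x, Lit 0)].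

Definition setup1 := prog_seq [::
  set_to 10 (Var 4); when (is_zero 4) (add_to 10 (Var 3) (Lit 1));
  set_to 11 (Var 5); when (is_zero 5) (add_to 11 (Var 3) (Lit 1));
  set_to 12 (Var 6); when (is_zero 6) (add_to 12 (Var 3) (Lit 1));
  set_to 13 (Var 4); when (is_zero 4) (set_to 13 (Lit 1));
  set_to 14 (Var 5); when (is_zero 5) (set_to 14 (Lit 1));
  set_to 15 (Var 6); when (is_zero 6) (set_to 15 (Lit 1));
  mul_to 18 (Var 14) 15 49; mul_to 19 (Var 13) 15 49; mul_to 20 (Var 13) 14 49;
  mul_to 16 (Var 13) 18 49;
  when (is_zero 4) (set_to 18 (Lit 0));
  when (is_zero 5) (set_to 19 (Lit 0));
  when (is_zero 6) (set_to 20 (Lit 0))].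

Definition setup2 := prog_seq [::
  add_to 17 (Var 16) (Var 16);
  add_to 21 (Var 18) (Var 18); add_to 22 (Var 19) (Var 19); add_to 23 (Var 20) (Var 20);
  add_to 24 (Var 18) (Var 19); add_to 24 (Var 24) (Var 20);
  add_to 25 (Var 18) (Var 19); sub_to 25 (Var 25) (Var 20);
  add_to 26 (Var 18) (Var 20); sub_to 26 (Var 26) (Var 19);
  add_to 43 (Var 19) (Var 20); sub_to 27 (Var 43) (Var 18);
  sub_to 43 (Var 18) (Var 43); add_to 27 (Var 27) (Var 43);
  sub_to 28 (Var 16) (Var 18); sub_to 29 (Var 16) (Var 19); sub_to 30 (Var 16) (Var 20);
  add_to 43 (Var 24) (Lit 1)].

(** The residues start at [k = 1] from the plain weights, which are doubled only afterwards. The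
    entries are emitted last to first, as the output is a stack. *)
Definition decide := prog_seq [::
  set_to 43 (Lit 0);
  set_to 31 (Lit 1); set_to 32 (Var 16);
  add_to 33 (Var 24) (Var 16); add_to 34 (Var 25) (Var 16);
  add_to 35 (Var 26) (Var 16); add_to 36 (Var 27) (Var 16);
  set_to 38 (Var 18); set_to 39 (Var 19); set_to 40 (Var 20);
  add_to 24 (Var 24) (Var 24); add_to 25 (Var 25) (Var 25);
  add_to 26 (Var 26) (Var 26); add_to 27 (Var 27) (Var 27);
  while_pos 32 inner_body;
  when (eqc (Var 47) (Var 48)) (Seq (emit 6) (Seq (emit 5) (emit 4)))].

(** Variable 43 holds [wt0 + 1] at this point, so the last condition is the strict inequality of
    hyperbolicity. *)
Definition test_conds : seq (operand * operand) :=
  [:: (Lit 2, Var 10); (Var 10, Var 11); (Var 11, Var 12); (Var 43, Var 16)].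

(** Clearing the variables 10 to 49 returns to [base_env], so every test starts from the same
    environment. *)
Definition test_triple := prog_seq [:: setup1; setup2; when test_conds decide; zeros (iota 10 40)].

Lemma zeros_take l : size l = 50 ->
  (fun x => if x \in iota 10 40 then 0 else nth 0 l x) = nth 0 (take 10 l).
Proof.
move=> sl; apply/funext => x; rewrite mem_iota; case: (ltnP x 10) => x10 /=.
  by rewrite nth_take.
rewrite [RHS]nth_default; last by rewrite size_takel ?sl.
by case: ltnP => // h; rewrite nth_default // sl.
Qed.

Variables (r n n2 n4 a b c ia ib ic : nat).
Local Notation D := (vol a b c).
Local Notation h1 := (ht1 a b c).
Local Notation h2 := (ht2 a b c).
Local Notation h3 := (ht3 a b c).
Local Notation w0 := (wt0 a b c).
Local Notation w1 := (wt1 a b c).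
Local Notation w2 := (wt2 a b c).
Local Notation w3 := (wt3 a b c).

(* Infinity becomes the largest value, so that [<=] compares the entries. *)
Definition cap x := if x == 0 then n4 + 1 else x.

Definition base_env := [:: r; n; n2; n4; a; b; c; ia; ib; ic].

Definition env1 := base_env ++ [:: cap a; cap b; cap c; den a; den b; den c;
  D; 0; h1; h2; h3; 0; 0; 0; 0; 0; 0; 0; 0; 0; 0; 0; 0; 0; 0; 0; 0; 0; 0; 0; 0;
  0; 0; 0; 0; 0; 0; 0; 0; 0].

Lemma if_leq0 (T : Type) (x : nat) (u v : T) :
  (if (x <= 0) && true then u else v) = if x == 0 then u else v.
Proof. by rewrite andbT leqn0. Qed.

Hypotheses (aN : a <= n4) (bN : b <= n4) (cN : c <= n4) (n4W : n4 + 4 < 2 ^ W).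
Hypothesis DW : 8 * D + 8 < 2 ^ W.

Lemma den_le_vol : [/\ den a <= D, den b <= D & den c <= D].
Proof.
have [a1 b1 c1] : [/\ 0 < den a, 0 < den b & 0 < den c] by rewrite !den_gt0.
split; rewrite /vol.
- by rewrite -mulnA leq_pmulr // muln_gt0 b1.
- by rewrite mulnAC leq_pmull // muln_gt0 a1.
- by rewrite leq_pmull // muln_gt0 a1.
Qed.

Lemma costs_setup1 out :
  costs setup1 (nth 0 base_env, out) (nth 0 env1, out) (3 * (den b + 3 * den a) + 40).
Proof.
have [a1 b1 c1] : [/\ 0 < den a, 0 < den b & 0 < den c] by rewrite !den_gt0.
have D1 : den b * den c <= D by rewrite /vol -mulnA leq_pmull.
have D2 : den a * den c <= D by rewrite /vol mulnAC leq_pmulr.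
have D3 : den a * den b <= D by rewrite /vol leq_pmulr.
have D4 : den a * (den b * den c) = D by rewrite /vol mulnA.
have [da db dc] := den_le_vol.
rewrite /base_env /setup1.
have capE x : (if x == 0 then n4 + 1 else x) = cap x by [].
have denE x : (if x == 0 then 1 else x) = den x by [].
have capW x : x <= n4 -> cap x < 2 ^ W by rewrite /cap; case: eqP; lia.
have fz x e : e x < 2 ^ W -> fits W e (is_zero x).
  by rewrite /fits /= andbT => ->; rewrite expn_gt0.
apply: costs_to.
  apply: costs_seq; first by apply: (costs_set W0) => /=; lia.
  rewrite upd_nth /=.
  apply: costs_seq; first by apply: (costs_when_add W0); rewrite ?fz //=; lia.
  rewrite upd_nth /holds /= if_leq0 capE.
  apply: costs_seq; first by apply: (costs_set W0) => /=; lia.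
  rewrite upd_nth /=.
  apply: costs_seq; first by apply: (costs_when_add W0); rewrite ?fz //=; lia.
  rewrite upd_nth /holds /= if_leq0 capE.
  apply: costs_seq; first by apply: (costs_set W0) => /=; lia.
  rewrite upd_nth /=.
  apply: costs_seq; first by apply: (costs_when_add W0); rewrite ?fz //=; lia.
  rewrite upd_nth /holds /= if_leq0 capE.
  apply: costs_seq; first by apply: (costs_set W0) => /=; lia.
  rewrite upd_nth /=.
  apply: costs_seq; first by apply: (costs_when_set W0); rewrite ?fz //=; lia.
  rewrite upd_nth /holds /= if_leq0 denE.
  apply: costs_seq; first by apply: (costs_set W0) => /=; lia.
  rewrite upd_nth /=.
  apply: costs_seq; first by apply: (costs_when_set W0); rewrite ?fz //=; lia.
  rewrite upd_nth /holds /= if_leq0 denE.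
  apply: costs_seq; first by apply: (costs_set W0) => /=; lia.
  rewrite upd_nth /=.
  apply: costs_seq; first by apply: (costs_when_set W0); rewrite ?fz //=; lia.
  rewrite upd_nth /holds /= if_leq0 denE.
  do 3 (apply: costs_seq; [by apply: (costs_mul W0) => //=; lia | rewrite !upd_nth /=]).
  apply: costs_seq; first by apply: (costs_mul W0) => //=; lia.
  rewrite !upd_nth /= D4.
  apply: costs_seq; first by apply: (costs_when_set W0); rewrite ?fz //=; lia.
  rewrite upd_nth /holds /= if_leq0 -/(height _ _) -/h1.
  apply: costs_seq; first by apply: (costs_when_set W0); rewrite ?fz //=; lia.
  rewrite upd_nth /holds /= if_leq0 -/(height _ _) -/h2.
  apply: costs_seq; first by apply: (costs_when_set W0); rewrite ?fz //=; lia.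
  rewrite upd_nth /holds /= if_leq0 -/(height _ _) -/h3.
  exact: costs_skip.
by [].
by rewrite /=; lia.
Qed.

Definition env2 := base_env ++ [:: cap a; cap b; cap c; den a; den b; den c;
  D; D + D; h1; h2; h3; h1 + h1; h2 + h2; h3 + h3; w0; w1; w2; w3; D - h1; D - h2; D - h3;
  0; 0; 0; 0; 0; 0; 0; 0; 0; 0; 0; 0; w0 + 1; 0; 0; 0; 0; 0; 0].

Lemma ht_le : [/\ h1 <= D, h2 <= D & h3 <= D].
Proof.
have [a1 b1 c1] : [/\ 0 < den a, 0 < den b & 0 < den c] by rewrite !den_gt0.
split; rewrite /ht1 /ht2 /ht3 /height; case: eqP => // _.
- by rewrite /vol -mulnA leq_pmull.
- by rewrite /vol mulnAC leq_pmulr.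
- by rewrite /vol leq_pmulr.
Qed.

Lemma costs_setup2 out : costs setup2 (nth 0 env1, out) (nth 0 env2, out) 18.
Proof.
have [hh1 hh2 hh3] := ht_le; rewrite /env1 /base_env /setup2.
apply: costs_to.
  do 18 (apply: costs_seq;
    [by (apply: (costs_add W0) || apply: (costs_sub W0)) => /=; lia | rewrite upd_nth /=]).
  exact: costs_skip.
by [].
by [].
Qed.

Definition splits := count (fun j => coprime (2 * j).+1 D && split_at a b c (2 * j).+1) (iota 0 D).
Definition fixes := count (fun j => coprime (2 * j).+1 D && fixed_by a b c (2 * j).+1) (iota 0 D).

Lemma capW x : x <= n4 -> cap x < 2 ^ W.
Proof. by rewrite /cap; case: eqP; lia. Qed.

Definition report out := if splits == r * fixes then code a ++ code b ++ code c ++ out else out.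

(** The final environment is left existential: the working variables are about to be cleared, and
    only their bit size matters for the cost of that. *)
Lemma costs_decide F out : wt0 a b c < D -> w1 < D -> w2 < D -> w3 < D ->
  h1 < D -> h2 < D -> h3 < D ->
  2 * D * D < 2 ^ F -> r * D + r < 2 ^ W ->
  exists l, [/\ size l = 50, take 10 l = base_env, all (fun x => x < 2 ^ W) (drop 10 l) &
  costs decide (nth 0 env2, out) (nth 0 l, report out) (D * (6 * F + 101) + 20)].
Proof.
move=> hw0 hw1 hw2 hw3 hh1 hh2 hh3 DF rW.
pose l := inner_at r n n2 n4 a b c ia ib ic (cap a) (cap b) (cap c) (den a) (den b) (den c)
   D h1 h2 h3 (D - h1) (D - h2) (D - h3) w0 w1 w2 w3.
have D0 := vol_gt0 a b c.
have cW (P : pred nat) : count P (iota 0 D) <= D.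
  by rewrite -[X in _ <= X](size_iota 0) count_size.
exists (l D); split => //.
  have pW w : phase D w D < 2 ^ W.
    by apply: (@leq_trans (2 * D)); [rewrite ltn_mod muln_gt0|lia].
  have yW x : x %% (2 * D) < 2 ^ W.
    by apply: (@leq_trans (2 * D)); [rewrite ltn_mod muln_gt0|lia].
  have kW (q : bool) : q < 2 ^ W by case: q; lia.
  have sW := cW (counted D w0 w1 w2 w3).
  have tW : r * count (stable D h1 h2 h3 (D - h1) (D - h2) (D - h3)) (iota 0 D) < 2 ^ W.
    by apply: leq_ltn_trans rW; apply: leq_trans (leq_addr _ _); rewrite leq_mul2l cW orbT.
  have [q1 q2 q3] := den_le_vol.
  rewrite /l /inner_at /= !pW !yW kW tW !capW //.
  by lia.
have h0 := @costs_inner_loop W W0 r n n2 n4 a b c ia ib ic (cap a) (cap b) (cap c)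
   (den a) (den b) (den c) D h1 h2 h3 (D - h1) (D - h2) (D - h3) w0 w1 w2 w3 F out.
have ph w : w < D -> phase D w 0 = w + D by move=> h; rewrite /phase mul1n modn_small //; lia.
have tu w : w < D -> turns D w 0 = 0 by move=> h; rewrite /turns /crossings mul1n divn_small //; lia.
have yy h : h < D -> (2 * 0 + 1) * h %% (2 * D) = h by move=> hh; rewrite mul1n modn_small //; lia.
have l0 : l 0 = inner_env r n n2 n4 a b c ia ib ic (cap a) (cap b) (cap c)
   (den a) (den b) (den c) D h1 h2 h3 (D - h1) (D - h2) (D - h3) w0 w1 w2 w3 1 D
   (w0 + D) (w1 + D) (w2 + D) (w3 + D)
   0 h1 h2 h3 0 0.
  rewrite /l /inner_at /all_turns !ph // !tu // !yy // subn0 muln0.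
  by rewrite [count (stable _ _ _ _ _ _ _) _]/= muln0.
rewrite /env2 /base_env /decide.
apply: costs_to.
  do 3 (apply: costs_seq; [by apply: (costs_set W0) => /=; lia | rewrite upd_nth /=]).
  do 4 (apply: costs_seq; [by apply: (costs_add W0) => /=; lia | rewrite upd_nth /=]).
  do 3 (apply: costs_seq; [by apply: (costs_set W0) => /=; lia | rewrite upd_nth /=]).
  do 4 (apply: costs_seq; [by apply: (costs_add W0) => /=; lia | rewrite upd_nth /=]).
  apply: costs_seq.
    rewrite (_ : [:: _, _ & _] = l 0); last by rewrite l0 /inner_env !mul2n -!addnn.
    apply: h0 => //; rewrite ?leq_subr //; by lia.
  apply: costs_seq; last exact: costs_skip.
  apply: (costs_when W0 (st := (nth 0 (l D), code a ++ code b ++ code c ++ out)) (s := 3)).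
    rewrite /fits /= !andbT.
    have := leq_mul (leqnn r) (cW (stable D h1 h2 h3 (D - h1) (D - h2) (D - h3))).
    have := cW (counted D w0 w1 w2 w3); lia.
  move=> _; apply: costs_to.
    apply: costs_seq; first by apply: (costs_emit W0) => /=; lia.
    apply: costs_seq; first by apply: (costs_emit W0) => /=; lia.
    by apply: (costs_emit W0) => /=; lia.
  by rewrite /= .
  by [].
- rewrite /holds /= andbT -eqn_leq /report.
  rewrite (_ : count (counted D w0 w1 w2 w3) (iota 0 D) = splits); last first.
    by apply: eq_count => j; rewrite /counted /all_turns /turns addn1.
  rewrite (_ : count (stable D h1 h2 h3 (D - h1) (D - h2) (D - h3)) (iota 0 D) = fixes) //.
  by case: eqP.
- by rewrite /=; lia.
Qed.

Definition test_ok := [&& 1 < cap a, cap a <= cap b, cap b <= cap c, w0 < D & splits == r * fixes].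

Lemma costs_test F out : 2 * D * D < 2 ^ F -> r * D + r < 2 ^ W ->
  costs test_triple (nth 0 base_env, out)
    (nth 0 base_env, if test_ok then code a ++ code b ++ code c ++ out else out)
    (D * (6 * F + 300)).
Proof.
move=> DF rW; have D0 := vol_gt0 a b c.
have [hh1 hh2 hh3] := ht_le.
pose b0 := holds (nth 0 env2) test_conds.
have b0E : b0 = [&& 1 < cap a, cap a <= cap b, cap b <= cap c & w0 < D].
  by rewrite /b0 /holds /= andbT addn1.
have dab : den b + 3 * den a <= 4 * D by have [] := den_le_vol; lia.
have : exists l, [/\ size l = 50, take 10 l = base_env, all (fun x => x < 2 ^ W) (drop 10 l) &
  costs (when test_conds decide) (nth 0 env2, out)
   (nth 0 l, if test_ok then code a ++ code b ++ code c ++ out else out)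
   (4 + (D * (6 * F + 101) + 20))].
  have ft : fits W (nth 0 env2) test_conds.
    have hw : w0 <= 3 * D by rewrite /wt0; lia.
    rewrite /fits /test_conds /= !capW // andbT; lia.
  have [hb|hb] := boolP b0; last first.
    exists env2; split => //.
      have [q1 q2 q3] := den_le_vol.
      by rewrite /= !capW //; rewrite /wt0 /wt1 /wt2 /wt3; lia.
    have h : costs (when test_conds decide) (nth 0 env2, out) (nth 0 env2, out) (4 + 0).
      have := costs_when W0 (p := decide) (st := (nth 0 env2, out)) (out := out) (s := 0) ft.
      by rewrite -/b0 (negbTE hb); apply.
    rewrite /test_ok; move: hb; rewrite b0E; set v1 := 1 < _; set v2 := _ <= cap b; set v3 := _ <= cap c.
    set v4 := w0 < D => hv.
    have -> : [&& v1, v2, v3, v4 & splits == r * fixes] = false.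
      by move: hv; case: v1 => //=; case: v2 => //=; case: v3 => //=; case: v4.
    by apply: costs_weaken h; lia.
  have := hb; rewrite b0E => /and4P[v1 v2 v3 v4].
  have hw : [/\ w1 < D, w2 < D & w3 < D /\ (h1 < D /\ h2 < D /\ h3 < D)].
    by move: v4; rewrite /wt0 /wt1 /wt2 /wt3; split; lia.
  have [hw1 hw2 [hw3 [hx1 [hx2 hx3]]]] := hw.
  have [l [sl tl al hl]] := costs_decide out v4 hw1 hw2 hw3 hx1 hx2 hx3 DF rW.
  exists l; split => //.
  have := costs_when W0 (p := decide) ft (fun _ => hl).
  by rewrite -/b0 hb /test_ok v1 v2 v3 v4 /=.
case=> l [sl tl al hl].
have hlW x : x \in iota 10 40 -> nth 0 l x < 2 ^ W.
  rewrite mem_iota => /andP[x1 x2]; rewrite -(subnKC x1) -nth_drop.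
  by apply: (all_nthP 0 al); rewrite size_drop sl; lia.
apply: costs_to.
  apply: costs_seq; first exact: costs_setup1.
  apply: costs_seq; first exact: costs_setup2.
  apply: costs_seq; first exact: hl.
  apply: costs_seq; last exact: costs_skip.
  by apply: (costs_zeros W0); apply/allP => x; apply: hlW.
- by rewrite zeros_take // tl.
- rewrite /=; lia.
Qed.

End Test.

(** The left side is the cost of the whole program for [m = n] and [v = W]: two moves of the input,
    the initialization and three nested loops around one test. *)
Lemma cost_arith m v l : (0 < m)%N -> (0 < v)%N -> (l <= m)%N ->
  ((4 * l).+1 + ((4 * l).+1 + (100 * m ^ 2 + (m.+1 * ((m * m).+1 *
     ((m * m * (m * m)).+1 * (m ^ 7 * (12 * v + 300) + 3) + 6) + 6) + 1)) * (70 * v))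
   <= 200 * 1000 * (m ^ 14 * v ^ 2))%N.
Proof.
move=> m0 v0 lm.
have P k : (0 < m ^ k)%N by rewrite expn_gt0 m0.
have Q k : (0 < m ^ k * v)%N by rewrite muln_gt0 P.
set U := (m ^ 7 * (12 * v + 300) + 3)%N.
have hU : (U <= 315 * (m ^ 7 * v))%N.
  have : (m ^ 7 <= m ^ 7 * v)%N by rewrite leq_pmulr.
  by rewrite /U; have := P 7; lia.
set A := ((m * m * (m * m)).+1 * U + 6)%N.
have hA : (A <= 636 * (m ^ 11 * v))%N.
  have h4 : ((m * m * (m * m)).+1 <= 2 * m ^ 4)%N.
    by rewrite (_ : m * m * (m * m) = m ^ 4)%N; [have := P 4; lia|ring].
  have := leq_mul h4 hU; rewrite (_ : 2 * m ^ 4 * (315 * (m ^ 7 * v)) = 630 * (m ^ 11 * v))%N; last by ring.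
  by have := Q 11; rewrite /A; lia.
set B := ((m * m).+1 * A + 6)%N.
have hB : (B <= 1278 * (m ^ 13 * v))%N.
  have h2 : ((m * m).+1 <= 2 * m ^ 2)%N by have := P 2; rewrite -mulnn; lia.
  have := leq_mul h2 hA; rewrite (_ : 2 * m ^ 2 * (636 * (m ^ 11 * v)) = 1272 * (m ^ 13 * v))%N; last by ring.
  by have := Q 13; rewrite /B; lia.
have hC : (m.+1 * B <= 2556 * (m ^ 14 * v))%N.
  have h1 : (m.+1 <= 2 * m)%N by lia.
  have := leq_mul h1 hB; rewrite (_ : 2 * m * (1278 * (m ^ 13 * v)) = 2556 * (m ^ 14 * v))%N //; by ring.
have hD : (m ^ 2 <= m ^ 14 * v)%N by apply: leq_trans (leq_pmulr _ v0); rewrite leq_pexp2l.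
have hE : (m <= m ^ 14 * v ^ 2)%N.
  rewrite -{1}[m]expn1; apply: (@leq_trans (m ^ 14)); first by rewrite leq_pexp2l.
  by rewrite leq_pmulr // expn_gt0 v0.
have hF : ((100 * m ^ 2 + (m.+1 * B + 1)) * (70 * v) <= 2657 * (m ^ 14 * v) * (70 * v))%N.
  by rewrite leq_mul2r; apply/orP; right; have := Q 14; lia.
have hG : (2657 * (m ^ 14 * v) * (70 * v) = 2657 * (70 * (m ^ 14 * v ^ 2)))%N by ring.
have {}hF := leq_trans hF (eq_leq hG); move: hF hE lm m0.
by move: (m ^ 14 * v ^ 2)%N (_ * (70 * v))%N => X Y; lia.
Qed.

(** * Enumeration of the box and the total cost *)

Section Main.
Local Open Scope nat_scope.
Variables (K W : nat).
Hypothesis W0 : 0 < W.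
Local Notation costs := (costs W).
Local Arguments when : simpl never.
Local Arguments set_to : simpl never.
Local Arguments add_to : simpl never.
Local Arguments sub_to : simpl never.
Local Arguments mul_to : simpl never.
Local Arguments while_pos : simpl never.
Local Arguments test_triple : simpl never.

Definition c_body := prog_seq [:: sub_to 9 (Var 9) (Lit 1); test_triple; add_to 6 (Var 6) (Lit 1)].
Definition b_body := prog_seq [:: sub_to 8 (Var 8) (Lit 1); set_to 6 (Lit 0);
  add_to 9 (Var 3) (Lit 1); while_pos 9 c_body; add_to 5 (Var 5) (Lit 1)].
Definition a_body := prog_seq [:: sub_to 7 (Var 7) (Lit 1); set_to 5 (Lit 0);
  add_to 8 (Var 2) (Lit 1); while_pos 8 b_body; add_to 4 (Var 4) (Lit 1)].

(** The bit length of [r] is counted by halving a copy of it; variables 1, 2 and 3 then receive [n],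
    [n ^ 2] and [n ^ 4]. The constant [K] is a literal of the program. *)
Definition init_prog := prog_seq [::
  set_to 1 (Var 0);
  while_pos 1 (Seq (halve 1) (add_to 2 (Var 2) (Lit 1)));
  mul_to 3 (Var 0) 2 4;
  mul_to 1 (Lit K) 3 4;
  mul_to 2 (Var 1) 1 4;
  mul_to 3 (Var 2) 2 4;
  add_to 7 (Var 1) (Lit 1)].

Definition main_prog :=
  Seq (move_stack 0 1) (Seq (move_stack 1 5) (Seq init_prog (while_pos 7 a_body))).

Definition codes (l : seq (nat * nat * nat)) : seq bool :=
  flatten [seq code t.1.1 ++ code t.1.2 ++ code t.2 | t <- l].

Lemma costs_halvings x y e out : x != y -> e y + up_log 2 (e x).+1 < 2 ^ W ->
  costs (while_pos x (Seq (halve x) (add_to y (Var y) (Lit 1)))) (e, out)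
    (upd (upd e x 0) y (e y + up_log 2 (e x).+1), out) (3 * up_log 2 (e x).+1 + 1).
Proof.
move=> xy; have yx : y != x by rewrite eq_sym.
move E: (e x) => m; elim/ltn_ind: m e E => m IH e E h.
case: (posnP m) => m0.
  rewrite m0 up_log1 addn0; apply: costs_to; first by apply: (costs_stop W0); rewrite /= E m0.
    by rewrite -m0 -E !upd_same.
  by [].
have lm := up_log2_half m0.
rewrite lm in h *.
have W1 : 1 < 2 ^ W by lia.
have s1 : costs (Seq (halve x) (add_to y (Var y) (Lit 1))) (e, out)
    (upd (upd e x m./2) y (e y + 1), out) 2.
  apply: costs_to.
    apply: costs_seq; first exact: (costs_halve W0).
    by apply: (costs_add W0) => //=; rewrite (updN _ _ yx); lia.
  by rewrite /= (updN _ _ yx) E.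
  by [].
have := IH m./2 _ (upd (upd e x m./2) y (e y + 1)).
rewrite (updN _ _ xy) !updE => /(_ ltac:(lia) erefl ltac:(lia)) s2.
apply: costs_to (costs_step W0 _ s1 s2) _ _ => //.
- by rewrite /= E; lia.
- rewrite (updC _ _ _ yx) !updK; congr (upd _ _ _, _).
  by lia.
- by lia.
Qed.

Variable r : nat.
Local Notation n := (K * (r * up_log 2 r.+1)).
Local Notation n2 := (n * n).
Local Notation n4 := (n * n * (n * n)).

Definition chosen a b c := test_ok r n4 a b c.
(** Reversed, because the output grows at its front. Enumeration starts at 0, which stands for
    infinity. *)
Definition list_c a b m := rev [seq (a, b, c) | c <- iota 0 m & chosen a b c].
Definition list_b a m := flatten (rev [seq list_c a b n4.+1 | b <- iota 0 m]).
Definition list_a m := flatten (rev [seq list_b a n2.+1 | a <- iota 0 m]).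

Lemma list_cS a b m : list_c a b m.+1 = (if chosen a b m then [:: (a, b, m)] else [::]) ++ list_c a b m.
Proof.
rewrite /list_c -{1}[m.+1]addn1 iotaD filter_cat map_cat rev_cat /= add0n.
by case: (chosen a b m).
Qed.

Lemma list_bS a m : list_b a m.+1 = list_c a m n4.+1 ++ list_b a m.
Proof. by rewrite /list_b -{1}[m.+1]addn1 iotaD map_cat rev_cat /= add0n. Qed.

Lemma list_aS m : list_a m.+1 = list_b m n2.+1 ++ list_a m.
Proof. by rewrite /list_a -{1}[m.+1]addn1 iotaD map_cat rev_cat /= add0n. Qed.

Lemma codes_cat l l' : codes (l ++ l') = codes l ++ codes l'.
Proof. by rewrite /codes map_cat flatten_cat. Qed.

Hypothesis K0 : 0 < K.
Hypothesis r0 : 0 < r.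
Hypothesis nW : 16 * n ^ 8 < 2 ^ W.
Let l0 : 0 < up_log 2 r.+1. Proof. by rewrite up_log_gt0. Qed.
Let n0 : 0 < n. Proof. by rewrite !muln_gt0 K0 r0. Qed.
Let rn : r <= n.
Proof. by rewrite mulnCA leq_pmulr // muln_gt0 K0. Qed.

Let n1W k : k <= 8 -> 16 * n ^ k < 2 ^ W.
Proof. by move=> hk; apply: leq_ltn_trans nW; rewrite leq_mul2l leq_pexp2l. Qed.
Let n2E : n2 = n ^ 2. Proof. by []. Qed.
Let n4E : n4 = n ^ 4. Proof. by rewrite -[4]/(2 * 2) expnM. Qed.
Let nn4 : n <= n4. Proof. by rewrite n4E -[X in X <= _]expn1 leq_pexp2l. Qed.
Let n2n4 : n2 <= n4. Proof. by rewrite n4E n2E leq_pexp2l. Qed.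
Let n4W : n4 + 4 < 2 ^ W.
Proof.
have := n1W (isT : 4 <= 8); have : 0 < n ^ 4 by rewrite expn_gt0 n0.
by rewrite n4E; lia.
Qed.

Lemma vol_le a b c : a <= n -> b <= n2 -> c <= n4 -> vol a b c <= n ^ 7.
Proof.
have dm x y : x <= y -> 0 < y -> den x <= y by rewrite /den; case: eqP.
move=> ha hb hc; rewrite (_ : n ^ 7 = n * n2 * n4); last by rewrite n4E n2E -!expnS -!expnD.
have n20 : 0 < n2 by rewrite muln_gt0 n0.
by rewrite /vol !leq_mul // dm // muln_gt0 n20.
Qed.

Definition unit_cost := n ^ 7 * (12 * W + 300).

Lemma costs_test_main a b c ia ib ic out : a <= n -> b <= n2 -> c <= n4 ->
  costs test_triple (nth 0 (base_env r n n2 n4 a b c ia ib ic), codes out)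
    (nth 0 (base_env r n n2 n4 a b c ia ib ic),
       codes ((if chosen a b c then [:: (a, b, c)] else [::]) ++ out)) unit_cost.
Proof.
move=> ha hb hc; have hv := vol_le ha hb hc.
have h7 := n1W (isT : 7 <= 8).
have n70 : 0 < n ^ 7 by rewrite expn_gt0 n0.
have n8 : n * n ^ 7 = n ^ 8 by rewrite -expnS.
have DW : 8 * vol a b c + 8 < 2 ^ W by lia.
(* The gcd loop is bounded by the bit length of the product of its two arguments, hence twice the
   word size. *)
have DF : 2 * vol a b c * vol a b c < 2 ^ (2 * W).
  have -> : 2 ^ (2 * W) = 2 ^ W * 2 ^ W by rewrite -expnD addnn mul2n.
  by apply: leq_ltn_trans (ltn_mul h7 h7); apply: leq_mul; lia.
have rW : r * vol a b c + r < 2 ^ W.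
  have : r * vol a b c <= n * n ^ 7 by apply: leq_mul.
  have : n <= n ^ 8 by rewrite -[X in X <= _]expn1 leq_pexp2l.
  by lia.
apply: costs_to (costs_test W0 n n2 ia ib ic (leq_trans ha nn4) (leq_trans hb n2n4) hc
  n4W DW (codes out) DF rW) _ _.
- rewrite codes_cat /chosen; congr (_, _).
  by case: test_ok => //=; rewrite /codes /= cats0 -!catA.
- by rewrite /unit_cost; apply: leq_mul => //; lia.
Qed.

Lemma costs_c_loop a b ia ib out : a <= n -> b <= n2 ->
  costs (while_pos 9 c_body)
    (nth 0 (base_env r n n2 n4 a b 0 ia ib n4.+1), codes out)
    (nth 0 (base_env r n n2 n4 a b n4.+1 ia ib 0), codes (list_c a b n4.+1 ++ out))
    (n4.+1 * (unit_cost + 3) + 1).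
Proof.
move=> ha hb.
pose L i : state := (nth 0 (base_env r n n2 n4 a b i ia ib (n4.+1 - i)), codes (list_c a b i ++ out)).
apply: costs_to; first apply: (costs_while W0 (L := L) (m := n4.+1) (s := unit_cost + 2)).
- move=> i hi; split; first by rewrite /L /=; lia.
  rewrite /L /base_env /c_body; set o := codes _.
  apply: costs_to.
    apply: costs_seq; first by apply: (costs_sub W0) => /=; lia.
    rewrite upd_nth /= /o.
    apply: costs_seq; first by apply: costs_test_main.
    apply: costs_seq; first by apply: (costs_add W0) => /=; lia.
    rewrite upd_nth /=.
    exact: costs_skip.
  by rewrite catA -list_cS addn1 subn1 -subnS.
  by lia.
- by rewrite /L /= subnn.
- by rewrite /L subnn.
- by lia.
Qed.

Lemma costs_b_loop a ia ic0 c0 out : a <= n -> ic0 < 2 ^ W -> c0 < 2 ^ W ->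
  costs (while_pos 8 b_body)
    (nth 0 (base_env r n n2 n4 a 0 c0 ia n2.+1 ic0), codes out)
    (nth 0 (base_env r n n2 n4 a n2.+1 n4.+1 ia 0 0), codes (list_b a n2.+1 ++ out))
    (n2.+1 * (n4.+1 * (unit_cost + 3) + 6) + 1).
Proof.
move=> ha hi0 hc0.
(* Before the first round the variables of the inner loop hold whatever they held on entry;
   afterwards they hold what that loop leaves behind. *)
pose cc i := if i == 0 then c0 else n4.+1.
pose ii i := if i == 0 then ic0 else 0.
have ccW i : cc i < 2 ^ W by rewrite /cc; case: eqP => // _; lia.
have iiW i : ii i < 2 ^ W by rewrite /ii; case: eqP => // _; lia.
pose L i : state := (nth 0 (base_env r n n2 n4 a i (cc i) ia (n2.+1 - i) (ii i)), codes (list_b a i ++ out)).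
apply: costs_to; first apply: (costs_while W0 (L := L) (m := n2.+1)
  (s := n4.+1 * (unit_cost + 3) + 5)).
- move=> i hi; split; first by rewrite /L /=; lia.
  rewrite /L /base_env /b_body; set o := codes _.
  apply: costs_to.
    apply: costs_seq; first by apply: (costs_sub W0) => /=; lia.
    rewrite upd_nth /=.
    apply: costs_seq; first by apply: (costs_set W0) => /=; rewrite ?ccW //; lia.
    rewrite upd_nth /=.
    apply: costs_seq; first by apply: (costs_add W0) => /=; rewrite ?iiW //; lia.
    rewrite upd_nth /= /o addn1.
    apply: costs_seq; first by apply: costs_c_loop.
    apply: costs_seq; first by apply: (costs_add W0) => /=; lia.
    rewrite upd_nth /=.
    exact: costs_skip.
  by rewrite catA -list_bS addn1 subn1 -subnS.
  by lia.
- by rewrite /L /= subnn.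
- by rewrite /L subnn.
- by lia.
Qed.

Lemma costs_a_loop :
  costs (while_pos 7 a_body) (nth 0 (base_env r n n2 n4 0 0 0 n.+1 0 0), codes [::])
    (nth 0 (base_env r n n2 n4 n.+1 n2.+1 n4.+1 0 0 0), codes (list_a n.+1))
    (n.+1 * (n2.+1 * (n4.+1 * (unit_cost + 3) + 6) + 6) + 1).
Proof.
pose bb i := if i == 0 then 0 else n2.+1.
pose cc i := if i == 0 then 0 else n4.+1.
have bbW i : bb i < 2 ^ W by rewrite /bb; case: eqP => _; lia.
have ccW i : cc i < 2 ^ W by rewrite /cc; case: eqP => _; lia.
pose L i : state := (nth 0 (base_env r n n2 n4 i (bb i) (cc i) (n.+1 - i) 0 0), codes (list_a i)).
apply: costs_to; first apply: (costs_while W0 (L := L) (m := n.+1)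
  (s := n2.+1 * (n4.+1 * (unit_cost + 3) + 6) + 5)).
- move=> i hi; split; first by rewrite /L /=; lia.
  rewrite /L /base_env /a_body; set o := codes _.
  apply: costs_to.
    apply: costs_seq; first by apply: (costs_sub W0) => /=; lia.
    rewrite upd_nth /=.
    apply: costs_seq; first by apply: (costs_set W0) => /=; rewrite ?bbW //; lia.
    rewrite upd_nth /=.
    apply: costs_seq; first by apply: (costs_add W0) => /=; lia.
    rewrite upd_nth /= /o addn1.
    apply: costs_seq; first by apply: costs_b_loop; rewrite ?ccW //; lia.
    apply: costs_seq; first by apply: (costs_add W0) => /=; lia.
    rewrite upd_nth /=.
    exact: costs_skip.
  by rewrite -list_aS addn1 subn1 -subnS.
  by lia.
- by rewrite /L /= subnn.
- by rewrite /L subnn.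
- by lia.
Qed.

Lemma costs_init :
  costs init_prog (nth 0 [:: r], [::]) (nth 0 (base_env r n n2 n4 0 0 0 n.+1 0 0), [::])
    (100 * n ^ 2).
Proof.
have ln : up_log 2 r.+1 <= n.
  by rewrite mulnA leq_pmull // muln_gt0 K0.
have Kn : K <= n by rewrite leq_pmulr // muln_gt0 r0.
have rl : r * up_log 2 r.+1 <= n by rewrite leq_pmull.
have nn2 : n <= n ^ 2 by rewrite -[X in X <= _]expn1 leq_pexp2l.
have W1 : n < 2 ^ W by lia.
apply: costs_to.
  apply: costs_seq; first by apply: (costs_set W0) => /=; lia.
  rewrite upd_nth /=.
  apply: costs_seq; first by apply: costs_halvings => //=; rewrite add0n; lia.
  rewrite !upd_nth /= add0n.
  do 4 (apply: costs_seq; [by apply: (costs_mul W0) => //=; lia | rewrite !upd_nth /=]).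
  apply: costs_seq; first by apply: (costs_add W0) => /=; lia.
  rewrite upd_nth /= addn1.
  exact: costs_skip.
- by congr (_, _); apply/funext => x; do 10 (case: x => [//|x]); case: x.
- rewrite /=; move: nn2 ln Kn rn n0; rewrite n2E; move: (n ^ 2) => N2; move: (n) => N; lia.
Qed.

Lemma runs_main : exists s, [/\ s 0 = codes (list_a n.+1) &
  runs main_prog (update (fun=> [::]) 0 (binary r)) s (200 * 1000 * (n ^ 14 * W ^ 2))].
Proof.
pose s0 : store := update (fun=> [::]) 0 (binary r).
have sE : s0 = mem (binary r) [::] [::] [::] [::] (nth 0 [::]).
  by apply/funext => -[|[|[|[|[|x]]]]]; rewrite /s0 /update //= nth_nil.
have r1 := @runs_move 0 1 s0 isT.
rewrite sE /= mem_update0 mem_update1 in r1.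
have r2 := @runs_move 1 5 (mem [::] (catrev (binary r) [::]) [::] [::] [::] (nth 0 [::])) isT.
rewrite /= mem_update1 catrev_catrev binary0 cats0 mem_update5 upd_nth /= in r2.
have h := costs_seq costs_init costs_a_loop.
exists (mem_of (nth 0 (base_env r n n2 n4 n.+1 n2.+1 n4.+1 0 0 0), codes (list_a n.+1))).
split => //; rewrite -/s0 sE.
apply: runsW (runs_seq r1 (runs_seq r2 h)).
rewrite catrevE cats0 size_rev size_binary; apply: cost_arith => //.
by rewrite mulnA leq_pmull // muln_gt0 K0.
Qed.

End Main.

(** * The emitted list enumerates the required set without repetition *)

Section Output.
Local Open Scope nat_scope.

Lemma mem_flatten_rev (T : eqType) (f : nat -> seq T) m x :
  (x \in flatten (rev [seq f i | i <- iota 0 m])) = has (fun i => x \in f i) (iota 0 m).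
Proof.
apply/flattenP/hasP => [[s]|[i hi xi]].
  by rewrite mem_rev => /mapP[i hi ->] hx; exists i.
by exists (f i) => //; rewrite mem_rev; apply: map_f.
Qed.

(** The index [i] can be recovered from any element of [f i] by [g], so different blocks are
    disjoint. *)
Lemma uniq_flatten_rev (T : eqType) (f : nat -> seq T) (g : T -> nat) m :
  (forall i, uniq (f i)) -> (forall i x, x \in f i -> g x = i) ->
  uniq (flatten (rev [seq f i | i <- iota 0 m])).
Proof.
move=> fU fg; elim: m => [//|m IH].
rewrite -addn1 iotaD map_cat rev_cat /= add0n cat_uniq fU IH andbT /=.
apply/hasPn => x; rewrite mem_flatten_rev => /hasP[i hi /fg xi].
apply/negP => /fg; rewrite xi => im; move: hi.
by rewrite im mem_iota add0n ltnn andbF.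
Qed.

Lemma mem_list_c K r a b m t :
  (t \in list_c K r a b m) = [&& t.1.1 == a, t.1.2 == b, t.2 < m & chosen K r a b t.2].
Proof.
case: t => [[a' b'] c]; rewrite /list_c mem_rev /=.
apply/mapP/and4P => [[c']|[/eqP-> /eqP-> cm ch]].
  by rewrite mem_filter mem_iota add0n => /andP[ch hc] [-> -> ->]; split.
by exists c => //; rewrite mem_filter ch mem_iota.
Qed.

Lemma mem_list_b K r a m t :
  (t \in list_b K r a m) =
    let n := K * (r * up_log 2 r.+1) in
    [&& t.1.1 == a, t.1.2 < m, t.2 <= n * n * (n * n) & chosen K r a t.1.2 t.2].
Proof.
rewrite /list_b mem_flatten_rev /=; apply/hasP/and4P => [[b]|[h1 h2 h3 h4]].
  by rewrite mem_iota mem_list_c add0n => hb /and4P[? /eqP-> ? ?]; split.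
by exists t.1.2; rewrite ?mem_iota ?add0n ?mem_list_c ?h1 ?h2 ?eqxx /= ?ltnS ?h3.
Qed.

Lemma mem_list_a K r m t :
  (t \in list_a K r m) =
    let n := K * (r * up_log 2 r.+1) in
    [&& t.1.1 < m, t.1.2 <= n * n, t.2 <= n * n * (n * n) & chosen K r t.1.1 t.1.2 t.2].
Proof.
rewrite /list_a mem_flatten_rev /=; apply/hasP/and4P => [[a]|[h1 h2 h3 h4]].
  by rewrite mem_iota mem_list_b add0n => ha /and4P[/eqP-> ? ? ?]; split.
by exists t.1.1; [rewrite mem_iota add0n | rewrite mem_list_b /= eqxx ltnS h2 h3].
Qed.

Lemma uniq_list_a K r m : uniq (list_a K r m).
Proof.
apply: (@uniq_flatten_rev _ _ (fun t => t.1.1)) => [a|a t]; last first.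
  by rewrite mem_list_b => /and4P[/eqP].
apply: (@uniq_flatten_rev _ _ (fun t => t.1.2)) => [b|b t]; last first.
  by rewrite mem_list_c => /and4P[_ /eqP].
by rewrite rev_uniq map_inj_uniq ?filter_uniq ?iota_uniq // => x y [].
Qed.

Definition indices (t : nat * nat * nat) : triple :=
  (index_of t.1.1, index_of t.1.2, index_of t.2).

Lemma index_of_inj : injective index_of.
Proof. by case=> [|x] [|y] //= [->]. Qed.

Lemma indices_inj : injective indices.
Proof. by move=> [[a b] c] [[a' b'] c'] [/index_of_inj-> /index_of_inj-> /index_of_inj->]. Qed.

Lemma codesE l : codes l = encode_triples (map indices l).
Proof.
have E a : code a = encode_index (index_of a) by case: a.
rewrite /codes /encode_triples -map_comp; congr flatten; apply: eq_map => -[[a b] c] /=.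
by rewrite !E -catA.
Qed.

Lemma test_okE (R : realType) r n4 a b c : 0 < n4 -> a <= n4 -> b <= n4 -> c <= n4 ->
  reflect (triples_of_adim R r (indices (a, b, c))) (test_ok r n4 a b c).
Proof.
move=> n40 ha hb hc.
have capE x y : x <= n4 -> y <= n4 -> (cap n4 x <= cap n4 y) = leqi (index_of x) (index_of y).
  by move=> hx hy; rewrite /cap /index_of; case: x y hx hy => [|x] [|y] //=; lia.
have cap1 : [&& 1 < cap n4 a, cap n4 a <= cap n4 b & cap n4 b <= cap n4 c] =
    [&& a != 1, b != 1 & c != 1] &&
    (leqi (index_of a) (index_of b) && leqi (index_of b) (index_of c)).
  rewrite !capE // /cap /index_of.
  by move: a b c ha hb hc {capE} => [|[|a]] [|[|b]] [|[|c]] //=; lia.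
have adm : admissible a b c <->
    [&& 1 < cap n4 a, cap n4 a <= cap n4 b, cap n4 b <= cap n4 c & wt0 a b c < vol a b c].
  rewrite (_ : [&& _, _, _ & _] = [&& 1 < cap n4 a, cap n4 a <= cap n4 b &
    cap n4 b <= cap n4 c] && (wt0 a b c < vol a b c)); last by rewrite -!andbA.
  rewrite cap1; split=> [[-> -> ->] //|/andP[/andP[h1 h2] h3]]; by split.
apply: (iffP idP) => [/and5P[h1 h2 h3 h4 /eqP h5]|[/hyperbolicE hA]].
  have hA : admissible a b c by apply/adm; rewrite h1 h2 h3.
  by split; [apply/hyperbolicE | apply/(has_adim_count R hA)].
move/(has_adim_count R hA) => h; move/adm: hA => /and4P[h1 h2 h3 h4].
by rewrite /test_ok h1 h2 h3 h4 /=; apply/eqP.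
Qed.

Lemma set_list_a (R : realType) K r : let n := K * (r * up_log 2 r.+1) in
  0 < n -> (forall a b c, admissible a b c ->
    has_adim R (index_of a, index_of b, index_of c) r -> [/\ a <= n, b <= n ^ 2 & c <= n ^ 4]) ->
  [set` map indices (list_a K r n.+1)] = triples_of_adim R r.
Proof.
move=> n n0 H.
have n4E : n * n * (n * n) = n ^ 4 by rewrite -[4]/(2 * 2) expnM.
have n40 : 0 < n * n * (n * n) by rewrite n4E expn_gt0 n0.
have nn4 : n <= n * n * (n * n) by rewrite n4E -[X in X <= _]expn1 leq_pexp2l.
have n2n4 : n * n <= n * n * (n * n) by rewrite n4E mulnn leq_pexp2l.
apply/seteqP; split=> t /=.
  move=> /mapP[[[a b] c]]; rewrite mem_list_a /= ltnS => /and4P[ha hb hc h] ->.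
  by apply/test_okE: h => //; [apply: leq_trans ha nn4 | apply: leq_trans hb n2n4].
move=> ht.
have [[[a b] c] E] : exists u, t = indices u.
  case: t ht => [[a b] c] [[/and3P[a2 b2 c2] _ _] _].
  have I x : leqi (Some 2) x -> x = index_of (odflt 0 x) by case: x => [[]|].
  by exists (odflt 0 a, odflt 0 b, odflt 0 c); rewrite /indices /= -!I.
rewrite E in ht *; apply: map_f; rewrite mem_list_a /=.
have [hy hd] := ht; move/hyperbolicE in hy.
have [ha hb hc] := H _ _ _ hy hd.
rewrite -n4E -mulnn in hb hc; rewrite ltnS ha hb hc /=.
by apply/(test_okE R) => //; [apply: leq_trans ha nn4 | apply: leq_trans hb n2n4].
Qed.

End Output.

Lemma prog_correct : exists (p : prog) (C : nat), forall (R : realType) (r : nat), (0 < r)%N ->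
  exists2 t, (t <= C * (r ^ 14 * up_log 2 r.+1 ^ 16))%N &
    outputs_set p r (triples_of_adim R r) t.
Proof.
(* The successor makes [K], and with it [n], positive. *)
have [K0 HK] := adim_bounds; set K := K0.+1; set k := up_log 2 K.
exists (main_prog K), (200 * 1000 * (K ^ 14 * (8 * k + 21) ^ 2))%N => R r r0.
(* As [r] and [l] are at most [2 ^ l], [n] has at most [k + 2 * l] bits. The word size must exceed
   [16 * n ^ 8]: four bits for the factor 16 and one for strictness. *)
set l := up_log 2 r.+1; set n := (K * (r * l))%N; set W := (8 * (k + 2 * l) + 5)%N.
have l0 : (0 < l)%N by rewrite /l up_log_gt0.
have n0 : (0 < n)%N by rewrite !muln_gt0 r0 l0.
have nle : (n <= 2 ^ (k + 2 * l))%N.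
  rewrite expnD leq_mul ?up_logP // mul2n -addnn expnD leq_mul //.
    by apply: ltnW; apply: up_logP.
  by apply: ltnW; rewrite ltn_expl.
have nW : (16 * n ^ 8 < 2 ^ W)%N.
  have : (16 * n ^ 8 <= 2 ^ 4 * 2 ^ ((k + 2 * l) * 8))%N.
    by rewrite leq_mul2l expnM leq_exp2r.
  move/leq_ltn_trans; apply; rewrite -expnD ltn_exp2l // /W; lia.
have W0 : (0 < W)%N by rewrite /W; lia.
have [s [s0 [t tT e]]] := runs_main W0 (ltn0Sn K0) r0 nW.
exists t.
  apply: leq_trans tT _; move: (200 * 1000)%N => Q.
  rewrite -mulnA leq_mul2l; apply/orP; right.
  have Wl : (W <= (8 * k + 21) * l)%N by rewrite /W; nia.
  have -> : (K ^ 14 * (8 * k + 21) ^ 2 * (r ^ 14 * l ^ 16) = n ^ 14 * ((8 * k + 21) * l) ^ 2)%N.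
    by rewrite /n !expnMn; ring.
  by rewrite leq_mul2l leq_exp2r // Wl orbT.
exists (map indices (list_a K r n.+1)), s; split => //.
- by rewrite (map_inj_uniq indices_inj) uniq_list_a.
- apply: set_list_a => // a b c adm h; have [ha hb hc] := HK R a b c r adm r0 h.
  have nn : (K0 * (r * l) <= n)%N by rewrite leq_mul2r leqnSn orbT.
  by split; [apply: leq_trans ha nn | apply: leq_trans hb _ | apply: leq_trans hc _];
    rewrite // leq_exp2r.
- by rewrite s0 codesE.
Qed.

(** If the bit length is [l + 1], then [2 ^ l <= r], so [l * ln 2] is at most [ln r]. The factor 2
    absorbs the extra [ln 2], which needs [r] to be at least 2. *)
Lemma up_log_le_ln (R : realType) (r : nat) : (1 < r)%N ->
  ((up_log 2 r.+1)%:R <= 2 / ln 2 * ln r%:R :> R).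
Proof.
move=> r1; have ln2 : 0 < ln 2 :> R by rewrite ln_gt0 // ltr1n.
have lr : ln 2 <= ln r%:R :> R by rewrite ler_ln ?posrE ?ltr0n ?ler_nat //; lia.
rewrite mulrAC ler_pdivlMr //.
have := up_log_gtn (isT : (1 < 2)%N) (ltnW r1 : (1 < r.+1)%N); rewrite ltnS.
have : (0 < up_log 2 r.+1)%N by rewrite up_log_gt0 /= ltnS (ltnW r1).
case: up_log => [//|l] _ /= h.
have : l%:R * ln 2 <= ln r%:R :> R.
  by rewrite mulr_natl -lnXn ?ltr0n // -natrX ler_ln ?posrE ?ltr0n ?expn_gt0 ?ler_nat //; lia.
by rewrite -[l.+1]addn1 natrD; lra.
Qed.

Theorem theorem5p1 (R : realType) :
  exists (p : prog) (time : nat -> nat),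
    (forall r : nat, (1 <= r)%N ->
       outputs_set p r (triples_of_adim R r) (time r)) /\
    (fun r : nat => (time r)%:R : R^o) =O_\oo
    (fun r : nat => r%:R ^+ 14 * ln r%:R ^+ 21 : R^o).
Proof.
have [p [C HC]] := prog_correct.
have /choice[time Ht] : forall r : nat, exists t, (0 < r)%N ->
    (t <= C * (r ^ 14 * up_log 2 r.+1 ^ 16))%N /\ outputs_set p r (triples_of_adim R r) t.
  by case=> [|r]; [exists 0%N | have [//|t] := HC R r.+1; exists t].
exists p, time; split=> [r r0|]; first by case: (Ht r r0).
have ln2 : 0 < ln 2 :> R by rewrite ln_gt0 // ltr1n.
have c0 : 0 < 2 / ln 2 :> R by rewrite divr_gt0.
apply/eqO_exP; exists (C.+1%:R * (2 / ln 2) ^+ 21); first by rewrite mulr_gt0 ?exprn_gt0.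
near=> r.
(* At [r = 1] the bound is 0, so the estimate holds only from 2 on. *)
have r1 : (1 < r)%N by near: r; exists 2%N.
have [tle _] := Ht r (ltnW r1).
have lr : 0 <= ln r%:R :> R by rewrite ln_ge0 // ler1n ltnW.
have l0 : (0 < up_log 2 r.+1)%N by rewrite up_log_gt0 /= ltnS (ltnW r1).
rewrite normr_nat ger0_norm ?mulr_ge0 ?exprn_ge0 //.
(* The exponent is raised while the base is the bit length, which is at least 1; [ln r] itself is
   below 1 for [r = 2]. *)
have le16 : ((up_log 2 r.+1)%:R ^+ 16 <= (2 / ln 2 * ln r%:R) ^+ 21 :> R).
  apply: (@le_trans _ _ ((up_log 2 r.+1)%:R ^+ 21)).
    by rewrite ler_weXn2l // ler1n.
  have cl : 0 <= 2 / ln 2 * ln r%:R :> R := mulr_ge0 (ltW c0) lr.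
  by rewrite lerXn2r ?nnegrE ?ler0n ?cl // up_log_le_ln.
rewrite (_ : _ * _ * _ = C.+1%:R * (r%:R ^+ 14 * (2 / ln 2 * ln r%:R) ^+ 21)); last first.
  by rewrite exprMn; ring.
apply: (@le_trans _ _ (C%:R * (r%:R ^+ 14 * (up_log 2 r.+1)%:R ^+ 16))).
  by rewrite -!natrX -!natrM ler_nat.
apply: ler_pM; rewrite ?mulr_ge0 ?exprn_ge0 // ?ler_nat //.
by rewrite ler_wpM2l ?exprn_ge0.
Unshelve. all: by end_near.
Qed.
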